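(* Let $(e^{zN}.F,W)$ be an admissible nilpotent orbit with limit mixed Hodge structure $(F,M)$ split over $\mathbb R$. Let $Y=Y(N,Y_{(F,M)})$ be Deligne's grading of $W$ and $N=N_0+\cdots+N_{-k}$ the decomposition of $N$ relative to $\mathrm{ad}\,Y$, with $N_{-k}\neq 0$. Then, writing $z=x+iy$, $$\|N\|_{(e^{zN}.F,W)}=\|N\|_{(e^{iyN}.F,W)}$$ and there is a non-zero constant $K$ such that $$\lim_{y\to\infty} y^{(2-k)/2}\,\|N\|_{(e^{iyN}.F,W)}=K .$$ In particular, $\|N\|_{(e^{zN}.F,W)}$ is bounded (as $y\to\infty$) for $k=2$ and unbounded for $k>2$.
   Context: Let $V_{\mathbb R}$ be a finite-dimensional real vector space with complexification $V$, increasing filtration $W$ and non-degenerate $(-1)^j$-symmetric forms $Q_j$ on $\mathrm{Gr}^W_j$. A graded-polarized mixed Hodge structure is a decreasing filtration $F$ of $V$ inducing pure weight-$j$ Hodge structures on $\mathrm{Gr}^W_j$ polarized by $Q_j$. Any mixed Hodge structure has a Deligne bigrading: the unique $V=\bigoplus I^{p,q}$ with $F^p=\bigoplus_{a\ge p}I^{a,b}$, $W_j\otimes\mathbb C=\bigoplus_{a+b\le j}I^{a,b}$, $\overline{I^{p,q}}\equiv I^{q,p}$ mod $\bigoplus_{a<p,b<q}I^{a,b}$; it is split over $\mathbb R$ if $\overline{I^{p,q}}=I^{q,p}$. $Y_{(F,W)}$ is the semisimple endomorphism acting as $p+q$ on $I^{p,q}_{(F,W)}$. The mixed Hodge metric makes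 the $I^{p,q}$ mutually orthogonal and on $I^{p,q}\simeq H^{p,q}\subset \mathrm{Gr}^W_{p+q}\otimes\mathbb C$ equals $Q_{p+q}(Cx,\bar y)$ with $C=i^{p-q}$; on endomorphisms of $V$ it induces $h(\alpha,\beta)=\mathrm{Tr}(\alpha\beta^* )$, with norm $\|\cdot\|_{(F,W)}$. $D$ is the classifying space of the graded-polarized mixed Hodge structures with given Hodge numbers, $\check D$ its compact dual (orbit of $D$ under the complex automorphism group of $(V,W,Q)$), and $\mathfrak g_{\mathbb R}$ the Lie algebra of real endomorphisms preserving $W$ and acting as infinitesimal isometries of $Q$ on $\mathrm{Gr}^W$. Admissible nilpotent orbit: $N\in\mathfrak g_{\mathbb R}$ nilpotent and $F\in\check D$ with $N(F^p)\subseteq F^{p-1}$, such that the relative weight filtration $M=M(N,W)$ exists ($NM_j\subset M_{j-2}$ and $M$ induces on $\mathrm{Gr}^W_j$ the monodromy weight filtration of $N$ centered at $j$), and $e^{zN}.F\in D$ for $\mathrm{Im}(z)$ sufficiently large. Then $(F,M)$ is a mixed Hodge structure, the limit mixed Hodge structure. Deligne's grading: a grading of $W$ is a semisimple endomorphism $Y$ with integral eigenvalues such that $W_j=\bigoplus_{\ell\le j}E_\ell(Y)$. Let $Y_M=Y_{(F,M)}$, which preserves $W$ and satisfies $[Y_M,N]=-2N$. Given a grading $Y$ of $W$ commuting with $Y_M$, write $N=\sum_{j\ge0}N_{-j}$ with $[Y,N_{-j}]=-jN_{-j}$. The pair $(\mathrm{Gr}^W(N),\mathrm{Gr}^W(Y_M)-\mathbf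 Y)$, where $\mathbf Y$ acts as $j$ on $\mathrm{Gr}^W_j$, is an $\mathrm{sl}_2$-pair; $N_0^+$ denotes the lift, commuting with $Y$, of the third (raising) element of the associated $\mathrm{sl}_2$-triple. By a theorem of Deligne there is a unique grading $Y=Y(N,Y_M)$ of $W$ with $[Y,Y_M]=0$ and $[N-N_0,N_0^+]=0$. The statements concern $y=\mathrm{Im}(z)$ large enough that $e^{zN}.F\in D$.
   Formalization: In the Deligne bigrading, the conjugate of I^{p,q} is taken congruent to I^{q,p} modulo the sum of I^{a,b} with a<q, b<p (the standard condition), since with the printed indices a<p, b<q the bigrading, and so the norm, need not exist. *)

(* Defs.v *)
From HB Require Import structures.
From mathcomp Require Import all_boot all_order all_algebra.
From mathcomp Require Import all_classical all_reals all_analysis.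
From mathcomp Require Import complex.

Set Implicit Arguments.
Unset Strict Implicit.
Unset Printing Implicit Defensive.

Import Order.TTheory GRing.Theory Num.Theory.
Import numFieldNormedType.Exports.

Local Open Scope classical_set_scope.
Local Open Scope ring_scope.

(* Conventions.  V_R = R^n and V = C^n are spaces of row vectors; a subspace
   is the row space of a square matrix (scope %MS of mxalgebra); an
   endomorphism A acts on the right, v |-> v *m A.  Thus the composite
   "A after B" is B *m A.  A subspace or an object living on the quotient
   Gr^W_j = W_j / W_(j-1) is described by its preimage in W_j. *)

Section Algebra.
Variables (K : fieldType) (n : nat).
Implicit Types (A B N : 'M[K]_n) (W L : int -> 'M[K]_n).

Definition form (Q : 'M[K]_n) (u v : 'rV[K]_n) : K := (u *m Q *m v^T) 0 0.

(* The operator bracket A o B - B o A, for the right action on row vectors. *)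
Definition lie A B : 'M[K]_n := B *m A - A *m B.

(* e^A for nilpotent A: then A ^+ n = 0, so that the series stops before n. *)
Definition expmx A : 'M[K]_n := \sum_(j < n) ((j : nat)`!%:R)^-1 *: A ^+ j.

Definition increasing_filtration W : Prop :=
  [/\ forall i j, i <= j -> (W i <= W j)%MS,
      exists a, W a = 0
    & exists b, (W b == 1%:M)%MS].

Definition decreasing_filtration W : Prop :=
  [/\ forall i j, i <= j -> (W j <= W i)%MS,
      exists a, (W a == 1%:M)%MS
    & exists b, W b = 0].

(* The subspace of Gr^W_j induced by A (as a preimage in W_j). *)
Definition induced W (j : int) A : 'M[K]_n := (A :&: W j + W (j - 1))%MS.

(* A induces the zero map on Gr^W_j. *)
Definition gr_zero W (j : int) A : Prop := (W j *m A <= W (j - 1))%MS.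

(* L (preimages in T of an increasing filtration of T / B) is the monodromy
   weight filtration, centered at c, of the endomorphism of T / B induced by
   N; the last two clauses say that N^l is an isomorphism from the graded
   piece of index c + l onto the one of index c - l. *)
Definition monodromy_weight_filtration (B T N : 'M[K]_n) (c : int) L : Prop :=
  [/\ forall i, (B <= L i)%MS && (L i <= T)%MS,
      forall i j, i <= j -> (L i <= L j)%MS,
      exists a, (L a == B)%MS,
      exists b, (L b == T)%MS
    & [/\ forall i, (L i *m N <= L (i - 2%:Z))%MS,
          forall l : nat,
            (L (c - l%:Z) <= L (c + l%:Z)%R *m N ^+ l + L (c - l%:Z - 1))%MS
        & forall (l : nat) (u : 'rV[K]_n),
            (u <= L (c + l%:Z)%R)%MS -> (u *m N ^+ l <= L (c - l%:Z - 1))%MS ->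
            (u <= L (c + l%:Z - 1)%R)%MS]].

Definition relative_weight_filtration N W (M : int -> 'M[K]_n) : Prop :=
  [/\ increasing_filtration M,
      forall j, (M j *m N <= M (j - 2%:Z))%MS
    & forall j, monodromy_weight_filtration (W (j - 1)) (W j) N j
                  (fun i => induced W j (M i))].

(* Q j is a matrix of a bilinear form on V_R, of which only the restriction to
   W j matters: it is (-1)^j-symmetric there with radical exactly W (j - 1),
   i.e. it is the same as a nondegenerate form on Gr^W_j. *)
Definition graded_forms W (Q : int -> 'M[K]_n) : Prop :=
  (forall j (u v : 'rV[K]_n), (u <= W j)%MS -> (v <= W j)%MS ->
     form (Q j) u v = (-1) ^ j * form (Q j) v u) /\
  (forall j (u : 'rV[K]_n), (u <= W j)%MS ->
     ((u <= W (j - 1))%MS <->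
      forall v : 'rV[K]_n, (v <= W j)%MS -> form (Q j) u v = 0)).

Definition preserves W A : Prop := forall j, (W j *m A <= W j)%MS.

Definition infinitesimal_isometry W (Q : int -> 'M[K]_n) A : Prop :=
  preserves W A /\
  forall j (u v : 'rV[K]_n), (u <= W j)%MS -> (v <= W j)%MS ->
    form (Q j) (u *m A) v + form (Q j) u (v *m A) = 0.

Definition graded_isometry W (Q : int -> 'M[K]_n) A : Prop :=
  [/\ A \in unitmx, preserves W A
    & forall j (u v : 'rV[K]_n), (u <= W j)%MS -> (v <= W j)%MS ->
        form (Q j) (u *m A) (v *m A) = form (Q j) u v].

Definition is_grading W A : Prop :=
  [/\ diagonalizable A,
      forall a, eigenvalue A a -> exists l : int, a = l%:~R
    & forall j, (W j ==
        \big[addsmx/0]_(l \in [set l : int | (l <= j)%R])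
           eigenspace A (l%:~R))%MS].

(* N = N_0 + N_(-1) + ... + N_(-k), where Nd j stands for N_(-j). *)
Definition ad_decomposition A N (k : nat) (Nd : nat -> 'M[K]_n) : Prop :=
  N = \sum_(j < k.+1) Nd j /\
  forall j, (j <= k)%N -> lie A (Nd j) = - (j%:R *: Nd j).

(* On each Gr^W_j, the maps induced by N, by YM - j and by Np satisfy the
   relations of an sl_2-triple (lowering, semisimple, raising). *)
Definition gr_sl2_triple W N YM Np : Prop :=
  forall j : int, let H := YM - (j%:~R)%:M in
  [/\ gr_zero W j (lie H N + 2%:R *: N),
      gr_zero W j (lie H Np - 2%:R *: Np)
    & gr_zero W j (lie Np N - H)].

Definition deligne_grading W N YM (Y : 'M[K]_n) : Prop :=
  [/\ is_grading W Y, lie Y YM = 0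
    & exists (k : nat) (Nd : nat -> 'M[K]_n) (Np : 'M[K]_n),
        [/\ ad_decomposition Y N k Nd, gr_sl2_triple W N YM Np,
            lie Y Np = 0 & lie (N - Nd 0%N) Np = 0]].

End Algebra.

Section Hodge.
Variables (R : realType) (n : nat).
Local Notation C := R[i].
Implicit Types (W Q M : int -> 'M[R]_n) (F : int -> 'M[C]_n).
Implicit Types (I : int -> int -> 'M[C]_n) (A : 'M[C]_n).

Definition cx m (A : 'M[R]_(m, n)) : 'M[C]_(m, n) := map_mx (real_complex R) A.
Definition bar m (A : 'M[C]_(m, n)) : 'M[C]_(m, n) := map_mx Num.conj A.

Definition cxf W : int -> 'M[C]_n := fun j => cx (W j).

Definition filtration_act F A : int -> 'M[C]_n := fun p => F p *m A.

(* Preimage in W_(p+q) of H^(p,q) = F^p Gr :&: bar (F^q Gr). *)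
Definition hodge_piece F W (p q : int) : 'M[C]_n :=
  (induced (cxf W) (p + q)%R (F p) :&: induced (cxf W) (p + q)%R (bar (F q)))%MS.

(* F^p Gr^W_j and bar (F^(j+1-p) Gr^W_j) are complementary in Gr^W_j. *)
Definition is_mhs F W : Prop :=
  decreasing_filtration F /\
  forall j p : int,
    let A := induced (cxf W) j (F p) in
    let B := induced (cxf W) j (bar (F (j + 1 - p))) in
    (A + B == cxf W j)%MS /\ (A :&: B == cxf W (j - 1))%MS.

Definition polarized F W Q : Prop :=
  (forall (j p : int) (u v : 'rV[C]_n),
     (u <= induced (cxf W) j (F p))%MS ->
     (v <= induced (cxf W) j (F (j + 1 - p)%R))%MS ->
     form (cxf Q j) u v = 0) /\
  (forall (p q : int) (u : 'rV[C]_n),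
     (u <= hodge_piece F W p q)%MS -> ~~ (u <= cxf W (p + q - 1)%R)%MS ->
     0 < ('i : C) ^ (p - q) * form (cxf Q (p + q)) u (bar u)).

Definition has_hodge_numbers F W (h : int -> int -> nat) : Prop :=
  forall p q : int,
    \rank (hodge_piece F W p q) = (h p q + \rank (cxf W (p + q - 1)%R))%N.

Definition in_D W Q (h : int -> int -> nat) F : Prop :=
  [/\ is_mhs F W, polarized F W Q & has_hodge_numbers F W h].

Definition in_Dcheck W Q (h : int -> int -> nat) F : Prop :=
  exists (F0 : int -> 'M[C]_n) (g : 'M[C]_n),
    [/\ in_D W Q h F0, graded_isometry (cxf W) (cxf Q) g
      & forall p, (F p == filtration_act F0 g p)%MS].

(* Sum of the I a b over the pairs (a, b) in S. *)
Definition bigsum I (S : set (int * int)) : 'M[C]_n :=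
  (\big[addsmx/0]_(ab \in S) I ab.1 ab.2)%MS.

(* Only finitely many pieces are nonzero; V is their sum, and the sum is direct
   because the ranks add up to n.  The congruence is the usual one: the
   conjugate of I^(p,q) is I^(q,p) modulo the I^(a,b) with a < q and b < p. *)
Definition is_deligne_bigrading F W I : Prop :=
  [/\ finite_set [set ab : int * int | I ab.1 ab.2 != 0],
      (bigsum I setT == 1%:M)%MS
        /\ (\big[addn/0%N]_(ab \in [set: int * int]) \rank (I ab.1 ab.2) = n)%N,
      forall p, (F p == bigsum I [set ab | (p <= ab.1)%R])%MS,
      forall j, (cxf W j == bigsum I [set ab | (ab.1 + ab.2 <= j)%R])%MS
    & forall p q,
        let S := bigsum I [set ab | (ab.1 < q)%R /\ (ab.2 < p)%R] in
        (bar (I p q) + S == I q p + S)%MS].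

(* "The" bigrading, metric, etc. are selected by xget, with an irrelevant
   default when (F, W) is not a (graded-polarized) mixed Hodge structure. *)
Definition deligne_bigrading F W : int -> int -> 'M[C]_n :=
  xget (fun _ _ => 0) [set I | is_deligne_bigrading F W I].

Definition split_mhs F W : Prop :=
  is_mhs F W /\
  exists I, is_deligne_bigrading F W I /\
    forall p q, (bar (I p q) == I q p)%MS.

(* Y_(F,W): multiplication by p + q on I^(p,q). *)
Definition deligne_Y F W : 'M[C]_n :=
  xget 0 [set A | forall p q,
    deligne_bigrading F W p q *m A = (p + q)%:~R *: deligne_bigrading F W p q].

(* A hermitian form is given by its Gram matrix G, as u *m G *m (bar v)^T. *)
Definition is_mixed_hodge_metric F W Q (G : 'M[C]_n) : Prop :=
  forall (p q r s : int) (u v : 'rV[C]_n),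
    (u <= deligne_bigrading F W p q)%MS ->
    (v <= deligne_bigrading F W r s)%MS ->
    form G u (bar v) =
      if (p == r) && (q == s)
      then form (cxf Q (p + q)) (('i : C) ^ (p - q) *: u) (bar v) else 0.

Definition mixed_hodge_metric F W Q : 'M[C]_n :=
  xget 0 [set G | is_mixed_hodge_metric F W Q G].

(* The solution B of (u A) G (bar v)^T = u G (bar (v B))^T for all u, v. *)
Definition adjoint (G A : 'M[C]_n) : 'M[C]_n :=
  (bar (invmx G *m A *m G))^T.

Definition mhnorm F W Q A : R :=
  Num.sqrt (complex.Re (\tr (A *m adjoint (mixed_hodge_metric F W Q) A))).

Definition orbit_at (N : 'M[R]_n) F (z : C) : int -> 'M[C]_n :=
  filtration_act F (expmx (z *: cx N)).

Definition admissible_nilpotent_orbit W Q (h : int -> int -> nat)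
    (N : 'M[R]_n) F M : Prop :=
  [/\ infinitesimal_isometry W Q N /\ exists m : nat, N ^+ m = 0,
      in_Dcheck W Q h F,
      forall p, (F p *m cx N <= F (p - 1))%MS,
      relative_weight_filtration N W M
    & exists y0 : R, forall x y : R, y0 < y ->
        in_D W Q h (orbit_at N F (x +i* y)%C)].

End Hodge.

(* Main.v *)
From Pilot Require Import Defs.
From HB Require Import structures.
From mathcomp Require Import all_boot all_order all_algebra.
From mathcomp Require Import all_classical all_reals all_analysis.
From mathcomp Require Import complex.
From mathcomp Require Import ring zify.

Set Implicit Arguments.
Unset Strict Implicit.
Unset Printing Implicit Defensive.

Import Order.TTheory GRing.Theory Num.Theory.
Import numFieldNormedType.Exports.

Local Open Scope classical_set_scope.
Local Open Scope ring_scope.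

(** Idea of the proof.

    Direct sum decompositions are handled through their projections
    ([grading]).  Let I^(p,q) be the bigrading of the limit (F, M), P the
    operator p on I^(p,q), Y_M = Y_(F,M), Y Deligne's grading of W and E the
    raising operator N_0^+, so that (E, H, N_0) with H = Y_M - Y is an
    sl_2-triple on V.

    Position of Y.  Deligne's conditions determine Y and E ([deligne_uniq]).
    Conjugating them by complex conjugation shows that Y and E are real;
    conjugating them by 2^P, which multiplies N by 2, shows that Y commutes
    with P and that [P, E] = E ([deligne_P]).  The second step is legitimate
    only if P preserves W.  This is where the orbit lying in D enters
    ([W_stable]): for the Hodge structure of weight l carried by the
    l-eigenspace of Y_M, the piece of W_j in it has Hodge slope at most l / 2,
    while purity of Gr^W_j and the vanishing of the trace of the commutator
    H on Gr^W_j force the total slope to be the extremal one; so each of these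
    pieces is a sum of its intersections with the I^(p,q).

    Bigrading along the orbit.  Let z be purely imaginary and let J^(p,q) be
    the simultaneous eigenspaces of P and Y, for the values p and p + q.  They
    split F and W, and so do their images under G = e^(cE) e^(zN) for e^(zN).F
    and W, because e^(cE) preserves F and W.  For c = -1 / (2z) the element
    e^(cE) e^(2z N_0) e^(cE) is the Weyl element of SL_2; it carries J^(q,p) to
    the conjugate of J^(p,q), and the remaining discrepancy between G and its
    conjugate lies in the algebra generated by the (ad N_0)^m N_(-j), j > 0.
    By the representation theory of sl_2 these operators lower both p and q
    ([lower_strict]), which is exactly the congruence required of Deligne's
    bigrading of (e^(zN).F, W) ([cayley_bigraded]).

    Change of the base point.  The real operator A_r acting as r^(-l) on the
    l-eigenspace of Y_M preserves F and W, satisfies A_r N = r^(-2) N A_r in the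
    row convention, and multiplies Q_j by r^(-2j) ([scaling_isometry]).  Hence
    it carries e^(zN).F to e^(r^2 zN).F, and the metric at r^2 z is transported
    by A_r from the one at z with each piece of weight w multiplied by r^(-2w).
    As e^(-zN) Y e^(zN) acts as w on the pieces of weight w, and N_(-j) has
    degree -j for Y, this yields ||N||^2 at iy as a sum of tau_j y^(j-2),
    j = 0, ..., k ([norm_formula]).  The conjugates of the N_(-j) by e^(zN)
    belong to different eigenvalues of a self-adjoint operator, hence are
    orthogonal, and so tau_k is a positive multiple of the square norm of the
    conjugate of N_(-k) ([norm_polynomial]).  The limit is K = sqrt(tau_k).

    The real part x of z does not matter because e^(xN) is a real isometry
    preserving W and commuting with N ([norm_translate]). *)

(** * Decompositions given by projections *)

Ltac mxnorm := rewrite ?(mulmxDl, mulmxDr, mulmxBl, mulmxBr, mulmxN, mulNmx,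
  mul1mx, mulmx1, mul0mx, mulmx0, mulmxA, =^~ scalemxAl, =^~ scalemxAr).

Section EntryLemmas.
Variables (K : nzRingType) (m n : nat).
Implicit Types A B : 'M[K]_(m, n).
Lemma mxDE A B i j : (A + B) i j = A i j + B i j. Proof. by rewrite mxE. Qed.
Lemma mxNE A i j : (- A) i j = - A i j. Proof. by rewrite mxE. Qed.
Lemma mxZE a A i j : (a *: A) i j = a * A i j. Proof. by rewrite mxE. Qed.
Lemma mx0E i j : (0 : 'M[K]_(m, n)) i j = 0. Proof. by rewrite mxE. Qed.
End EntryLemmas.

Ltac mxlin := mxnorm; apply/matrixP => ? ?; rewrite ?(mxDE, mxNE, mxZE, mx0E); ring.

Section Gradings.
Variables (K : fieldType) (n : nat) (T : eqType).
Implicit Types (X Y : 'M[K]_n) (s : seq T) (e : T -> 'M[K]_n).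

(** The direct sum decomposition of the row space whose [t]-th summand is the
    image of [e t]; only the summands with index in [s] may be nonzero. *)
Definition grading s e : Prop :=
  [/\ uniq s, forall t, t \notin s -> e t = 0,
      forall t u, e t *m e u = if t == u then e t else 0
    & \sum_(t <- s) e t = 1%:M].

Definition proj s e (S : pred T) : 'M[K]_n := \sum_(t <- s | S t) e t.

Definition eigenop s e (f : T -> K) : 'M[K]_n := \sum_(t <- s) f t *: e t.

Section One.
Variables (s : seq T) (e : T -> 'M[K]_n).
Hypothesis ge : grading s e.

Lemma gr_out t : t \notin s -> e t = 0. Proof. by case: ge => _ H _ _; exact: H. Qed.
Lemma gr_mul t u : e t *m e u = if t == u then e t else 0.
Proof. by case: ge => _ _ H _. Qed.
Lemma gr_idem t : e t *m e t = e t. Proof. by rewrite gr_mul eqxx. Qed.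
Lemma gr_orth t u : t != u -> e t *m e u = 0.
Proof. by rewrite gr_mul => /negbTE->. Qed.
Lemma gr_sum : \sum_(t <- s) e t = 1%:M. Proof. by case: ge. Qed.
Lemma gr_uniq : uniq s. Proof. by case: ge. Qed.

Lemma gr_suml X : X = \sum_(t <- s) e t *m X.
Proof. by rewrite -mulmx_suml gr_sum mul1mx. Qed.
Lemma gr_sumr m (X : 'M[K]_(m, n)) : X = \sum_(t <- s) X *m e t.
Proof. by rewrite -mulmx_sumr gr_sum mulmx1. Qed.

Lemma mx_eq_blocks X Y : (forall a b, e a *m X *m e b = e a *m Y *m e b) -> X = Y.
Proof.
move=> H; rewrite (gr_suml X) (gr_suml Y); apply: eq_bigr => a _.
by rewrite [LHS]gr_sumr [RHS]gr_sumr; apply: eq_bigr => b _.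
Qed.

Lemma mx_eq0_blocks X : (forall a b, e a *m X *m e b = 0) -> X = 0.
Proof. by move=> H; apply: mx_eq_blocks => a b; rewrite H mulmx0 mul0mx. Qed.

Lemma gr_sum_pick (V : zmodType) t (F : T -> V) :
  (forall u, u != t -> F u = 0) -> (t \notin s -> F t = 0) ->
  \sum_(u <- s) F u = F t.
Proof.
move=> H Ht; case: (boolP (t \in s)) => [ts|nts].
  by rewrite (bigD1_seq t) ?gr_uniq //= big1 ?addr0.
rewrite (Ht nts) big_seq big1 // => u us; apply: H.
by apply: contra nts => /eqP <-.
Qed.

Lemma gr_projl t (S : pred T) : e t *m proj s e S = if S t then e t else 0.
Proof.
rewrite /proj mulmx_sumr big_mkcond (@gr_sum_pick _ t) /=.
- by case: (S t); rewrite ?gr_idem.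
- by move=> u ut; rewrite gr_orth 1?eq_sym ?ut // if_same.
- by move=> /gr_out->; rewrite mul0mx if_same.
Qed.

Lemma gr_projr t (S : pred T) : proj s e S *m e t = if S t then e t else 0.
Proof.
rewrite /proj mulmx_suml big_mkcond (@gr_sum_pick _ t) /=.
- by case: (S t); rewrite ?gr_idem.
- by move=> u ut; rewrite gr_orth ?ut // if_same.
- by move=> /gr_out->; rewrite mulmx0 if_same.
Qed.

Lemma projM (S S' : pred T) : proj s e S *m proj s e S' = proj s e (predI S S').
Proof.
rewrite {1}/proj mulmx_suml /proj big_mkcond [RHS]big_mkcond /=.
by apply: eq_bigr => t _; rewrite gr_projl; case: (S t); case: (S' t).
Qed.

Lemma proj_compl (S : pred T) : proj s e S + proj s e (predC S) = 1%:M.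
Proof. by rewrite -gr_sum (bigID S). Qed.

Lemma proj_id m (v : 'M[K]_(m, n)) (S : pred T) :
  (forall t, ~~ S t -> v *m e t = 0) -> v *m proj s e S = v.
Proof.
move=> H; rewrite -[RHS]mulmx1 -(proj_compl S) mulmxDr.
rewrite [X in _ = _ + X](_ : _ = 0) ?addr0 // /proj mulmx_sumr big1 //.
Qed.

Lemma proj_idE m (v : 'M[K]_(m, n)) (S : pred T) :
  (v <= proj s e S)%MS -> forall t, ~~ S t -> v *m e t = 0.
Proof.
move=> /submxP[D ->] t /negbTE St.
by rewrite -mulmxA gr_projr St mulmx0.
Qed.

Lemma sub_projP m (v : 'M[K]_(m, n)) (S : pred T) :
  (v <= proj s e S)%MS <-> (forall t, ~~ S t -> v *m e t = 0).
Proof.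
by split; [exact: proj_idE | move=> /proj_id <-; exact: submxMl].
Qed.

Lemma sub_eq_projP m p (U : 'M[K]_(p, n)) (v : 'M[K]_(m, n)) (S : pred T) :
  (U == proj s e S)%MS -> (v <= U)%MS <-> (forall t, ~~ S t -> v *m e t = 0).
Proof. by move/eqmxP=> UE; rewrite UE; exact: sub_projP. Qed.

Lemma sub_proj_id m (v : 'M[K]_(m, n)) (S : pred T) :
  (v <= proj s e S)%MS -> v *m proj s e S = v.
Proof. by move/sub_projP; exact: proj_id. Qed.

Lemma sub_proj_sub (S S' : pred T) : {subset S <= S'} -> (proj s e S <= proj s e S')%MS.
Proof.
move=> sub; apply/sub_projP => t nt; rewrite gr_projr.
by case: ifP => // /sub; rewrite unfold_in (negbTE nt).
Qed.

Lemma gr_sub_proj t (S : pred T) : S t -> (e t <= proj s e S)%MS.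
Proof.
by move=> St; apply/sub_projP => u nu; rewrite gr_orth //; apply: contra nu => /eqP<-.
Qed.

Lemma gr_idr m (v : 'M[K]_(m, n)) t : (v <= e t)%MS -> v *m e t = v.
Proof. by move=> /submxP[D ->]; rewrite -mulmxA gr_idem. Qed.

Lemma gr_orthr m (v : 'M[K]_(m, n)) t u : (v <= e t)%MS -> t != u -> v *m e u = 0.
Proof. by move=> /submxP[D ->] tu; rewrite -mulmxA gr_orth ?mulmx0. Qed.

Lemma sub_blocks m p (U : 'M[K]_(m, n)) (V : 'M[K]_(p, n)) :
  (forall t, (U *m e t <= V)%MS) -> (U <= V)%MS.
Proof. by move=> H; rewrite (gr_sumr U); apply: summx_sub. Qed.

(** Repeats an idempotent, so that it can be attached to both neighbours. *)
Lemma gr_split m p t (A : 'M[K]_(m, n)) X (B : 'M[K]_(n, p)) :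
  A *m e t *m X *m B = A *m e t *m (e t *m X *m B).
Proof. by rewrite !mulmxA -(mulmxA A (e t) (e t)) gr_idem. Qed.

Lemma eigenopl f t : e t *m eigenop s e f = f t *: e t.
Proof.
rewrite /eigenop mulmx_sumr (gr_sum_pick (t := t)) => [|u ut|/gr_out->].
- by rewrite -scalemxAr gr_idem.
- by rewrite -scalemxAr gr_orth 1?eq_sym // scaler0.
- by rewrite mul0mx.
Qed.

Lemma eigenopr f t : eigenop s e f *m e t = f t *: e t.
Proof.
rewrite /eigenop mulmx_suml (gr_sum_pick (t := t)) => [|u ut|/gr_out->].
- by rewrite -scalemxAl gr_idem.
- by rewrite -scalemxAl gr_orth // scaler0.
- by rewrite scaler0 mul0mx.
Qed.

Lemma eigenop_unit f : (forall t, f t != 0) -> eigenop s e f \in unitmx.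
Proof.
move=> f0; suff : eigenop s e f *m eigenop s e (fun t => (f t)^-1) = 1%:M by case/mulmx1_unit.
apply: mx_eq_blocks => a b; rewrite mulmxA eigenopl -scalemxAl eigenopl scalerA.
by rewrite mulfV // scale1r mulmx1.
Qed.

Lemma eigenop_comm f X : (forall t, X *m e t = e t *m X) -> X *m eigenop s e f = eigenop s e f *m X.
Proof.
move=> h; rewrite /eigenop mulmx_sumr mulmx_suml; apply: eq_bigr => t _.
by rewrite -scalemxAr -scalemxAl h.
Qed.

(** The block of indices a, b of the hypothesis says that (x b - x a) times the
    block of X vanishes. *)
Lemma eigen_comm (x : T -> K) X :
  {in s &, injective x} -> eigenop s e x *m X = X *m eigenop s e x ->
  forall t, X *m e t = e t *m X.
Proof.
move=> xinj H.
have off a b : a != b -> e a *m X *m e b = 0.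
  case: (boolP (a \in s)) => [as_|/gr_out-> _]; last by rewrite !mul0mx.
  case: (boolP (b \in s)) => [bs|/gr_out-> _]; last by rewrite !mulmx0.
  move=> ab; have := congr1 (fun Z => e a *m Z *m e b) H.
  rewrite !mulmxA eigenopl -!scalemxAl -!mulmxA eigenopr -!scalemxAr mulmxA => /eqP.
  rewrite -subr_eq0 -scalerBl scaler_eq0 subr_eq0 => /orP[/eqP /(xinj _ _ as_ bs)|/eqP //].
  by move/eqP; rewrite (negbTE ab).
move=> t; apply: mx_eq_blocks => a b.
have [->|at_] := eqVneq a t; have [->|bt] := eqVneq b t.
- by rewrite !mulmxA gr_idem -!mulmxA gr_idem.
- by rewrite !mulmxA gr_idem (off t b) 1?eq_sym // -!mulmxA gr_orth 1?eq_sym // !mulmx0.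
- by rewrite !mulmxA (gr_orth at_) !mul0mx -!mulmxA gr_idem mulmxA off.
- by rewrite !mulmxA (gr_orth at_) !mul0mx -!mulmxA gr_orth 1?eq_sym // !mulmx0.
Qed.

End One.
End Gradings.

(** * Exponentials of nilpotent matrices *)
Section Exponentials.
Variables (K : numFieldType) (n : nat).
Implicit Types (A B X Z : 'M[K]_n).

Definition divpow A i : 'M[K]_n := (i`!%:R)^-1 *: A ^+ i.

(** The part of e^A X e^B of total degree [m] in A and B. *)
Definition exp_term A X B m : 'M[K]_n :=
  \sum_(i < m.+1) divpow A i *m X *m divpow B (m - i).

Lemma divpowS A i : i.+1%:R *: divpow A i.+1 = A *m divpow A i.
Proof.
rewrite /divpow scalerA -scalemxAr exprS mulmxE; congr (_ *: _).
by rewrite factS natrM invfM mulrA mulfV ?mul1r // pnatr_eq0.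
Qed.

Lemma divpowSr A i : i.+1%:R *: divpow A i.+1 = divpow A i *m A.
Proof.
rewrite divpowS /divpow -scalemxAl -scalemxAr !mulmxE -exprS -exprSr //.
Qed.

(** Taylor coefficients at 0 of the differential equation Z' = A Z + Z B satisfied
    by Z(t) = e^(tA) X e^(tB). *)
Lemma exp_termS A X B m :
  m.+1%:R *: exp_term A X B m.+1 =
  A *m exp_term A X B m + exp_term A X B m *m B.
Proof.
have -> : m.+1%:R *: exp_term A X B m.+1 =
  \sum_(i < m.+2) (i%:R *: divpow A i) *m X *m divpow B (m.+1 - i) +
  \sum_(i < m.+2) divpow A i *m X *m ((m.+1 - i)%:R *: divpow B (m.+1 - i)).
  rewrite -big_split scaler_sumr; apply: eq_bigr => i _ /=.
  rewrite -(scalemxAl i%:R) -(scalemxAl i%:R) -(scalemxAr (m.+1 - i)%:R).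
  have im : (i <= m.+1)%N by rewrite -ltnS.
  by rewrite -scalerDl -natrD (subnKC im).
rewrite [X in X + _]big_ord_recl [X in _ + X]big_ord_recr /= scale0r !mul0mx add0r.
rewrite subnn scale0r mulmx0 addr0 mulmx_sumr mulmx_suml; congr (_ + _).
  by apply: eq_bigr => i _; rewrite divpowS subSS !mulmxA.
apply: eq_bigr => i _; have im : (i <= m)%N by rewrite -ltnS.
by rewrite (subSn im) divpowSr !mulmxA.
Qed.

Lemma exp_term0 A X B : exp_term A X B 0 = X.
Proof.
by rewrite /exp_term big_ord1 /divpow !fact0 invr1 !scale1r !expr0 -!idmxE mul1mx mulmx1.
Qed.

Lemma divpow_nil A i : A ^+ n = 0 -> (n <= i)%N -> divpow A i = 0.
Proof. by move=> An ni; rewrite /divpow -(subnK ni) exprD An mulr0 scaler0. Qed.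

Lemma exp_term_nil A X B m : A ^+ n = 0 -> B ^+ n = 0 -> (n + n <= m)%N ->
  exp_term A X B m = 0.
Proof.
move=> An Bn nm; rewrite /exp_term big1 // => i _.
have [ni|ni] := leqP n i; first by rewrite (divpow_nil An ni) !mul0mx.
by rewrite (divpow_nil (A := B)) ?mulmx0 //; lia.
Qed.

Lemma exp_prod A X B M : A ^+ n = 0 -> B ^+ n = 0 -> (n + n <= M)%N ->
  expmx A *m X *m expmx B = \sum_(m < M) exp_term A X B m.
Proof.
move=> An Bn nM; rewrite -(big_mkord xpredT (exp_term A X B)).
under eq_big_nat => m /andP[_ mM].
  rewrite /exp_term -(big_mkord xpredT (fun i => divpow A i *m X *m divpow B (m - i))).
  rewrite (big_nat_widen 0 m.+1 M) //; over.
rewrite (exchange_big_dep_nat xpredT) //=.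
rewrite /expmx !mulmx_suml (big_cat_nat (n := n)) //=; last by lia.
rewrite [X in _ = _ + X]big_nat_cond [X in _ = _ + X]big1 ?addr0; last first.
  move=> i /andP[/andP[ni _] _]; rewrite big1 // => m _.
  by rewrite (divpow_nil An ni) !mul0mx.
rewrite big_mkord; apply: eq_bigr => i _.
rewrite -/(divpow A i) mulmx_sumr.
have -> : \sum_(0 <= m < M | (i < m.+1)%N) divpow A i *m X *m divpow B (m - i) =
    \sum_(0 + i <= m < M) divpow A i *m X *m divpow B (m - i).
  by rewrite [RHS](big_nat_widenl _ 0).
rewrite big_addn.
have ni := ltn_ord i.
rewrite (big_cat_nat (n := n)) //=; last by lia.
rewrite [X in _ = _ + X]big_nat_cond [X in _ = _ + X]big1 ?addr0; last first.
  by move=> j /andP[/andP[nj _] _]; rewrite addnK (divpow_nil Bn nj) mulmx0.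
by rewrite big_mkord; apply: eq_bigr => j _; rewrite addnK.
Qed.

(** Each term of positive degree is obtained from A X + X B by iterating
    Z |-> A Z + Z B, up to a scalar ([exp_termS]). *)
Lemma exp_conj_ind (P : 'M[K]_n -> Prop) A X B :
  A ^+ n = 0 -> B ^+ n = 0 ->
  P 0 -> (forall Y Z, P Y -> P Z -> P (Y + Z)) ->
  (forall a Y, P Y -> P (a *: Y)) ->
  P (A *m X + X *m B) -> (forall Z, P Z -> P (A *m Z + Z *m B)) ->
  P (expmx A *m X *m expmx B - X).
Proof.
move=> An Bn P0 PD PZ PX PS.
rewrite (@exp_prod _ _ _ (n + n).+1) // big_ord_recl exp_term0 addrC addrA addNr add0r.
have H m : P (exp_term A X B m.+1).
  elim: m => [|m IH].
    by have := exp_termS A X B 0; rewrite exp_term0 scale1r => ->.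
  rewrite -[exp_term _ _ _ _]scale1r -(mulVf (x := m.+2%:R)) ?pnatr_eq0 //.
  by rewrite -scalerA exp_termS; apply: PZ; apply: PS.
by elim/big_ind: _ => // i _; exact: H.
Qed.

Lemma exp_conj2 A B X Z Z' : A ^+ n = 0 -> B ^+ n = 0 ->
  A *m X + X *m B = Z -> A *m Z + Z *m B = Z' -> A *m Z' + Z' *m B = 0 ->
  expmx A *m X *m expmx B = X + Z + 2^-1 *: Z'.
Proof.
move=> An Bn HX HZ HZ'.
rewrite (@exp_prod _ _ _ (n + n).+3) //; last by lia.
have e1 : exp_term A X B 1 = Z.
  by have := exp_termS A X B 0; rewrite exp_term0 scale1r HX.
have e2 : exp_term A X B 2 = 2^-1 *: Z'.
  have := exp_termS A X B 1; rewrite e1 HZ => <-.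
  by rewrite scalerA mulVf ?scale1r // pnatr_eq0.
have e3 m : exp_term A X B m.+3 = 0.
  elim: m => [|m IH].
    apply/(scalerI (a := 3%:R)); rewrite ?pnatr_eq0 // exp_termS e2 scaler0.
    by rewrite -scalemxAr -scalemxAl -scalerDr HZ' scaler0.
  apply/(scalerI (a := m.+4%:R)); rewrite ?pnatr_eq0 // exp_termS IH scaler0.
  by rewrite mulmx0 mul0mx addr0.
rewrite !big_ord_recl exp_term0 /= e1 e2 big1 ?addr0 ?addrA //.
Qed.

(** The two sides have the same terms in each degree, by the recursion [exp_termS]
    for X = 1. *)
Lemma expmxD A B : A *m B = B *m A -> A ^+ n = 0 -> B ^+ n = 0 ->
  (A + B) ^+ n = 0 -> expmx A *m expmx B = expmx (A + B).
Proof.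
move=> AB An Bn ABn; rewrite -{1}[expmx A]mulmx1 (@exp_prod _ _ _ (n + n)) //.
have H m : exp_term A 1%:M B m = divpow (A + B) m.
  have AX m' : divpow (A + B) m' *m B = B *m divpow (A + B) m'.
    rewrite /divpow -scalemxAr -scalemxAl; congr (_ *: _); apply/esym.
    by apply: commrX; rewrite /GRing.comm mulrDl mulrDr; congr (_ + _).
  elim: m => [|m IH].
    by rewrite exp_term0 /divpow fact0 invr1 scale1r expr0.
  apply/(scalerI (a := m.+1%:R)); rewrite ?pnatr_eq0 //.
  by rewrite exp_termS IH divpowS AX mulmxDl.
under eq_bigr do rewrite H.
rewrite /expmx big_split_ord /= [X in _ + X]big1 ?addr0 // => i _.
by rewrite divpow_nil // leq_addr.
Qed.

Lemma expmxN A : A ^+ n = 0 -> expmx A *m expmx (- A) = 1%:M.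
Proof.
move=> An; have := @exp_conj_ind (fun Z => Z = 0) A 1%:M (- A) An.
rewrite !mulmx1 mul1mx => H; apply/eqP; rewrite -subr_eq0; apply/eqP; apply: H => //.
- by rewrite exprNn An mulr0.
- by move=> Y Z -> ->; rewrite addr0.
- by move=> a Y ->; rewrite scaler0.
- by rewrite subrr.
- by move=> Z ->; rewrite mulmx0 mul0mx addr0.
Qed.

Lemma expmx_unit A : A ^+ n = 0 -> expmx A \in unitmx.
Proof. by move/expmxN/mulmx1_unit => []. Qed.

Lemma expmx_stable m (U : 'M[K]_(m, n)) A : (U *m A <= U)%MS -> (U *m expmx A <= U)%MS.
Proof.
move=> UA; rewrite /expmx mulmx_sumr; apply: summx_sub => i _.
rewrite -scalemxAr scalemx_sub //; elim: (i : nat) => [|j IH].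
  by rewrite expr0 mulmx1.
by rewrite exprSr -mulmxE mulmxA; apply: submx_trans (submxMr A IH) UA.
Qed.

Lemma expmx_comm A X : X *m A = A *m X -> X *m expmx A = expmx A *m X.
Proof.
move=> H; rewrite /expmx mulmx_sumr mulmx_suml; apply: eq_bigr => i _.
rewrite -scalemxAr -scalemxAl; congr (_ *: _).
by have := commrX i (H : GRing.comm X A).
Qed.

Lemma expmx_intertwine A B X : X *m A = B *m X -> X *m expmx A = expmx B *m X.
Proof.
move=> H; rewrite /expmx mulmx_sumr mulmx_suml; apply: eq_bigr => i _.
rewrite -scalemxAr -scalemxAl; congr (_ *: _); elim: (i : nat) => [|j IH].
  by rewrite !expr0 mulmx1 mul1mx.
by rewrite !exprSr -!mulmxE mulmxA IH -(mulmxA _ X A) H mulmxA.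
Qed.

(** The minimal polynomial is a power of the variable, of degree at most [n]. *)
Lemma nilp_dim A m : A ^+ m = 0 -> A ^+ n = 0.
Proof.
case: n A => [|n'] A Am; first by rewrite thinmx0; apply/matrixP => -[].
have : mxminpoly A %| ('X - 0%:P) ^+ m.
  by apply: mxminpoly_min; rewrite subr0 rmorphXn /= horner_mx_X Am.
move=> /dvdp_exp_XsubCP[k _ eq_k].
have kn : (k <= n'.+1)%N.
  have := dvdp_leq (monic_neq0 (char_poly_monic A)) (mxminpoly_dvd_char A).
  by rewrite size_char_poly (eqp_size eq_k) size_exp_XsubC ltnS.
have : mxminpoly A %| 'X ^+ k by rewrite (eqp_dvdl _ eq_k) subr0.
move/mxminpoly_minP; rewrite rmorphXn /= horner_mx_X => Ak.
have H i : (k <= i)%N -> A ^+ i = 0.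
  by move=> ki; rewrite -(subnK ki) exprD Ak mulr0.
exact: H.
Qed.

End Exponentials.

(** * Representations of sl_2 on matrices *)
Section Weights.
Variables (K : numFieldType) (n : nat).
Implicit Types (A B E F H X Z : 'M[K]_n).

(** Each factor X lowers the height [ht] by at least one, and the heights of the
    nonzero summands are bounded. *)
Lemma lower_nilpotent (T : eqType) (s : seq T) (e : T -> 'M[K]_n) (ht : T -> int) X :
  grading s e -> (forall a b, ~~ (ht b < ht a) -> e a *m X *m e b = 0) ->
  X ^+ n = 0.
Proof.
move=> ge lowX.
have low m a b : ~~ (ht b + m%:Z <= ht a) -> e a *m X ^+ m *m e b = 0.
  elim: m a b => [|m IH] a b.
    rewrite addr0 expr0 -idmxE mulmx1 => hab; rewrite (gr_orth ge) //.
    by apply: contra hab => /eqP->.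
  move=> hab; rewrite exprS -mulmxE mulmxA (gr_sumr ge (e a *m X)).
  rewrite !mulmx_suml big1 // => c _.
  have [hca|hca] := boolP (ht c < ht a); last by rewrite lowX ?mul0mx.
  rewrite -(gr_idem ge c) !mulmxA -(mulmxA _ (e c) (X ^+ m)) -(mulmxA _ (_ *m X ^+ m)).
  by rewrite (IH c b) ?mulmx0 //; apply: contra hab; lia.
pose B := (\sum_(t <- s) `|ht t|)%N.
have bnd t : t \in s -> (`|ht t| <= B)%N.
  by move=> ts; rewrite /B (big_rem t) //= leq_addr.
apply: (@nilp_dim _ _ _ (B + B).+1); apply: (mx_eq0_blocks ge) => a b.
have [as_|/(gr_out ge)->] := boolP (a \in s); last by rewrite !mul0mx.
have [bs|/(gr_out ge)->] := boolP (b \in s); last by rewrite mulmx0.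
by apply: low; have := bnd _ as_; have := bnd _ bs; lia.
Qed.

(** On the string x, e x, e^2 x, ... the operator f maps e^(i+1) x to
    -(i+1)(d+i) e^i x, and this factor is not zero since d > 0.  So if one term of
    the string vanishes, then all do. *)
Lemma sl2_inj (V : lmodType K) (e f h : V -> V) (d : K) x :
  (forall a v, e (a *: v) = a *: e v) -> f 0 = 0 ->
  (forall v, f (e v) = e (f v) - h v) ->
  (forall v, h (e v) = e (h v) + 2 *: e v) ->
  h x = d *: x -> 0 < d -> e (f x) = 0 -> (exists m, iter m e x = 0) -> x = 0.
Proof.
move=> eZ f0 fe he hx d0 efx.
have hw i : h (iter i e x) = (d + 2 * i%:R) *: iter i e x.
  elim: i => [|i IH]; first by rewrite mulr0 addr0.
  by rewrite /= he IH eZ -scalerDl; congr (_ *: _); rewrite -natr1; ring.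
have fw i : f (iter i.+1 e x) = - (i.+1%:R * (d + i%:R)) *: iter i e x.
  elim: i => [|i IH]; first by rewrite /= fe efx hx addr0 mul1r scaleNr sub0r.
  rewrite iterS fe IH eZ -[e (iter i e x)]/(iter i.+1 e x) hw -scalerBl.
  by congr (_ *: _); rewrite -!natr1; ring.
case; elim=> // i IH Hi; apply: IH.
have := fw i; rewrite Hi f0 => /esym/eqP; rewrite scaler_eq0 oppr_eq0 mulf_eq0.
rewrite pnatr_eq0 /= gt_eqF /=; first by move/eqP.
by rewrite ltr_pwDl // ler0n.
Qed.

(** A highest weight vector of weight r - 1 generates a module of dimension at
    most r: e maps f^(i+1) x to (i+1)(r-1-i) f^i x, a nonzero multiple when i >= r,
    so the vanishing of a high term f^m x goes down to f^r x. *)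
Lemma sl2_top (V : lmodType K) (e f h : V -> V) (r : nat) x :
  (forall a v, f (a *: v) = a *: f v) -> e 0 = 0 ->
  (forall v, e (f v) = f (e v) + h v) ->
  (forall v, h (f v) = f (h v) - 2 *: f v) ->
  h x = (r%:R - 1) *: x -> e x = 0 -> (exists m, iter m f x = 0) -> iter r f x = 0.
Proof.
move=> fZ e0 ef hf hx ex.
have f0 : f 0 = 0 by have := fZ 0 0; rewrite !scale0r.
have hw i : h (iter i f x) = (r%:R - 1 - 2 * i%:R) *: iter i f x.
  elim: i => [|i IH]; first by rewrite mulr0 subr0.
  by rewrite /= hf IH fZ -scalerBl; congr (_ *: _); rewrite -natr1; ring.
have ew i : e (iter i.+1 f x) = (i.+1%:R * (r%:R - 1 - i%:R)) *: iter i f x.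
  elim: i => [|i IH]; first by rewrite /= ef ex f0 hx add0r mul1r subr0.
  rewrite iterS ef IH fZ -[f (iter i f x)]/(iter i.+1 f x) hw -scalerDl.
  by congr (_ *: _); rewrite -!natr1; ring.
case=> m; have [mr|/ltnW mr] := leqP m r.
  by move=> fm; rewrite -(subnK mr) iterD fm; elim: (r - m)%N => //= i ->.
rewrite -(subnK mr); elim: (m - r)%N => // i IH Hi; apply: IH.
have := ew (i + r)%N; rewrite -addSn Hi e0 => /esym/eqP; rewrite scaler_eq0 mulf_eq0.
rewrite pnatr_eq0 /=; case/orP => [/eqP|/eqP //] H; exfalso.
have : (i.+1)%:R = 0 :> K by rewrite -[0]oppr0 -H natrD -natr1; ring.
by apply/eqP; rewrite pnatr_eq0.
Qed.

Lemma iter_two_sided A B X m :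
  iter m (fun Z => A *m Z + Z *m B) X = m`!%:R *: exp_term A X B m.
Proof.
elim: m => [|m IH]; first by rewrite exp_term0 fact0 scale1r.
by rewrite iterS IH -scalemxAl -scalemxAr -scalerDr -exp_termS scalerA factS -natrM mulnC.
Qed.

Lemma iter_two_sided_nil A B X : A ^+ n = 0 -> B ^+ n = 0 ->
  iter (n + n) (fun Z => A *m Z + Z *m B) X = 0.
Proof. by move=> An Bn; rewrite iter_two_sided exp_term_nil ?scaler0. Qed.

Lemma lie_two_sided A X : lie A X = (- A) *m X + X *m A.
Proof. by rewrite /lie mulNmx addrC. Qed.

Lemma iter_lie_nil A X : A ^+ n = 0 -> iter (n + n) (lie A) X = 0.
Proof.
move=> An; rewrite (eq_iter (lie_two_sided A)) iter_two_sided_nil //.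
by rewrite exprNn An mulr0.
Qed.

Lemma lieZr A a X : lie A (a *: X) = a *: lie A X.
Proof. by rewrite /lie -scalemxAl -scalemxAr scalerBr. Qed.

Lemma lie0r A : lie A 0 = 0.
Proof. by rewrite /lie mulmx0 mul0mx subr0. Qed.

Lemma lieD A X Z : lie A (X + Z) = lie A X + lie A Z.
Proof. rewrite /lie; mxlin. Qed.

Lemma lieM A X Z : lie A (X *m Z) = lie A X *m Z + X *m lie A Z.
Proof. rewrite /lie; mxlin. Qed.

Lemma lieBl A B X : lie (A - B) X = lie A X - lie B X.
Proof. rewrite /lie; mxlin. Qed.

Lemma lieZl a A X : lie (a *: A) X = a *: lie A X.
Proof. by rewrite /lie -scalemxAl -scalemxAr scalerBr. Qed.

Lemma lieC A X : lie A X = - lie X A.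
Proof. by rewrite /lie opprB. Qed.

Lemma lie_jacobi A B X : lie A (lie B X) = lie B (lie A X) + lie (lie A B) X.
Proof. rewrite /lie; mxlin. Qed.

Lemma ad_inj E F H X (d : K) : lie E F = H -> lie H E = 2 *: E ->
  lie H X = d *: X -> 0 < d -> lie E (lie F X) = 0 -> E ^+ n = 0 -> X = 0.
Proof.
move=> EF HE HX d0 EFX En.
apply: (@sl2_inj _ (lie E) (lie F) (lie H) d) => //.
- exact: lieZr.
- exact: lie0r.
- by move=> v; rewrite (lie_jacobi E F) EF addrK.
- by move=> v; rewrite lie_jacobi HE; congr (_ + _); rewrite /lie; mxlin.
- by exists (n + n)%N; exact: iter_lie_nil.
Qed.

Lemma ad_top E F H X (r : nat) : lie E F = H -> lie H F = - (2 *: F) ->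
  lie H X = (r%:R - 1) *: X -> lie E X = 0 -> F ^+ n = 0 ->
  iter r (lie F) X = 0.
Proof.
move=> EF HF HX EX Fn.
apply: (@sl2_top _ (lie E) (lie F) (lie H) r) => //.
- exact: lieZr.
- exact: lie0r.
- by move=> v; rewrite (lie_jacobi E F) EF.
- by move=> v; rewrite lie_jacobi HF; congr (_ + _); rewrite /lie; mxlin.
- by exists (n + n)%N; exact: iter_lie_nil.
Qed.

End Weights.

Lemma mx_eq_blocks2 (K : fieldType) n (T : eqType) (s s' : seq T) (e e' : T -> 'M[K]_n)
    (X Y : 'M[K]_n) : grading s e -> grading s' e' ->
  (forall a b, e a *m X *m e' b = e a *m Y *m e' b) -> X = Y.
Proof.
move=> ge ge' H; rewrite (gr_suml ge X) (gr_suml ge Y); apply: eq_bigr => a _.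
by rewrite [LHS](gr_sumr ge') [RHS](gr_sumr ge'); apply: eq_bigr => b _.
Qed.

(** * Components of an operator for an integral grading *)
Section DegreeParts.
Variables (K : numFieldType) (n : nat) (s : seq int) (e : int -> 'M[K]_n).
Hypothesis ge : grading s e.
Implicit Types (X Y Z : 'M[K]_n) (a b d : int).

Definition degop : 'M[K]_n := eigenop s e intr.

(** For X = N and the projections of Deligne's grading, this is N_(-d). *)
Definition low d X : 'M[K]_n := \sum_(a <- s) e a *m X *m e (a - d).

Lemma degopl t : e t *m degop = t%:~R *: e t. Proof. exact: eigenopl. Qed.
Lemma degopr t : degop *m e t = t%:~R *: e t. Proof. exact: eigenopr. Qed.

Lemma low_block d X a b :
  e a *m low d X *m e b = if b == a - d then e a *m X *m e b else 0.
Proof.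
rewrite /low mulmx_sumr (@gr_sum_pick _ _ _ _ _ ge _ a) /=.
- rewrite !mulmxA (gr_idem ge) -!mulmxA (gr_mul ge) eq_sym.
  by case: eqP => [->|_]; rewrite ?mulmx0.
- by move=> u ua; rewrite !mulmxA (gr_orth ge) 1?eq_sym // !mul0mx.
- by move/(gr_out ge)->; rewrite !mul0mx.
Qed.

Lemma low_commr d X Z : (forall t, Z *m e t = e t *m Z) -> low d (X *m Z) = low d X *m Z.
Proof.
move=> H; rewrite /low mulmx_suml; apply: eq_bigr => a _.
by rewrite -!mulmxA H.
Qed.

Lemma low_comml d X Z : (forall t, Z *m e t = e t *m Z) -> low d (Z *m X) = Z *m low d X.
Proof.
move=> H; rewrite /low mulmx_sumr; apply: eq_bigr => a _.
by rewrite !mulmxA H.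
Qed.

Lemma lowB d X Y : low d (X - Y) = low d X - low d Y.
Proof.
rewrite /low -sumrB; apply: eq_bigr => a _.
by rewrite mulmxBr mulmxBl.
Qed.

Lemma lowZ d (k : K) X : low d (k *: X) = k *: low d X.
Proof. by rewrite /low scaler_sumr; apply: eq_bigr => i _; rewrite -scalemxAr -scalemxAl. Qed.

Lemma low_lie d X Z : (forall t, X *m e t = e t *m X) -> lie X (low d Z) = low d (lie X Z).
Proof. by move=> H; rewrite /lie lowB low_commr ?low_comml. Qed.

Lemma low0_comm X t : low 0 X *m e t = e t *m low 0 X.
Proof.
apply: (mx_eq_blocks ge) => a b; rewrite !mulmxA.
rewrite -(mulmxA (e a *m low 0 X)) (gr_mul ge t b) (gr_mul ge a t).
have [->|tb] := eqVneq t b; have [->|at_] := eqVneq a b => //.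
- by rewrite low_block subr0 eq_sym (negbTE at_) !mul0mx.
- by rewrite !mulmx0 eq_sym (negbTE tb) !mul0mx.
- rewrite mulmx0; case: eqP => [ab|_]; last by rewrite !mul0mx.
  by rewrite low_block subr0 ab eq_sym (negbTE tb).
Qed.

Lemma lie_degop_block X a b :
  e a *m lie degop X *m e b = (b - a)%:~R *: (e a *m X *m e b).
Proof.
rewrite /lie mulmxBr mulmxBl !mulmxA degopl -!mulmxA degopr.
by rewrite -!(scalemxAr, scalemxAl) -scalerBl rmorphB.
Qed.

Lemma comm_degop X : (forall t, X *m e t = e t *m X) -> lie degop X = 0.
Proof.
by move=> H; rewrite /lie /degop eigenop_comm // subrr.
Qed.

Lemma lie_degop_comm X : lie degop X = 0 -> forall t, X *m e t = e t *m X.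
Proof.
move=> /eqP; rewrite subr_eq0 => /eqP H; apply: (eigen_comm ge (x := intr)) => //.
by move=> a b _ _ /eqP; rewrite eqr_int => /eqP.
Qed.

Lemma low_weight d X : lie degop (low d X) = - (d%:~R *: low d X).
Proof.
apply: (mx_eq_blocks ge) => a b; rewrite lie_degop_block mulmxN mulNmx.
rewrite -scalemxAr -scalemxAl low_block; case: eqP => [->|_]; last by rewrite !scaler0 oppr0.
by rewrite -scaleNr; congr (_ *: _); rewrite -rmorphN; congr (_%:~R); ring.
Qed.

Lemma low_of_weight d X : lie degop X = - (d%:~R *: X) -> low d X = X.
Proof.
move=> H; apply: (mx_eq_blocks ge) => a b; rewrite low_block; case: eqP => // bad.
have := lie_degop_block X a b; rewrite H mulmxN mulNmx -scalemxAr -scalemxAl => /eqP.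
rewrite -scaleNr -subr_eq0 -scalerBl scaler_eq0 => /orP[|/eqP //].
rewrite -rmorphN -rmorphB intr_eq0 => /eqP h; case: bad.
by move: h; lia.
Qed.

Lemma low_weight_off d d' X : lie degop X = - (d%:~R *: X) -> d != d' -> low d' X = 0.
Proof.
move=> H dd; rewrite -(low_of_weight H); apply: (mx_eq0_blocks ge) => a b.
rewrite !low_block; case: eqP => // ->; case: eqP => // /addrI /oppr_inj /esym/eqP.
by rewrite (negbTE dd).
Qed.

(** Triangularity of the factors often leaves a single intermediate degree. *)
Lemma mid_block X Y a b c :
  (forall c', c' != c -> e a *m X *m e c' = 0 \/ e c' *m Y *m e b = 0) ->
  e a *m (X *m Y) *m e b = e a *m X *m e c *m Y *m e b.
Proof.
move=> H; have -> : e a *m (X *m Y) *m e b = \sum_(c' <- s) e a *m X *m e c' *m Y *m e b.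
  by rewrite -!mulmx_suml -(gr_sumr ge) !mulmxA.
apply: (gr_sum_pick ge) => [c' /H [->|h]|/(gr_out ge)->]; rewrite ?(mulmx0, mul0mx) //.
by rewrite -(gr_idem ge c') !mulmxA -(mulmxA _ (e c') Y) -mulmxA h mulmx0.
Qed.

End DegreeParts.

(** * Uniqueness of Deligne's grading *)
Definition upto (j : int) : pred int := fun i => i <= j.
Lemma upto_refl j : upto j j. Proof. exact: lexx. Qed.

Lemma nilp_unitmx (K : fieldType) n (c : 'M[K]_n) : c ^+ n = 0 -> 1%:M + c \in unitmx.
Proof.
move=> cn; have := subrX1 (- c) n; rewrite exprNn cn mulr0 sub0r -mulmxE => H.
have : (1%:M + c) *m (\sum_(i < n) (- c) ^+ i) = 1%:M.
  by apply: oppr_inj; rewrite -mulNmx opprD [X in X *m _]addrC; exact: esym.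
by case/mulmx1_unit.
Qed.

Lemma stable_invmx (K : fieldType) n m (U : 'M[K]_(m, n)) (g : 'M[K]_n) :
  g \in unitmx -> (U *m g <= U)%MS -> (U *m invmx g <= U)%MS.
Proof.
move=> gU Ug; have /mxrank_leqif_eq/geq_leqif := Ug.
rewrite mxrankMfree ?row_free_unit // leqnn => /esym/andP[_ h].
by rewrite -[X in (_ <= X)%MS](mulmxK gU) submxMr.
Qed.

Section DeligneUniqueness.
Variables (K : numFieldType) (n : nat) (W : int -> 'M[K]_n) (N YM : 'M[K]_n).

(** Deligne's conditions on the projections [e] of Y and on E = N_0^+.  The
    relations of the sl_2-triple hold on V, as all operators in them have degree 0
    for Y and may thus be read on Gr^W. *)
Definition deligne_data (s : seq int) (e : int -> 'M[K]_n) (E : 'M[K]_n) : Prop :=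
  [/\ grading s e, forall j, (W j == proj s e (upto j))%MS,
      forall t, YM *m e t = e t *m YM, forall t, E *m e t = e t *m E
    & [/\ lie YM E = 2 *: E, lie E (low s e 0 N) = YM - degop s e
        & lie (N - low s e 0 N) E = 0]].

Hypothesis WN : preserves W N.
Variables (sM : seq int) (eM : int -> 'M[K]_n).
Hypotheses (gM : grading sM eM) (YME : YM = degop sM eM).

Section Filtered.
Variables (s : seq int) (e : int -> 'M[K]_n).
Hypotheses (ge : grading s e) (We : forall j, (W j == proj s e (upto j))%MS).

Lemma preserves_block X a b : preserves W X -> a < b -> e a *m X *m e b = 0.
Proof.
move=> WX ab; have H : (e a *m X <= proj s e (upto a))%MS.
  have /andP[Wa Wa'] := We a; apply: (submx_trans _ Wa); apply: (submx_trans _ (WX a)).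
  by apply: submxMr; apply: (submx_trans _ Wa'); exact: (gr_sub_proj ge (upto_refl _)).
by apply: (proj_idE ge H); rewrite -ltNge.
Qed.

Lemma deg_preserves X : (forall t, X *m e t = e t *m X) -> preserves W X.
Proof.
move=> H j; have /andP[Wj Wj'] := We j.
apply: submx_trans (submxMr X Wj) _; apply: (submx_trans _ Wj').
by apply/(sub_projP ge) => t nt; rewrite -mulmxA H mulmxA (gr_projr ge) (negbTE nt) mul0mx.
Qed.

Lemma preservesP X : (forall a b, a < b -> e a *m X *m e b = 0) -> preserves W X.
Proof.
move=> H j; have /andP[Wj Wj'] := We j.
apply: submx_trans (submxMr X Wj) _; apply: (submx_trans _ Wj').
apply/(sub_projP ge) => t nt; rewrite /proj 2!mulmx_suml big1 // => a aj.
by rewrite H //; move: nt aj; rewrite /upto; lia.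
Qed.

End Filtered.

Variables (s s' : seq int) (e e' : int -> 'M[K]_n) (E E' : 'M[K]_n).
Hypotheses (D : deligne_data s e E) (D' : deligne_data s' e' E').

(** Let g be the unipotent operator intertwining the two gradings of W.  It
    conjugates the degree 0 parts of N into each other; since E is determined by
    N_0 and H ([ad_inj]), it also conjugates E' into E.  Thus [E, g N g^-1 - N] = 0.
    If c = g - 1 were not zero, let -d be the degree of its leading component c_d: the
    component of degree -d of this relation is [E, [N_0, c_d]] = 0, where c_d has
    weight d > 0 for H because g commutes with Y_M; so c_d = 0 by [ad_inj]. *)
Lemma deligne_uniq : (forall t, e t = e' t) /\ E = E'.
Proof.
case: D => ge We YMe Ee [YE EN NE]; case: D' => ge' We' YMe' Ee' [YE' EN' NE'].
have lo a b : a < b -> e a *m e' b = 0.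
  move=> ab; apply: (proj_idE ge' (S := fun i => i <= a)); last by rewrite /upto -ltNge.
  have /andP[Wa _] := We' a; have /andP[_ Wa'] := We a.
  apply: (submx_trans _ Wa); apply: (submx_trans _ Wa').
  exact: (gr_sub_proj ge (upto_refl _)).
have lo' a b : a < b -> e' a *m e b = 0.
  move=> ab; apply: (proj_idE ge (S := fun i => i <= a)); last by rewrite /upto -ltNge.
  have /andP[Wa _] := We a; have /andP[_ Wa'] := We' a.
  apply: (submx_trans _ Wa); apply: (submx_trans _ Wa').
  exact: (gr_sub_proj ge' (upto_refl _)).
pose g := \sum_(t <- s) e t *m e' t.
have eg t : e t *m g = e t *m e' t.
  rewrite mulmx_sumr (gr_sum_pick ge (t := t)) /= ?mulmxA ?(gr_idem ge) //.
    by move=> u ut; rewrite mulmxA (gr_orth ge) 1?eq_sym // mul0mx.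
  by move/(gr_out ge)->; rewrite !mul0mx.
have ge_ t : g *m e' t = e t *m e' t.
  rewrite mulmx_suml (gr_sum_pick ge (t := t)) /= -?mulmxA ?(gr_idem ge') //.
    by move=> u ut; rewrite -mulmxA (gr_orth ge') // mulmx0.
  by move/(gr_out ge)->; rewrite !mul0mx.
pose c := g - 1%:M.
have cE : g = 1%:M + c by rewrite /c addrC subrK.
have clow a b : ~~ (b < a) -> e a *m c *m e b = 0.
  rewrite -leNgt => ab; rewrite /c mulmxBr mulmx1 eg.
  have -> : e a *m e' a - e a = - \sum_(i <- s' | i != a) e a *m e' i.
    rewrite {2}(gr_sumr ge' (e a)) -[X in X = _]opprK opprB; congr (- _).
    apply/eqP; rewrite subr_eq addrC; apply/eqP.
    have [as_|as_] := boolP (a \in s'); first by rewrite (bigD1_seq a) ?(gr_uniq ge').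
    rewrite (gr_out ge' as_) mulmx0 add0r [RHS]big_seq_cond [LHS]big_seq_cond.
    apply: eq_bigl => i; rewrite andbT; case: (boolP (i \in s')) => //= is_.
    by apply/esym; apply: contra as_ => /eqP<-.
  rewrite mulNmx mulmx_suml big1 ?oppr0 // => i ia.
  have [ai|ai] := ltP a i; first by rewrite lo ?mul0mx.
  by rewrite -mulmxA lo' ?mulmx0 // lt_neqAle; lia.
have ccomm : YM *m c = c *m YM.
  rewrite /c mulmxBr mulmxBl mulmx1 mul1mx /g mulmx_sumr mulmx_suml; congr (_ - _).
  by apply: eq_bigr => t _; rewrite mulmxA YMe -mulmxA YMe' mulmxA.
have cn : c ^+ n = 0 by apply: (lower_nilpotent (ht := id) ge) => a b; exact: clow.
have gU : g \in unitmx by rewrite cE nilp_unitmx.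
have cancel A B : A *m g = B *m g -> A = B by move/(congr1 (mulmx^~ (invmx g))); rewrite /= !mulmxK.
have gX X : preserves W X -> g *m low s' e' 0 X = low s e 0 X *m g.
  move=> WX; apply: (mx_eq_blocks2 ge ge') => a b.
  rewrite !mulmxA eg -(mulmxA (e a) (e' a)) -(mulmxA (e a) (e' a *m _)) (low_block ge').
  rewrite -(mulmxA _ g) ge_ mulmxA (low_block ge) subr0.
  case: eqP => [->|_]; last by rewrite mulmx0 mul0mx.
  rewrite !mulmxA; transitivity (e a *m X *m e' a).
    rewrite [RHS](_ : _ = e a *m (1%:M *m X) *m e' a); last by rewrite mul1mx.
    rewrite -(gr_sum ge') mulmx_suml mulmx_sumr mulmx_suml.
    rewrite (gr_sum_pick ge' (t := a)) ?mulmxA // => [i ia|/(gr_out ge')->]; last by rewrite !(mulmx0, mul0mx).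
    have [ai|ai] := ltP a i; first by rewrite !mulmxA lo // !mul0mx.
    rewrite -!mulmxA (mulmxA (e' i)) (preserves_block ge' We') ?mulmx0 // lt_neqAle; lia.
  rewrite [LHS](_ : _ = e a *m X *m (1%:M *m e' a)); last by rewrite mul1mx.
  rewrite -(gr_sum ge) mulmx_suml mulmx_sumr.
  rewrite (gr_sum_pick ge (t := a)) ?mulmxA // => [i ia|/(gr_out ge)->]; last by rewrite !(mulmx0, mul0mx).
  have [ai|ai] := ltP a i; first by rewrite mulmxA (preserves_block ge We) // !mul0mx.
  by rewrite lo ?mulmx0 // lt_neqAle; lia.
have gY : g *m degop s' e' = degop s e *m g.
  apply: (mx_eq_blocks2 ge ge') => a b.
  rewrite -!mulmxA (degopr ge') -!scalemxAr !ge_ (mulmxA (e a) (degop _ _)) degopl //.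
  rewrite -scalemxAl (mulmxA (e a)) (gr_mul ge).
  by case: eqP => [->//|_]; rewrite mul0mx !scaler0.
have gYM : g *m YM = YM *m g by rewrite cE mulmxDl mulmxDr mulmx1 mul1mx ccomm.
set N0 := low s e 0 N in EN NE *; set N0' := low s' e' 0 N in EN' NE' *.
have gN : g *m N0' = N0 *m g by exact: gX.
have deg_id s1 e1 (X : 'M[K]_n) : grading s1 e1 -> (forall t, X *m e1 t = e1 t *m X) -> low s1 e1 0 X = X.
  by move=> g1 h1; apply: low_of_weight => //; rewrite scale0r oppr0; apply: comm_degop.
pose E1 := low s e 0 E'.
have gE1 : g *m E' = E1 *m g.
  by have := gX E' (deg_preserves ge' We' Ee'); rewrite (deg_id s' e' E' ge' Ee').
pose H := YM - degop s e.
have He X : (forall t, X *m e t = e t *m X) -> lie H X = lie YM X.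
  move=> hX; rewrite -[RHS]subr0 -(comm_degop s hX) /H /lie; mxlin.
have HE : lie H E = 2 *: E by rewrite He.
have En : E ^+ n = 0.
  apply: (lower_nilpotent (ht := -%R) gM) => a b ab.
  have := lie_degop_block gM E a b; rewrite -YME YE -scalemxAr -scalemxAl => /eqP.
  rewrite -subr_eq0 -scalerBl scaler_eq0 => /orP[|/eqP//].
  rewrite subr_eq0 -[2]/(2%:~R) eqr_int => /eqP h; move: ab; lia.
have E1N : lie E1 N0 = H.
  apply: cancel; rewrite /lie mulmxBl -(mulmxA N0) -gE1 mulmxA -gN -(mulmxA E1) -gN mulmxA -gE1.
  by rewrite -!mulmxA -mulmxBr -[_ - _]/(lie E' N0') EN' mulmxBr gY gYM -mulmxBl.
(* [E1 - E] has weight 2 for [H] and commutes with [N0]. *)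
have E1E : E1 = E.
  apply/eqP; rewrite -subr_eq0; apply/eqP; apply: (ad_inj (E := E) (F := N0) (H := H) (d := 2)) => //.
  - rewrite He; last by move=> t; rewrite mulmxBl mulmxBr low0_comm // Ee.
    rewrite scalerBr -YE -(lowZ s e) -YE' -low_lie // /lie; mxlin.
  - have -> : lie N0 (E1 - E) = lie E N0 - lie E1 N0 by rewrite /lie; mxlin.
    by rewrite EN E1N subrr lie0r.
rewrite E1E in gE1.
pose Ng := g *m N *m invmx g.
have NgE : g *m N = Ng *m g by rewrite /Ng mulmxKV.
have Wg : preserves W g.
  apply: (preservesP ge We) => a b ab; rewrite eg -mulmxA lo' ?mulmx0 //.
have WNg : preserves W Ng.
  move=> j; rewrite /Ng !mulmxA.
  apply: submx_trans (stable_invmx gU (Wg j)); apply: submxMr.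
  by apply: submx_trans (WN j); apply: submxMr.
have NgE0 : lie E (Ng - N0) = 0.
  apply/eqP; rewrite subr_eq0; apply/eqP; apply: cancel.
  rewrite -(mulmxA _ E) -gE1 mulmxA mulmxBl -NgE -gN -mulmxBr.
  rewrite -(mulmxA E) mulmxBl -NgE -gN -mulmxBr mulmxA -gE1 -!mulmxA; congr (_ *m _).
  by apply/eqP; rewrite eq_sym -subr_eq0; apply/eqP.
pose Z := Ng - N.
have ZE : lie E Z = 0.
  have -> : lie E Z = lie E (Ng - N0) + lie (N - N0) E by rewrite /Z /lie; mxlin.
  by rewrite NgE0 NE addr0.
have Ngd a : e a *m Ng *m e a = e a *m N *m e a.
  have gd : e a *m g *m e a = e a.
    by rewrite cE mulmxDr mulmx1 mulmxDl (gr_idem ge) clow ?addr0 // ltxx.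
  have := congr1 (fun X => e a *m X *m e a) NgE.
  rewrite (mid_block ge (c := a)) ?gd; last first.
    move=> i ia; have [ai|ai] := ltP a i; [left|right].
      by rewrite (preserves_block ge We).
    by rewrite (preserves_block ge We) //; lia.
  rewrite (mid_block ge (c := a)); last first.
    move=> i ia; have [ai|ai] := ltP a i; [left|right].
      by rewrite (preserves_block ge We).
    by rewrite (preserves_block ge We) //; lia.
  by rewrite -(mulmxA _ g) -(mulmxA _ (e a)) (mulmxA (e a) g) gd => ->.
have N0e a : e a *m N0 = e a *m N *m e a.
  by rewrite -(gr_idem ge a) -(mulmxA (e a) (e a)) -low0_comm // mulmxA low_block // subr0 eqxx (gr_idem ge).
clearbody c Ng.
(* The component of degree -d of [c] vanishes, by induction on [d]. *)
have step (d : nat) a : e a *m c *m e (a - d%:Z) = 0.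
  have [m] := ubnP d; elim: m d a => // m IH d a; rewrite ltnS => dm.
  have [->|d0] := posnP d; first by rewrite subr0 clow // ltxx.
  have chigh i j : i - d%:Z < j -> e i *m c *m e j = 0.
    move=> ij; have [ji|ji] := boolP (j < i); last exact: clow.
    have -> : j = i - `|i - j|%N%:Z by lia.
    by apply: IH; lia.
  (* [Z = c N - Ng c] has the same component of degree -d as [lie N0 c]: the
     higher components of [c] vanish, and both [N] and [Ng] have [N0] as
     component of degree 0. *)
  pose X := low s e d%:Z c.
  suff X0 : X = 0.
    by have := low_block ge d%:Z c a (a - d%:Z); rewrite eqxx -/X X0 mulmx0 mul0mx => <-.
  apply: (ad_inj (E := E) (F := N0) (H := H) (d := d%:R)) => //; last 2 first.
  - by rewrite ltr0n.
  - suff -> : lie N0 X = low s e d%:Z Z by rewrite low_lie // ZE /low big1 // => i _; rewrite mulmx0 mul0mx.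
    apply: (mx_eq_blocks ge) => i j.
    rewrite /lie mulmxBr mulmxBl !mulmxA -(mulmxA _ N0) low0_comm // mulmxA low_block //.
    rewrite -(low0_comm ge) -(mulmxA N0) -(mulmxA N0) low_block // low_block //.
    case: eqP => [->|_]; last by rewrite mulmx0 mul0mx subrr.
    have -> : Z = c *m N - Ng *m c.
      by have := NgE; rewrite /Z cE mulmxDl mulmxDr mulmx1 mul1mx => h; apply/eqP; rewrite subr_eq addrAC eq_sym subr_eq addrC h.
    rewrite mulmxBr mulmxBl (mid_block ge (c := i - d%:Z)); last first.
      move=> k ki; have [ik|ik] := ltP (i - d%:Z) k; [left|right]; first exact: chigh.
      by rewrite (preserves_block ge We) //; lia.
    rewrite (mid_block ge (c := i)); last first.
      move=> k ki; have [ik|ik] := ltP i k; [left|right].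
        by rewrite (preserves_block ge We).
      by apply: chigh; lia.
    have r1 u : e u *m N *m e u = N0 *m e u by rewrite -N0e low0_comm.
    rewrite -(mulmxA _ (e (i - d%:Z)) N) -(mulmxA _ (_ *m N)) Ngd !r1 -!mulmxA.
    by rewrite low0_comm.
  have -> : lie H X = lie YM X - lie (degop s e) X by rewrite /H /lie; mxlin.
  rewrite low_weight // low_lie // opprK [lie YM c]/lie ccomm subrr.
  by rewrite /low big1 ?add0r // => i _; rewrite mulmx0 mul0mx.
have c0 : c = 0.
  apply: (mx_eq0_blocks ge) => a b; have [ba|ba] := boolP (b < a); last exact: clow.
  by have -> : b = a - `|a - b|%N%:Z by lia.
have g1 : g = 1%:M by rewrite cE c0 addr0.
split; last by move: gE1; rewrite g1 mul1mx mulmx1.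
by move=> t; have := eg t; have := ge_ t; rewrite g1 mul1mx mulmx1 => <-.
Qed.

End DeligneUniqueness.

(** * Deligne's grading in terms of projections *)
Section FromSubspaces.
Variables (K : fieldType) (n : nat).

Lemma grading_of_direct (T : eqType) (s : seq T) (I : T -> 'M[K]_n) :
  uniq s -> (forall t, t \notin s -> I t = 0) ->
  ((\sum_(t <- s) I t)%MS == (1%:M : 'M[K]_n))%MS ->
  (\sum_(t <- s) \rank (I t) = n)%N ->
  exists e, grading s e /\ forall t, (e t == I t)%MS.
Proof.
move=> us I0 /eqmxP sum1 rk.
pose A (i : 'I_(size s)) := I (tnth (in_tuple s) i).
have dA : mxdirect (\sum_i A i).
  apply/mxdirectP => /=; rewrite -[RHS](big_tnth 0%N addn s xpredT (fun t => \rank (I t))) rk.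
  rewrite -(big_tnth (0 : 'M[K]_n) addsmx s xpredT I) sum1.
  by rewrite mxrank1.
have capA i : (A i :&: \sum_(j | j != i) A j = 0)%MS by exact: (mxdirect_sumsP dA i isT).
pose e t : 'M[K]_n := if insub (index t s) is Some i then
  proj_mx (A i) (\sum_(j | j != i) A j)%MS else 0.
have eE t (ts : t \in s) : exists2 i, A i = I t &
    (e t = proj_mx (A i) (\sum_(j | j != i) A j)%MS) /\ tnth (in_tuple s) i = t.
  rewrite /e; case: insubP => [i _ vi|]; last by rewrite index_mem ts.
  have ti : tnth (in_tuple s) i = t by rewrite (tnth_nth t) vi nth_index.
  by exists i => //; rewrite /A ti.
have e0 t : t \notin s -> e t = 0.
  by rewrite -index_mem /e; case: insubP => [i -> //|].
have Ie t : I t *m e t = I t.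
  have [ts|ts] := boolP (t \in s); last by rewrite I0 // mul0mx.
  by have [i Ai [-> _]] := eE t ts; rewrite -Ai proj_mx_id.
have Ieo t u : t != u -> I t *m e u = 0.
  move=> tu; have [ts|ts] := boolP (t \in s); last by rewrite I0 // mul0mx.
  have [su|su] := boolP (u \in s); last by rewrite e0 // mulmx0.
  have [i <- [_ ti]] := eE t ts; have [j Aj [-> uj]] := eE u su.
  rewrite (proj_mx_0 (capA j)) //.
  apply: (sumsmx_sup i) => //; apply: contraNneq tu => ij.
  by rewrite -ti -uj ij.
have eI t : (e t <= I t)%MS.
  have [ts|ts] := boolP (t \in s); last by rewrite e0 // sub0mx.
  have [i <- [-> _]] := eE t ts.
  by rewrite -[proj_mx _ _]mul1mx proj_mx_sub.
exists e; split.
  split => //.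
    move=> t u; have /submxP[D De] := eI t; case: eqP => [<-|/eqP tu].
      by rewrite {1}De -mulmxA Ie.
    by rewrite De -mulmxA Ieo // mulmx0.
  apply/eqP; rewrite -subr_eq0; apply/eqP.
  suff H t : I t *m (\sum_(u <- s) e u - 1%:M) = 0.
    rewrite -[LHS]mul1mx; apply/eqP; rewrite -submx0.
    apply: (submx_trans (B := (\sum_(t <- s) I t)%MS *m (\sum_(u <- s) e u - 1%:M))).
      by apply: submxMr; rewrite sum1.
    rewrite submx0 -sub_kermx; elim/big_ind: _ => [|x y hx hy|t _]; first exact: sub0mx.
      by rewrite addsmx_sub hx.
    by rewrite sub_kermx H.
  rewrite mulmxBr mulmx1 mulmx_sumr; apply/eqP; rewrite subr_eq0; apply/eqP.
  have [ts|ts] := boolP (t \in s); last by rewrite I0 // big1 // => u _; rewrite mul0mx.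
  rewrite (bigD1_seq t) //= Ie big1 ?addr0 // => u ut; rewrite Ieo // eq_sym //.
move=> t; rewrite /eqmx eI /=; apply/submxP; exists (I t); exact/esym.
Qed.

Lemma fs_addsmx_sub (T : choiceType) (F : T -> 'M[K]_n) (S : set T) m (U : 'M[K]_(m, n)) :
  (forall t, S t -> (F t <= U)%MS) -> ((\big[addsmx/0]_(t \in S) F t)%MS <= U)%MS.
Proof.
move=> H; rewrite big_seq_cond; elim/big_ind: _ => [|x y hx hy|t].
- exact: sub0mx.
- by rewrite addsmx_sub hx.
by case: finite_supportP => //= X XS _ _; rewrite andbT => /XS; exact: H.
Qed.

Lemma fs_addsmx_sup (T : choiceType) (F : T -> 'M[K]_n) (S : set T) t :
  finite_set (F @^-1` [set~ 0]) -> S t -> (F t <= (\big[addsmx/0]_(t \in S) F t)%MS)%MS.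
Proof.
move=> fin St; have [->|Ft] := eqVneq (F t) 0; first exact: sub0mx.
have tS : t \in finite_support 0 S F.
  rewrite in_finite_support; last by apply: sub_finite_set fin => ? [].
  by rewrite inE; split => //; apply/eqP.
rewrite (bigD1_seq t) //=; exact: addsmxSl.
Qed.

End FromSubspaces.

Section Commutation.
Variables (K : fieldType) (n : nat).
Implicit Types A X Y : 'M[K]_n.

Lemma commM X Y A : X *m A = A *m X -> Y *m A = A *m Y -> X *m Y *m A = A *m (X *m Y).
Proof. by move=> hX hY; rewrite -mulmxA hY !mulmxA hX. Qed.

Lemma commB X Y A : X *m A = A *m X -> Y *m A = A *m Y -> (X - Y) *m A = A *m (X - Y).
Proof. by move=> hX hY; rewrite mulmxBl mulmxBr hX hY. Qed.

Lemma commZ a X A : X *m A = A *m X -> (a *: X) *m A = A *m (a *: X).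
Proof. by move=> hX; rewrite -scalemxAl -scalemxAr hX. Qed.

Lemma commL X Y A : X *m A = A *m X -> Y *m A = A *m Y -> lie X Y *m A = A *m lie X Y.
Proof. by move=> hX hY; apply: commB; apply: commM. Qed.

End Commutation.

Section FromDeligne.
Variables (K : numFieldType) (n : nat).

Lemma grading_of_is_grading (W : int -> 'M[K]_n) (Y : 'M[K]_n) :
  increasing_filtration W -> is_grading W Y ->
  exists s e, [/\ grading s e, Y = degop s e & forall j, (W j == proj s e (upto j))%MS].
Proof.
move=> [Wmon [a Wa] [b Wb]] [_ _ Wj].
pose F (l : int) := eigenspace Y l%:~R.
have rkF r : uniq r -> \rank (\sum_(l <- r) F l)%MS = (\sum_(l <- r) \rank (F l))%N.
  move=> ur; rewrite (big_tnth (0 : 'M[K]_n) addsmx) (big_tnth 0%N addn).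
  suff /mxdirectP : mxdirect (\sum_(i < size r) F (tnth (in_tuple r) i)) by [].
  apply: mxdirect_sum_eigenspace => i j _ _ /eqP; rewrite eqr_int !(tnth_nth 0) => /eqP.
  by move/eqP; rewrite nth_uniq //= => /eqP /val_inj.
pose s := finite_support 0 [set l | l <= b] F.
have us : uniq s by exact: finite_support_uniq.
have sum1 : ((\sum_(l <- s) F l)%MS == (1%:M : 'M[K]_n))%MS.
  have /eqmxP h1 := Wb; have /eqmxP h2 := Wj b.
  by apply/eqmxP; apply: eqmx_trans h1; apply: eqmx_sym.
have rks : (\sum_(l <- s) \rank (F l) = n)%N.
  by rewrite -rkF // (eqmxP sum1) mxrank1.
have F0 t : t \notin s -> F t = 0.
  move=> ts; have := rkF (t :: s); rewrite /= ts us !big_cons rks => /(_ isT) h.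
  have := rank_leq_col (F t + \sum_(l <- s) F l)%MS; rewrite h => h'.
  by apply/eqP; rewrite -mxrank_eq0; lia.
have [e [ge eF]] := grading_of_direct us F0 sum1 rks.
have eY t : e t *m Y = t%:~R *: e t.
  by apply/eigenspaceP; have /andP[] := eF t.
exists s, e; split => //.
  by rewrite [LHS](gr_suml ge) /degop /eigenop; apply: eq_bigr => t _.
move=> j; have /eqmxP h := Wj j; apply/eqmxP; apply: eqmx_trans h _.
have fin : finite_set (F @^-1` [set~ 0]).
  apply: (sub_finite_set (B := [set` s])) => [l /= Fl|]; last exact: finite_seq.
  by apply/negPn/negP => /F0.
apply/eqmxP/andP; split.
  apply: fs_addsmx_sub => t tj; have /andP[_ h1] := eF t.
  by apply: submx_trans h1 _; exact: (gr_sub_proj ge).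
apply: summx_sub => t tj; have /andP[h1 _] := eF t.
by apply: submx_trans h1 _; exact: (fs_addsmx_sup (F := F)).
Qed.

(** The relations of the sl_2-triple, given on Gr^W, lift to V because the
    operators involved have degree 0 for Y. *)
Lemma deligne_data_of (W : int -> 'M[K]_n) (N YM Y : 'M[K]_n) :
  increasing_filtration W ->
  deligne_grading W N YM Y ->
  exists s e E, deligne_data W N YM s e E /\ Y = degop s e.
Proof.
move=> hW [gY YYM [k [Nd [E [[Nsum Nwt] tri YE NE]]]]].
have [s [e [ge YE_ We]]] := grading_of_is_grading hW gY.
exists s, e, E; split=> //.
have Ee : forall t, E *m e t = e t *m E by apply: (lie_degop_comm ge); rewrite -YE_.
have YMe : forall t, YM *m e t = e t *m YM by apply: (lie_degop_comm ge); rewrite -YE_.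
have N0 : low s e 0 N = Nd 0%N.
  rewrite Nsum /low; under eq_bigr do rewrite mulmx_sumr mulmx_suml.
  rewrite exchange_big /= big_ord_recl [X in X + _](_ : _ = Nd 0%N).
    rewrite big1 ?addr0 // => i _; apply: (low_weight_off ge (d := i.+1%:Z)) => //.
    by rewrite -YE_; apply: Nwt; exact: ltn_ord.
  by apply: (low_of_weight ge); rewrite -YE_; exact: Nwt.
(* An operator of degree 0 has only diagonal blocks, which can be read on Gr^W. *)
have gr0 X : (forall t, X *m e t = e t *m X) -> (forall j, gr_zero W j X) -> X = 0.
  move=> Xe X0; apply: (mx_eq0_blocks ge) => a b.
  have [->|ab] := eqVneq a b; last first.
    by rewrite -mulmxA Xe mulmxA (gr_orth ge) ?mul0mx.
  have /andP[_ Wb] := We b; have /andP[Wb' _] := We (b - 1).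
  apply: (proj_idE ge (S := upto (b - 1))); last by rewrite /upto -ltNge; lia.
  apply: submx_trans Wb'; apply: submx_trans (X0 b); apply: submxMr.
  by apply: submx_trans Wb; apply: (gr_sub_proj ge); exact: upto_refl.
have Wdeg j : (W j *m (Y - (j%:~R)%:M) <= W (j - 1))%MS.
  have /andP[Wj _] := We j; have /andP[_ Wj'] := We (j - 1).
  apply: submx_trans (submxMr _ Wj) _; apply: (submx_trans _ Wj').
  apply: (sub_blocks ge) => t; rewrite YE_ mulmxBr mul_mx_scalar mulmxBl -mulmxA degopr //.
  rewrite -scalemxAl -scalemxAr -scalerBl (gr_projr ge); case: ifP => [|_]; last first.
    by rewrite scaler0 sub0mx.
  rewrite /upto => tj; have [->|tj'] := eqVneq t j; first by rewrite subrr scale0r sub0mx.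
  by apply: scalemx_sub; apply: (gr_sub_proj ge); rewrite /upto; lia.
split=> //; split.
- apply/eqP; rewrite -subr_eq0; apply/eqP; apply: gr0 => [t|j].
    by apply: commB; [exact: commL | exact: commZ].
  have [_ + _] := tri j; congr gr_zero; rewrite /lie mulmxBl mulmxBr mul_mx_scalar mul_scalar_mx.
  by rewrite opprB addrA subrK.
- rewrite N0; apply/eqP; rewrite -subr_eq0; apply/eqP; apply: gr0 => [t|j].
    have N0e u : Nd 0%N *m e u = e u *m Nd 0%N by rewrite -N0 (low0_comm ge).
    have Ye u : Y *m e u = e u *m Y by rewrite YE_ (degopl ge) (degopr ge).
    by rewrite -YE_; apply: commB; [exact: commL | exact: commB].
  have [_ _ h] := tri j; rewrite /gr_zero.
  have -> : lie E (Nd 0%N) - (YM - degop s e) =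
      (lie E N - (YM - (j%:~R)%:M)) + (Y - (j%:~R)%:M).
    have -> : lie E (Nd 0%N) = lie E N + lie (N - Nd 0%N) E by rewrite /lie; mxlin.
    by rewrite NE addr0 -YE_; mxlin.
  by rewrite mulmxDr addmx_sub.
- by rewrite N0.
Qed.
End FromDeligne.

(** * Ranks of stable subspaces *)
Section StableRank.
Variables (K : fieldType) (n : nat) (T : eqType) (s : seq T) (e : T -> 'M[K]_n).
Hypothesis ge : grading s e.

Lemma rank_gr_part (r : seq T) m (X : 'M[K]_(m, n)) :
  (forall t, (X *m e t <= X)%MS) -> uniq r ->
  (\rank (X *m \sum_(t <- r) e t) = \sum_(t <- r) \rank (X *m e t))%N.
Proof.
move=> Xe; elim: r => [|t r IH] /=; first by rewrite !big_nil mulmx0 mxrank0.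
move=> /andP[tr ur]; rewrite !big_cons -IH //.
have eo : e t *m \sum_(u <- r) e u = 0.
  rewrite mulmx_sumr big_seq big1 // => u ur'; rewrite (gr_orth ge) //.
  by apply: contraNneq tr => ->.
have eo' : (\sum_(u <- r) e u) *m e t = 0.
  rewrite mulmx_suml big_seq big1 // => u ur'; rewrite (gr_orth ge) //.
  by apply: contraNneq tr => <-.
have ei : (\sum_(u <- r) e u) *m (\sum_(u <- r) e u) = \sum_(u <- r) e u.
  rewrite {1}mulmx_suml [RHS]big_seq [LHS]big_seq; apply: eq_bigr => u ur'.
  rewrite mulmx_sumr (bigD1_seq u) //= (gr_idem ge) big1 ?addr0 // => v vu.
  by rewrite (gr_orth ge) // eq_sym.
set P := \sum_(u <- r) e u in eo eo' ei *.
rewrite -mxrank_disjoint_sum.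
  apply: eqmx_rank; apply/andP; split; first by rewrite mulmxDr addmx_sub_adds.
  rewrite addsmx_sub; apply/andP; split.
    have -> : X *m e t = X *m e t *m (e t + P) by rewrite mulmxDr -!mulmxA eo (gr_idem ge) mulmx0 addr0.
    exact: submxMr.
  have -> : X *m P = X *m P *m (e t + P) by rewrite mulmxDr -!mulmxA eo' ei mulmx0 add0r.
  apply: submxMr; rewrite /P mulmx_sumr; apply: summx_sub => u _; exact: Xe.
apply/eqP; rewrite -submx0; apply/rV_subP => v; rewrite sub_capmx => /andP[vt vP].
have vt' : v *m e t = v by case/submxP: vt => D ->; rewrite -!mulmxA (gr_idem ge).
by rewrite -vt'; case/submxP: vP => D ->; rewrite -!mulmxA eo' !mulmx0 sub0mx.
Qed.

Lemma rank_gr m (X : 'M[K]_(m, n)) : (forall t, (X *m e t <= X)%MS) ->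
  (\rank X = \sum_(t <- s) \rank (X *m e t))%N.
Proof. by move=> Xe; rewrite -rank_gr_part ?(gr_uniq ge) // (gr_sum ge) mulmx1. Qed.

Lemma rank_gr_sum : (\rank (\sum_(t <- s) e t)%R = \sum_(t <- s) \rank (e t))%N.
Proof.
rewrite (gr_sum ge) (rank_gr (X := 1%:M)) => [|t]; last by rewrite submx1.
by apply: eq_bigr => t _; rewrite mul1mx.
Qed.

End StableRank.

(** * Complex conjugation of matrices *)
Section Bar.
Variables (R : realType) (n : nat).
Local Notation C := R[i].

Lemma barM m (A : 'M[C]_(m, n)) (B : 'M[C]_n) : bar (A *m B) = bar A *m bar B.
Proof. by rewrite /bar map_mxM. Qed.
Lemma barK m (A : 'M[C]_(m, n)) : bar (bar A) = A.
Proof. by apply/matrixP => i j; rewrite !mxE conjCK. Qed.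
Lemma barB m (A B : 'M[C]_(m, n)) : bar (A - B) = bar A - bar B.
Proof. by rewrite /bar map_mxB. Qed.
Lemma barZ m a (A : 'M[C]_(m, n)) : bar (a *: A) = Num.conj a *: bar A.
Proof. by rewrite /bar map_mxZ. Qed.
Lemma bar1 : bar (1%:M : 'M[C]_n) = 1%:M.
Proof. by rewrite /bar map_mx1. Qed.
Lemma bar0 m : bar (0 : 'M[C]_(m, n)) = 0.
Proof. by rewrite /bar map_mx0. Qed.
Lemma bar_sum (T : Type) (r : seq T) (P : pred T) m (F : T -> 'M[C]_(m, n)) :
  bar (\sum_(i <- r | P i) F i) = \sum_(i <- r | P i) bar (F i).
Proof. by rewrite /bar (raddf_sum (map_mx Num.conj)). Qed.
Lemma bar_sub m p (A : 'M[C]_(m, n)) (B : 'M[C]_(p, n)) : (bar A <= bar B)%MS = (A <= B)%MS.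
Proof. by rewrite /bar map_submx. Qed.
Lemma bar_subl m p (A : 'M[C]_(m, n)) (B : 'M[C]_(p, n)) : (bar A <= B)%MS = (A <= bar B)%MS.
Proof. by rewrite -bar_sub barK. Qed.

Lemma conj_real (x : R) : Num.conj (real_complex R x) = real_complex R x.
Proof. by apply/CrealP/complex_realP; exists x. Qed.

Lemma real_neq0 (x : R) : 0 < x -> real_complex R x != 0.
Proof. by move=> x0; rewrite -(rmorph0 (real_complex R)) (inj_eq (fmorph_inj _)) gt_eqF. Qed.

Lemma bar_cx m (A : 'M[R]_(m, n)) : bar (cx A) = cx A.
Proof. by apply/matrixP => i j; rewrite !mxE conj_real. Qed.

Lemma bar_expmx (A : 'M[C]_n) : bar (expmx A) = expmx (bar A).
Proof.
rewrite /expmx bar_sum; apply: eq_bigr => i _; rewrite barZ fmorphV rmorph_nat; congr (_ *: _).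
elim: (i : nat) => [|j IH]; first by rewrite !expr0 -idmxE bar1.
by rewrite !exprS -!mulmxE barM IH.
Qed.

End Bar.

(** * Bigradings of mixed Hodge structures *)
Section Bigradings.
Variables (R : realType) (n : nat).
Local Notation C := R[i].
Implicit Types (F : int -> 'M[C]_n) (W : int -> 'M[R]_n) (e : int * int -> 'M[C]_n).

Definition Hpart (p : int) : pred (int * int) := fun ab => p <= ab.1.
Definition Wpart (j : int) : pred (int * int) := fun ab => ab.1 + ab.2 <= j.
Definition below (p q : int) : pred (int * int) := fun ab => (ab.1 < p) && (ab.2 < q).

(** [is_deligne_bigrading] in terms of the projections to the pieces. *)
Definition bigraded F W s e : Prop :=
  [/\ grading s e, forall p, (F p == proj s e (Hpart p))%MS,
      forall j, (cxf W j == proj s e (Wpart j))%MS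
    & forall p q, (bar (e (p, q)) + proj s e (below q p) == e (q, p) + proj s e (below q p))%MS].

Lemma bigsum_proj I s e (S : set (int * int)) (P : pred (int * int)) :
  grading s e -> (forall ab, (e ab == I ab.1 ab.2)%MS) -> (forall ab, S ab <-> P ab) ->
  (bigsum I S == proj s e P)%MS.
Proof.
move=> ge eI SP; apply/andP; split.
  apply: fs_addsmx_sub => t /SP tj; have /andP[_ h1] := eI t.
  by apply: submx_trans h1 _; exact: (gr_sub_proj ge).
apply: summx_sub => t /SP tj; have /andP[h1 _] := eI t.
apply: submx_trans h1 _; apply: (fs_addsmx_sup (F := fun ab : int * int => I ab.1 ab.2)) => //.
apply: (sub_finite_set (B := [set` s])) => [l /= Fl|]; last exact: finite_seq.
apply/negPn/negP => /(gr_out ge) el; apply: Fl.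
by apply/eqP; have := eI l; rewrite el => /andP[_]; rewrite submx0.
Qed.

Lemma bigraded_of F W I : is_deligne_bigrading F W I ->
  exists s e, bigraded F W s e /\ forall p q, (e (p, q) == I p q)%MS.
Proof.
case=> fin [sum1 rk] FI WI barI.
have [r rE] := (finite_seqP _).1 fin.
pose s := undup r; pose I2 (ab : int * int) := I ab.1 ab.2.
have us : uniq s := undup_uniq r.
have I0 t : t \notin s -> I2 t = 0.
  rewrite mem_undup => ts; apply/eqP/negPn/negP => It.
  have : [set ab : int * int | I ab.1 ab.2 != 0] t by [].
  by rewrite rE /= (negbTE ts).
have [e [ge eI]] : exists e, grading s e /\ forall t, (e t == I2 t)%MS.
  apply: grading_of_direct => //.
    suff <- : bigsum I setT = (\sum_(t <- s) I2 t)%MS by [].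
    rewrite /bigsum (fsbigE s) //= => [|i _]; last exact: I0.
    by apply: eq_bigl => i; exact: mem_set.
  rewrite -[RHS]rk (fsbigE s) //= => [|i _ /I0]; last by rewrite /I2 => ->; rewrite mxrank0.
  by apply: eq_bigl => i; exact/esym/mem_set.
have tr S (P : pred (int * int)) : (forall ab, S ab <-> P ab) -> (bigsum I S :=: proj s e P)%MS.
  by move=> SP; apply/eqmxP; apply: bigsum_proj.
exists s, e; split; last by move=> p q; exact: (eI (p, q)).
split=> //.
- move=> p; apply/eqmxP; apply: eqmx_trans (eqmxP (FI p)) _; exact: tr.
- move=> j; apply/eqmxP; apply: eqmx_trans (eqmxP (WI j)) _; exact: tr.
move=> p q; have h : (bigsum I [set ab | (ab.1 < q)%R /\ (ab.2 < p)%R] :=: proj s e (below q p))%MS.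
  by apply: tr => ab; rewrite /below; split => [[-> ->]|/andP[]].
have hb : (bar (e (p, q)) :=: bar (I p q))%MS.
  by apply/eqmxP; rewrite !bar_sub; exact: (eI (p, q)).
apply/eqmxP; apply: eqmx_trans (adds_eqmx hb (eqmx_sym h)) _.
apply: eqmx_trans (eqmxP (barI p q)) _; apply: adds_eqmx h.
by apply: eqmx_sym; apply/eqmxP; exact: (eI (q, p)).
Qed.

Lemma bigraded_is F W s e : bigraded F W s e -> is_deligne_bigrading F W (fun p q => e (p, q)).
Proof.
case=> ge FI WI barI; have [us _ _ _] := ge.
have eI (ab : int * int) : (e ab == e (ab.1, ab.2))%MS by case: ab => a b; rewrite submx_refl.
have tr S (P : pred (int * int)) : (forall ab, S ab <-> P ab) -> (bigsum (fun p q => e (p, q)) S :=: proj s e P)%MS.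
  by move=> SP; apply/eqmxP; apply: bigsum_proj.
split.
- apply: (sub_finite_set (B := [set` s])) => [[a b] /= Fl|]; last exact: finite_seq.
  by apply/negPn/negP => /(gr_out ge) h; move: Fl; rewrite h eqxx.
- split.
    apply/eqmxP; apply: eqmx_trans (tr _ predT _) _ => //.
    by rewrite /proj (gr_sum ge).
  rewrite (fsbigE s) //= => [|[a b] _ /= /(gr_out ge) ->]; last by rewrite mxrank0.
  rewrite -[RHS](mxrank1 C) -(gr_sum ge) (eq_bigl xpredT) => [|i]; last exact: mem_set.
  by rewrite (rank_gr_sum ge) //; apply: eq_bigr => -[].
- move=> p; apply/eqmxP; apply: eqmx_trans (eqmxP (FI p)) _; exact/eqmx_sym/tr.
- move=> j; apply/eqmxP; apply: eqmx_trans (eqmxP (WI j)) _; exact/eqmx_sym/tr.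
move=> p q; have h : (bigsum (fun p q => e (p, q)) [set ab | (ab.1 < q)%R /\ (ab.2 < p)%R] :=: proj s e (below q p))%MS.
  by apply: tr => ab; rewrite /below; split => [[-> ->]|/andP[]].
apply/eqmxP; apply: eqmx_trans (adds_eqmx (eqmx_refl _) h) _.
apply: eqmx_trans (eqmxP (barI p q)) _; exact: adds_eqmx (eqmx_refl _) (eqmx_sym h).
Qed.

(** Uniqueness.  The conjugate of I^(q,p) is congruent to I^(p,q), and I^(q,p) lies
    in F^q and W_(p+q); expressing this in the other bigrading and conjugating, one
    finds by induction on p that I^(p,q) lies in I'^(p,q) plus the I'^(a,b) with
    a < p.  It also lies in F^p, so it lies in I'^(p,q). *)
Lemma bigraded_sub F W s e s' e' : bigraded F W s e -> bigraded F W s' e' ->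
  forall t, (e t <= e' t)%MS.
Proof.
move=> [ge FI WI barI] [ge' FI' WI' barI'].
pose Tp (p q : int) : pred (int * int) := fun ab => (ab == (p, q)) || (ab.1 < p).
suff key : forall p q, (e (p, q) <= proj s' e' (Tp p q))%MS.
  case=> p q; have h2 := sub_proj_id ge' (key p q).
  have h1 : (e (p, q) <= proj s' e' (Hpart p))%MS.
    have /andP[h _] := FI' p; apply: submx_trans h.
    have /andP[_ h] := FI p; apply: submx_trans h.
    by apply: (gr_sub_proj ge); rewrite /Hpart /=.
  suff <- : e (p, q) *m e' (p, q) = e (p, q) by exact: submxMl.
  rewrite [RHS](gr_sumr ge') (gr_sum_pick ge' (t := (p, q))) //; last first.
    by move/(gr_out ge')->; rewrite mulmx0.
  move=> u ut; have [Tu|Tu] := boolP (Tp p q u); last exact: (proj_idE ge' (key p q)).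
  apply: (proj_idE ge' h1); move: Tu; rewrite /Tp /Hpart (negbTE ut) /=; lia.
(* The induction starts below a lower bound of the indices p that occur. *)
have [B Bs] : exists B : int, forall t, t \in s -> B <= t.1.
  exists (- (\sum_(t <- s) `|t.1|)%N%:Z) => t ts.
  suff : (`|t.1| <= \sum_(t <- s) `|t.1|)%N by lia.
  by rewrite (big_rem t) //= leq_addr.
suff H (m : nat) : forall p q, p < B + m%:Z -> (e (p, q) <= proj s' e' (Tp p q))%MS.
  by move=> p q; apply: (H `|p - B|.+1); lia.
elim: m => [|m IH] p q pB.
  rewrite (gr_out ge) ?sub0mx //; apply/negP => /Bs /=; lia.
have /andP[_ h] := barI q p.
apply: submx_trans (addsmxSl _ _) _; apply: submx_trans h _; rewrite addsmx_sub; apply/andP; split; last first.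
  apply: summx_sub => -[a b] /andP[/= ap bq]; apply: submx_trans (IH a b _) _; first by lia.
  apply: (sub_proj_sub ge') => u; rewrite !unfold_in /Tp => /orP[/eqP->|] /=; lia.
have h1 : (e (q, p) <= proj s' e' (predI (Hpart q) (Wpart (p + q))))%MS.
  apply/(sub_projP ge') => t; rewrite negb_and => /orP[]; apply: (proj_idE ge').
    have /andP[h1 _] := FI' q; apply: submx_trans h1.
    have /andP[_ h1] := FI q; apply: submx_trans h1.
    by apply: (gr_sub_proj ge); rewrite /Hpart /=.
  have /andP[h1 _] := WI' (p + q); apply: submx_trans h1.
  have /andP[_ h1] := WI (p + q); apply: submx_trans h1.
  by apply: (gr_sub_proj ge); rewrite /Wpart /= addrC.
rewrite -bar_sub in h1; apply: submx_trans h1 _; rewrite /proj bar_sum.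
apply: summx_sub => -[b a] /andP[]; rewrite /Hpart /Wpart /= => hb hab.
have /andP[h1 _] := barI' b a; apply: submx_trans (addsmxSl _ _) _; apply: submx_trans h1 _.
rewrite addsmx_sub; apply/andP; split.
  apply: (gr_sub_proj ge'); rewrite /Tp /= xpair_eqE; lia.
apply: (sub_proj_sub ge') => u; rewrite !unfold_in /below /Tp; lia.
Qed.

End Bigradings.

Section Coarsening.
Variables (K : fieldType) (n : nat) (T U : eqType) (s : seq T) (e : T -> 'M[K]_n).
Hypothesis ge : grading s e.
Variable f : T -> U.

Definition coarse u : 'M[K]_n := proj s e (fun t => f t == u).

Lemma coarse_grading : grading (undup (map f s)) coarse.
Proof.
split; first exact: undup_uniq.
- move=> u; rewrite mem_undup => us; rewrite /coarse /proj big_seq_cond big1 // => t /andP[ts /eqP tu].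
  by case/negP: us; rewrite -tu map_f.
- move=> u v; rewrite /coarse (projM ge); case: eqP => [<-|uv].
    by apply: eq_bigl => t /=; rewrite andbb.
  rewrite /proj big_pred0 // => t /=; apply/negP => /andP[/eqP tu /eqP tv]; apply: uv.
  by rewrite -tu.
rewrite -(gr_sum ge) /coarse /proj.
rewrite (eq_bigr (fun u => \sum_(t <- s) if f t == u then e t else 0)); last first.
  by move=> u _; rewrite big_mkcond.
rewrite exchange_big /=; rewrite big_seq [RHS]big_seq; apply: eq_bigr => t ts.
rewrite (bigD1_seq (f t)) ?undup_uniq ?mem_undup ?map_f //= eqxx big1 ?addr0 // => u.
by rewrite eq_sym => /negbTE->.
Qed.

Lemma coarse_mull t u : e t *m coarse u = if f t == u then e t else 0.
Proof. exact: (gr_projl ge). Qed.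
Lemma coarse_mulr t u : coarse u *m e t = if f t == u then e t else 0.
Proof. exact: (gr_projr ge). Qed.

End Coarsening.

Lemma grading_eq (K : fieldType) n (T : eqType) s s' (e e' : T -> 'M[K]_n) :
  grading s e -> grading s' e' -> (forall t, (e t <= e' t)%MS) -> forall t, e t = e' t.
Proof.
move=> ge ge' H t; rewrite [RHS](gr_suml ge) (gr_sum_pick ge (t := t)).
- by rewrite (gr_idr ge').
- by move=> u ut; apply: (gr_orthr ge' (H u)).
- by move/(gr_out ge)->; rewrite mul0mx.
Qed.

Section SplitData.
Variables (R : realType) (n : nat).
Local Notation C := R[i].
Implicit Types (F : int -> 'M[C]_n) (W M : int -> 'M[R]_n).

Lemma bigraded_uniq F W s e s' e' : bigraded F W s e -> bigraded F W s' e' -> forall t, e t = e' t.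
Proof.
move=> b b'; have [ge _ _ _] := b; have [ge' _ _ _] := b'.
exact: (grading_eq ge ge' (bigraded_sub b b')).
Qed.

Lemma deligne_bigradingE F W s e : bigraded F W s e ->
  forall p q, (deligne_bigrading F W p q == e (p, q))%MS.
Proof.
move=> b; have h : is_deligne_bigrading F W (deligne_bigrading F W).
  apply: (@xgetPex _ _ [set I | is_deligne_bigrading F W I]).
  by exists (fun p q => e (p, q)); exact: bigraded_is b.
have [s0 [e0 [b0 e0E]]] := bigraded_of h.
move=> p q; rewrite -(bigraded_uniq b0 b).
by apply/eqmxP/eqmx_sym/eqmxP; exact: e0E.
Qed.

Definition weight (t : int * int) : int := t.1 + t.2.
Definition swap (t : int * int) := (t.2, t.1).

Lemma split_data F M : split_mhs F M ->
  exists s e, [/\ bigraded F M s e, forall t, bar (e t) = e (swap t)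
    & deligne_Y F M = eigenop s e (fun t => (weight t)%:~R)].
Proof.
move=> [_ [I [bI barI]]]; have [s [e [b eI]]] := bigraded_of bI; exists s, e.
have [ge _ _ _] := b.
split => //.
  have sub t : (bar (e t) <= e (swap t))%MS.
    case: t => p q; have /andP[_ h] := eI q p; apply: submx_trans h.
    have /andP[h _] := barI p q; apply: submx_trans h; rewrite bar_sub.
    by have /andP[] := eI p q.
  move=> t; have st : bar (e t) *m e (swap t) = bar (e t) by exact: (gr_idr ge).
  rewrite -st -[RHS]mul1mx -bar1 -(gr_sum ge) bar_sum mulmx_suml.
  rewrite (gr_sum_pick ge (t := t)) // => [u ut|/(gr_out ge)->]; last by rewrite bar0 mul0mx.
  apply: (gr_orthr ge (sub u)); apply: contra ut => /eqP[h1 h2].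
  by case: u t h1 h2 {st} => a c [a' c'] /= -> ->.
have eY t : e t *m eigenop s e (fun t => (weight t)%:~R) = (weight t)%:~R *: e t by exact: eigenopl.
set A := eigenop s e _ in eY *.
pose S : set 'M[C]_n := [set A | forall p q,
    deligne_bigrading F M p q *m A = (p + q)%:~R *: deligne_bigrading F M p q].
have SA : S A.
  move=> p q; have /andP[/submxP[D ->] _] := deligne_bigradingE b p q.
  by rewrite -mulmxA eY scalemxAr.
have : S (deligne_Y F M) by apply: (@xgetPex _ _ S); exists A.
move=> h; rewrite [LHS](gr_suml ge) /A /eigenop; apply: eq_bigr => -[p q] _.
have /andP[_ /submxP[D eD]] := deligne_bigradingE b p q.
by rewrite {1}eD -mulmxA h -scalemxAr -eD.
Qed.

End SplitData.

(** * Stability of W under the bigrading of the limit *)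
Section DegreeArithmetic.

Variables (B : nat) (B0 : int).

(** The 2 [B] consecutive integers 1 - B, ..., B, stable under p |-> 1 - p. *)
Definition window (i : nat) : int := i%:Z - B%:Z + 1.

(** A reflection maps the window to itself, and moving it by k to the right trades
    k values c for k values 0. *)
Lemma sum_reflect (g : int -> int) c k :
  (forall p, p <= - B0 -> g p = c) -> (forall p, B0 < p -> g p = 0) ->
  0 <= B0 -> `|k| + B0 <= B%:Z ->
  \sum_(i < B + B) g (k + 1 - window i) = \sum_(i < B + B) g (window i) - k * c.
Proof.
move=> gc g0 B00 kB.
transitivity (\sum_(i < B + B) g (k + window i)).
  rewrite (reindex_inj rev_ord_inj) /=; apply: eq_bigr => i _; congr g.
  by rewrite /window; have := ltn_ord i; lia.
have step l : - (B%:Z - B0) <= l -> l < B%:Z - B0 ->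
    \sum_(i < B + B) g (l + 1 + window i) = \sum_(i < B + B) g (l + window i) - c.
  move=> l1 l2; apply/eqP; rewrite -subr_eq0 opprB addrCA -sumrB.
  rewrite -(big_mkord xpredT (fun i => g (l + 1 + window i) - g (l + window i))).
  rewrite (eq_bigr (fun i => g (l + window i.+1) - g (l + window i))); last first.
    by move=> i _; congr (g _ - _); rewrite /window; lia.
  rewrite telescope_sumr // (gc (l + window 0)); last by rewrite /window; lia.
  by rewrite (g0 (l + window _)) ?sub0r ?subrr // /window; lia.
have pos (m : nat) : m%:Z <= B%:Z - B0 ->
    \sum_(i < B + B) g (m%:Z + window i) = \sum_(i < B + B) g (window i) - m%:Z * c.
  elim: m => [|m IH] mB; first by rewrite mul0r subr0; apply: eq_bigr => i _; rewrite add0r.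
  have -> : m.+1%:Z = m%:Z + 1 by lia.
  rewrite step ?IH; [|lia..]; ring.
have neg (m : nat) : m%:Z <= B%:Z - B0 ->
    \sum_(i < B + B) g (- m%:Z + window i) = \sum_(i < B + B) g (window i) + m%:Z * c.
  elim: m => [|m IH] mB; first by rewrite mul0r addr0; apply: eq_bigr => i _; rewrite oppr0 add0r.
  have := step (- m.+1%:Z); have -> : - m.+1%:Z + 1 = - m%:Z by lia.
  rewrite IH; last by lia.
  move=> h; have h1 : - (B%:Z - B0) <= - m.+1%:Z by lia.
  have /(h h1) : - m.+1%:Z < B%:Z - B0 by lia.
  move/eqP; rewrite eq_sym subr_eq => /eqP ->.
  have -> : m.+1%:Z = m%:Z + 1 by lia.
  by ring.
have [k0|k0] := leP 0 k.
  have -> : k = `|k|%N%:Z by lia.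
  by apply: pos; lia.
have -> : k = - `|k|%N%:Z by lia.
rewrite neg ?mulNr ?opprK //; lia.
Qed.

End DegreeArithmetic.

Section Semistability.
Variables (R : realType) (n : nat).
Local Notation C := R[i].
Variables (F : int -> 'M[C]_n) (W : int -> 'M[R]_n) (s : seq (int * int)) (e : int * int -> 'M[C]_n).
Hypotheses (ge : grading s e) (FI : forall p, (F p == proj s e (Hpart p))%MS).
Hypothesis ebar : forall t, bar (e t) = e (swap t).
Hypothesis hW : increasing_filtration W.

Let sM := undup (map weight s).
Let eM := coarse s e weight.
Let gM : grading sM eM := coarse_grading ge weight.

(* The numbers below compare the Hodge filtration of W_j with the one of its
   pieces U_(j,l), where U_(j,l) is the part of W_j on which Y_M = l. *)

Hypothesis WeM : forall j l, (cxf W j *m eM l <= cxf W j)%MS.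

Let w j : int := (\rank (cxf W j))%:Z.
Let u j l : int := (\rank (cxf W j *m eM l))%:Z.
Let r j p : int := (\rank (F p :&: cxf W j)%MS)%:Z.
Let f j l p : int := (\rank (F p :&: (cxf W j *m eM l))%MS)%:Z.

(* [Hgr] is the purity of the Gr^W_j, and [Htr] says that Y_M - j has trace 0 on
   Gr^W_j. *)
Hypothesis Hgr : forall j p, (r j p - r (j - 1) p) + (r j (j + 1 - p) - r (j - 1) (j + 1 - p)) = w j - w (j - 1).
Hypothesis Htr : forall j, \sum_(l <- sM) l * (u j l - u (j - 1) l) = j * (w j - w (j - 1)).

Lemma cxfS i j : i <= j -> (cxf W i <= cxf W j)%MS.
Proof. by move=> ij; rewrite /cxf /cx map_submx; case: hW => h _ _; exact: h. Qed.

Lemma FprojE p m (v : 'M[C]_(m, n)) : (v <= F p)%MS <-> forall t, ~~ Hpart p t -> v *m e t = 0.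
Proof.
exact: (sub_eq_projP ge v (FI p)).
Qed.

Lemma weight_comm t l : e t *m eM l = eM l *m e t.
Proof. by rewrite coarse_mull // coarse_mulr. Qed.

Lemma eM_bar l : bar (eM l) = eM l.
Proof.
rewrite /eM /coarse /proj; apply: (mx_eq_blocks ge) => a b; congr (_ *m _).
rewrite -/(proj s e _) (gr_projl ge).
rewrite bar_sum big_mkcond mulmx_sumr (gr_sum_pick ge (t := swap a)) /=.
- rewrite /weight /swap /= addrC; case: ifP => _; last by rewrite mulmx0.
  by rewrite ebar /swap /= -surjective_pairing (gr_idem ge).
- move=> t ta; case: ifP => _; last by rewrite mulmx0.
  rewrite ebar (gr_orth ge) //; apply: contra ta => /eqP->.
  by rewrite /swap /= -surjective_pairing.
- by move=> /(gr_out ge)->; rewrite bar0 if_same mulmx0.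
Qed.

Lemma FeM p l m (v : 'M[C]_(m, n)) : (v <= F p)%MS -> (v *m eM l <= F p)%MS.
Proof.
move=> /FprojE h; apply/FprojE => t nt.
by rewrite -mulmxA -weight_comm mulmxA h // mul0mx.
Qed.

Lemma Posz_sum (T : Type) (q : seq T) (g : T -> nat) :
  (\sum_(i <- q) g i)%N%:Z = \sum_(i <- q) (g i)%:Z.
Proof. exact: (big_morph Posz PoszD (erefl 0%:Z)). Qed.

Lemma w_sum j : w j = \sum_(l <- sM) u j l.
Proof. by rewrite /w (rank_gr gM (WeM j)) Posz_sum. Qed.

Lemma r_sum j p : r j p = \sum_(l <- sM) f j l p.
Proof.
rewrite /r (rank_gr gM) => [|l].
  rewrite Posz_sum; apply: eq_bigr => l _; congr Posz; apply: eqmx_rank; apply/andP; split.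
    by rewrite sub_capmx FeM ?capmxSl // submxMr // capmxSr.
  apply/rV_subP => v; rewrite sub_capmx => /andP[vF vW].
  have ve : v *m eM l = v by case/submxP: vW => D ->; rewrite -!mulmxA (gr_idem gM).
  rewrite -ve submxMr // sub_capmx vF /=; exact: submx_trans vW (WeM j l).
rewrite sub_capmx FeM ?capmxSl //=.
by apply: submx_trans (WeM j l); apply: submxMr; exact: capmxSr.
Qed.

Lemma UM_bar j l : bar (cxf W j *m eM l) = cxf W j *m eM l.
Proof. by rewrite barM bar_cx eM_bar. Qed.

(** The l-eigenspace of Y_M carries a Hodge structure of weight l. *)
Lemma slope_disjoint j l p :
  ((F p :&: (cxf W j *m eM l)) :&: bar (F (l + 1 - p)%R :&: (cxf W j *m eM l)) = 0)%MS.
Proof.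
apply/eqP; rewrite -submx0; apply/rV_subP => v; rewrite sub_capmx -bar_subl.
rewrite !sub_capmx => /andP[/andP[vF vW] /andP[vF' _]].
suff -> : v = 0 by exact: sub0mx.
rewrite (gr_sumr ge v) big1 // => t _.
have [tp|tp] := boolP (Hpart p t); last by rewrite (FprojE p v).1.
have ve : v *m eM l = v by case/submxP: vW => D ->; rewrite -!mulmxA (gr_idem gM).
rewrite -ve -mulmxA /eM coarse_mulr //; case: eqP => [tl|_]; last by rewrite mulmx0.
apply: (can_inj (@barK R n 1)); rewrite barM ebar bar0.
apply: (FprojE (l + 1 - p) _).1 => //; move: tp tl; rewrite /Hpart /weight /swap /=; lia.
Qed.

Lemma slope_le j l p : f j l p + f j l (l + 1 - p) <= u j l.
Proof.
rewrite /f /u -PoszD lez_nat; set U := cxf W j *m eM l.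
have -> : \rank (F (l + 1 - p)%R :&: U)%MS = \rank (bar (F (l + 1 - p)%R :&: U)%MS).
  by rewrite /bar mxrank_map.
rewrite -mxrank_disjoint_sum ?slope_disjoint //; apply: mxrankS.
by rewrite addsmx_sub capmxSr bar_subl UM_bar capmxSr.
Qed.

(** In the case of equality U_(j,l) is the sum of its intersections with F^p and
    with the conjugate of F^(l+1-p), on which the projection to F^p is the identity
    and 0 respectively. *)
Lemma slope_split j l p : f j l p + f j l (l + 1 - p) = u j l ->
  (cxf W j *m eM l *m proj s e (Hpart p) <= cxf W j *m eM l)%MS.
Proof.
rewrite /f /u -PoszD; case; set U := cxf W j *m eM l.
have -> : \rank (F (l + 1 - p)%R :&: U)%MS = \rank (bar (F (l + 1 - p)%R :&: U)%MS).
  by rewrite /bar mxrank_map.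
rewrite -mxrank_disjoint_sum ?slope_disjoint // => rk.
set A := (F p :&: U)%MS in rk *; set B := bar _ in rk *.
have AU : (A + B <= U)%MS by rewrite addsmx_sub capmxSr bar_subl UM_bar capmxSr.
have /mxrank_leqif_eq/geq_leqif := AU; rewrite rk leqnn => /esym/andP[_ UA].
apply: submx_trans (submxMr _ UA) _; rewrite addsmxMr addsmx_sub; apply/andP; split.
  rewrite (proj_id ge) ?capmxSr // => t nt; apply: (FprojE p _).1 => //; exact: capmxSl.
rewrite [X in (X <= _)%MS](_ : _ = 0) ?sub0mx // /proj mulmx_sumr big1 // => t tp.
have Be : B *m eM l = B.
  have : (B <= U)%MS by rewrite bar_subl UM_bar capmxSr.
  by case/submxP => D ->; rewrite -!mulmxA (gr_idem gM).
rewrite -Be -mulmxA /eM coarse_mulr //; case: eqP => [tl|_]; last by rewrite mulmx0.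
apply: (can_inj (@barK R n n)); rewrite barM ebar bar0 /B barK.
apply: (FprojE (l + 1 - p) _).1; first exact: capmxSl.
move: tp tl; rewrite /Hpart /weight /swap /=; lia.
Qed.

(** Let T j be the sum over l and p of the defects in [slope_le].  A reflection
    p |-> l + 1 - p of the sums expresses it through the ranks r and the numbers
    l u; by [Hgr] and [Htr] it does not depend on j, and it vanishes for small j.
    As all defects are nonnegative, they all vanish. *)
Lemma slope_eq j l p : l \in sM -> f j l p + f j l (l + 1 - p) = u j l.
Proof.
move=> lM; case: hW => _ [a Wa] _.
have wa i : i <= a -> cxf W i = 0.
  move=> ia; apply/eqP; rewrite -submx0; apply: submx_trans (cxfS ia) _.
  by rewrite /cxf /cx Wa map_mx0.
pose B0 := (\sum_(t <- s) `|t.1|)%N.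
pose L := (\sum_(l <- sM) `|l|)%N.
pose B := (B0 + L + `|a| + `|j| + `|p| + 1)%N.
have bs (t : int * int) : t \in s -> (`|t.1| <= B0)%N by move=> ts; rewrite /B0 (big_rem t) //= leq_addr.
have bl (i : int) : i \in sM -> (`|i| <= L)%N by move=> ts; rewrite /L (big_rem i) //= leq_addr.
clearbody B0 L.
have F1 q : q <= - B0%:Z -> (1%:M <= F q)%MS.
  move=> qB; apply/FprojE => t; rewrite /Hpart mul1mx => nt; apply: (gr_out ge).
  by apply: contra nt => /bs ?; lia.
have F0 q : B0%:Z < q -> F q = 0.
  move=> qB; rewrite (gr_sumr ge (F q)) big_seq big1 // => t /bs ts.
  by apply: (FprojE q _).1 => //; rewrite /Hpart; lia.
have f1 i l' q : q <= - B0%:Z -> f i l' q = u i l'.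
  move=> qB; congr Posz; apply: eqmx_rank; rewrite capmxSr sub_capmx submx_refl andbT.
  exact: submx_trans (submx1 _) (F1 q qB).
have f0 i l' q : B0%:Z < q -> f i l' q = 0 by move=> qB; rewrite /f F0 // cap0mx mxrank0.
have r1 i q : q <= - B0%:Z -> r i q = w i.
  move=> qB; congr Posz; apply: eqmx_rank; rewrite capmxSr sub_capmx submx_refl andbT.
  exact: submx_trans (submx1 _) (F1 q qB).
have r0 i q : B0%:Z < q -> r i q = 0 by move=> qB; rewrite /r F0 // cap0mx mxrank0.
pose S (g : int -> int) := \sum_(i < B + B) g (window B i).
pose T i := (B + B)%:Z * w i - 2 * S (r i) + \sum_(l <- sM) l * u i l.
have defect i : T i = \sum_(l <- sM) \sum_(q < B + B) (u i l - (f i l (window B q) + f i l (l + 1 - window B q))).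
  have -> : T i = \sum_(l <- sM) ((B + B)%:Z * u i l - 2 * S (f i l) + l * u i l).
    rewrite big_split big_split /= sumrN -!mulr_sumr -w_sum /T; congr (_ - 2 * _ + _).
    rewrite exchange_big /=; apply: eq_bigr => q _; exact: r_sum.
  rewrite big_seq [RHS]big_seq; apply: eq_bigr => l' /bl l'L.
  rewrite sumrB big_split /= (sum_reflect (B0 := B0%:Z) (c := u i l')) //; last by rewrite /B; lia.
  - rewrite sumr_const card_ord /S -mulr_natl natz; ring.
  - by move=> q; exact: f1.
  - by move=> q; exact: f0.
have Tstep i : `|i| + B0%:Z <= B%:Z -> T i = T (i - 1).
  move=> iB; pose g q := r i q - r (i - 1) q.
  have Sg : S g = S (r i) - S (r (i - 1)) by rewrite /S /g sumrB.
  have h : S (fun q => g q + g (i + 1 - q)) = (B + B)%:Z * (w i - w (i - 1)).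
    rewrite /S (eq_bigr (fun=> w i - w (i - 1))) => [|q _]; last exact: Hgr.
    by rewrite sumr_const card_ord -mulr_natl natz.
  have Sr : \sum_(q < B + B) g (i + 1 - window B q) = S g - i * (w i - w (i - 1)).
    apply: (sum_reflect (B0 := B0%:Z)) => // q qB; first by rewrite /g !r1.
    by rewrite /g !r0 ?subrr.
  move: h; rewrite /S big_split /= Sr -[\sum_(q < B + B) g (window B q)]/(S g) Sg => h.
  have alg (x b c d1 d2 t1 t2 : int) : (x * b - 2 * d1 + t1) - (x * c - 2 * d2 + t2) =
    x * (b - c) - ((d1 - d2) + (d1 - d2 - (t1 - t2))) by ring.
  apply/eqP; rewrite -subr_eq0 /T alg; have := Htr i.
  under eq_bigr do rewrite mulrBr; rewrite sumrB => ->.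
  by rewrite h subrr.
have Ta i : i <= a -> T i = 0.
  move=> ia; rewrite /T /w /S wa // mxrank0 mulr0 sub0r !big1 ?mulr0 ?oppr0 //.
    by move=> l' _; rewrite /u wa // mul0mx mxrank0 mulr0.
  by move=> q _; rewrite /r wa // capmx0 mxrank0.
have Tj : T j = 0.
  have [|aj] := leP j a; first exact: Ta.
  have H (m : nat) : a + m%:Z <= j -> T (a + m%:Z) = 0.
    elim: m => [|m IH] mj; first by rewrite addr0; exact: Ta.
    by rewrite Tstep; [rewrite -(IH _); [congr T|]; lia | rewrite /B; lia].
  have -> : j = a + `|j - a|%N%:Z by lia.
  by apply: H; lia.
have ge0 l' q : 0 <= u j l' - (f j l' q + f j l' (l' + 1 - q)) by rewrite subr_ge0 slope_le.
move: Tj; rewrite defect (bigD1_seq l) ?undup_uniq //= => /eqP.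
rewrite paddr_eq0; [|by apply: sumr_ge0|by apply: sumr_ge0 => l' _; apply: sumr_ge0].
case/andP => /eqP h _; have pB : (absz (p + B%:Z - 1)%R < B + B)%N by rewrite /B; lia.
have /(_ (Ordinal pB) isT) := psumr_eq0P (fun (q : 'I_(B + B)) _ => ge0 l (window B q)) h.
have -> : window B (Ordinal pB) = p by rewrite /window /=; rewrite /B; lia.
by move/eqP; rewrite subr_eq0 eq_sym => /eqP.
Qed.

Lemma W_stable j t : (cxf W j *m e t <= cxf W j)%MS.
Proof.
have H l p : (cxf W j *m eM l *m proj s e (Hpart p) <= cxf W j)%MS.
  have [lM|/(gr_out gM)->] := boolP (l \in sM); last by rewrite mulmx0 mul0mx sub0mx.
  exact: submx_trans (slope_split (slope_eq j p lM)) (WeM j l).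
(* Within weight p + q, the piece I^(p,q) is cut out by F^p and F^(p+1). *)
have -> : e t = eM (weight t) *m (proj s e (Hpart t.1) - proj s e (Hpart (t.1 + 1))).
  apply: (mx_eq_blocks ge) => a b; congr (_ *m _).
  rewrite mulmxBr mulmxBr !mulmxA /eM coarse_mull //.
  case: eqP => [at_|at_]; last first.
    by rewrite !mul0mx subrr (gr_orth ge) //; apply/eqP => at'; apply: at_; rewrite at'.
  rewrite !(gr_projl ge) (gr_mul ge) /Hpart.
  have [->|at'] := eqVneq a t; first by rewrite lexx ifF ?subr0 //; lia.
  have : a.1 != t.1.
    apply: contra at' => /eqP h; move: at_; rewrite /weight; case: a t h => x y [x' y'] /= -> /addrI ->.
    by rewrite eqxx.
  move: (e a) => X; move: a t {at_ at'} => [x y] [x' y'] /= ne.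
  by case: ifP => h1; case: ifP => h2; rewrite ?subrr //; lia.
by rewrite mulmxA mulmxBr addmx_sub // eqmx_opp.
Qed.

End Semistability.

(** * Traces on the graded pieces *)
Section TraceRank.
Variables (K : numFieldType) (n : nat).

Lemma trace_idem (e : 'M[K]_n) : e *m e = e -> \tr e = (\rank e)%:R.
Proof.
move=> ee; rewrite -{1}(mulmx_base e) mxtrace_mulC.
suff -> : row_base e *m col_base e = 1%:M by rewrite mxtrace1.
apply: (row_free_inj (row_base_free e)); apply: (row_full_inj (col_base_full e)).
by rewrite mul1mx -(mulmxA (row_base e)) !mulmx_base mulmxA mulmx_base ee.
Qed.

Variables (W : int -> 'M[K]_n) (N YM : 'M[K]_n) (sY : seq int) (eY : int -> 'M[K]_n) (E : 'M[K]_n).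
Hypothesis D : deligne_data W N YM sY eY E.
Variables (sM : seq int) (eM : int -> 'M[K]_n).
Hypotheses (gM : grading sM eM) (YME : YM = degop sM eM).

Let gY : grading sY eY. Proof. by case: D. Qed.
Let WY j : (W j == proj sY eY (upto j))%MS. Proof. by case: D. Qed.

Lemma YM_comm t l : eY t *m eM l = eM l *m eY t.
Proof. by apply: (lie_degop_comm gM); rewrite /lie -YME; case: D => _ _ -> _ _; rewrite subrr. Qed.

Lemma W_eY j t : (W j *m eY t == if (t <= j)%R then eY t else 0)%MS.
Proof.
have /andP[h1 h2] := WY j; apply/andP; split.
  by apply: submx_trans (submxMr _ h1) _; rewrite (gr_projr gY) /upto.
case: ifP => tj; last exact: sub0mx.
rewrite -{1}(gr_idem gY t); apply: submxMr; apply: submx_trans h2.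
exact: (gr_sub_proj gY).
Qed.

Lemma rank_W_part j X : (forall t, X *m eY t = eY t *m X) ->
  (\rank (W j *m X) = \sum_(t <- sY | (t <= j)%R) \rank (eY t *m X))%N.
Proof.
move=> Xe; rewrite (rank_gr gY) => [|t].
  rewrite [RHS]big_mkcond; apply: eq_bigr => t _; rewrite -mulmxA Xe mulmxA.
  have /eqmxP h := W_eY j t; rewrite (eqmxMr X h).
  by case: ifP => //; rewrite mul0mx mxrank0.
rewrite -mulmxA Xe mulmxA; apply: submxMr; have /andP[h _] := W_eY j t.
apply: submx_trans h _; case: ifP => tj; last exact: sub0mx.
have /andP[_ h] := WY j; apply: submx_trans h; exact: (gr_sub_proj gY).
Qed.

Lemma rank_gr_piece j X : (forall t, X *m eY t = eY t *m X) ->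
  (\rank (W j *m X))%:Z - (\rank (W (j - 1) *m X))%:Z = (\rank (eY j *m X))%:Z.
Proof.
move=> Xe; rewrite !rank_W_part // !(big_morph Posz PoszD (erefl 0%:Z)).
rewrite [X in X - _]big_mkcond [X in _ - X]big_mkcond -sumrB /=.
rewrite (gr_sum_pick gY (t := j)) /=.
- by rewrite lexx ifF ?subr0 //; lia.
- by move=> t tj; case: ifP => h1; case: ifP => h2; rewrite ?subrr //; lia.
- by move/(gr_out gY)->; rewrite mul0mx mxrank0 !if_same.
Qed.

(** Gr^W_j is isomorphic to the j-eigenspace of Y, on which Y_M - j is the
    commutator of E and N_0. *)
Lemma trace_weights j :
  \sum_(l <- sM) l * ((\rank (W j *m eM l))%:Z - (\rank (W (j - 1) *m eM l))%:Z) =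
  j * ((\rank (W j))%:Z - (\rank (W (j - 1)))%:Z).
Proof.
apply: (@intr_inj K); rewrite rmorph_sum /=.
have -> : (\rank (W j))%:Z - (\rank (W (j - 1)))%:Z = (\rank (eY j))%:Z.
  by rewrite -[W j]mulmx1 -[W (j - 1)]mulmx1 -[eY j]mulmx1 rank_gr_piece // => t; rewrite mul1mx mulmx1.
rewrite (eq_bigr (fun l => \tr (l%:~R *: (eY j *m eM l)))) => [|l _]; last first.
  rewrite rank_gr_piece => [|t]; last by rewrite YM_comm.
  rewrite rmorphM /= mxtraceZ trace_idem // -!mulmxA (mulmxA (eM l)) -YM_comm.
  by rewrite -!mulmxA (gr_idem gM) mulmxA (gr_idem gY).
rewrite rmorphM /= -[(Posz _)%:~R]/((\rank (eY j))%:R) -trace_idem ?(gr_idem gY) //.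
rewrite -mxtraceZ -raddf_sum /= -(degopl gY).
have -> : \sum_(l <- sM) l%:~R *: (eY j *m eM l) = eY j *m YM.
  by rewrite YME mulmx_sumr; apply: eq_bigr => l _; rewrite scalemxAr.
case: D => _ _ _ Ee [_ EN _].
have -> : YM = degop sY eY + lie E (low sY eY 0 N) by rewrite EN addrC subrK.
have h : \tr (eY j *m (low sY eY 0 N *m E)) = \tr (eY j *m (E *m low sY eY 0 N)).
  by rewrite mulmxA mxtrace_mulC !mulmxA Ee.
by rewrite mulmxDr mxtraceD /lie mulmxBr raddfB /= h subrr addr0.
Qed.

End TraceRank.

(** * Deligne's grading commutes with the Hodge grading of the limit *)
Section Compat.
Variables (K : numFieldType) (n : nat).
Variables (W : int -> 'M[K]_n) (N YM : 'M[K]_n) (sY : seq int) (eY : int -> 'M[K]_n) (E : 'M[K]_n).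
Hypothesis D : deligne_data W N YM sY eY E.
Variables (sM : seq int) (eM : int -> 'M[K]_n).
Hypotheses (gM : grading sM eM) (YME : YM = degop sM eM).
Hypothesis WN : preserves W N.

Lemma conj_grading (T : eqType) (s : seq T) (e : T -> 'M[K]_n) (A : 'M[K]_n) :
  A \in unitmx -> grading s e -> grading s (fun t => invmx A *m e t *m A).
Proof.
move=> AU [us e0 em e1]; split=> //.
- by move=> t /e0->; rewrite mulmx0 mul0mx.
- move=> t u; rewrite -!mulmxA (mulmxA A) mulmxV // mul1mx (mulmxA (e t)) em.
  by case: eqP => _ //; rewrite mul0mx mulmx0.
- by rewrite -mulmx_suml -mulmx_sumr e1 mulmx1 mulVmx.
Qed.

Lemma conj_degop (s : seq int) (e : int -> 'M[K]_n) (A : 'M[K]_n) :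
  degop s (fun t => invmx A *m e t *m A) = invmx A *m degop s e *m A.
Proof.
rewrite /degop /eigenop mulmx_sumr mulmx_suml; apply: eq_bigr => t _.
by rewrite -scalemxAr -scalemxAl.
Qed.

Lemma conj_low0 (s : seq int) (e : int -> 'M[K]_n) (A X : 'M[K]_n) : A \in unitmx ->
  low s (fun t => invmx A *m e t *m A) 0 X = invmx A *m low s e 0 (A *m X *m invmx A) *m A.
Proof.
move=> AU; rewrite /low mulmx_sumr mulmx_suml; apply: eq_bigr => t _.
by rewrite !mulmxA.
Qed.

Lemma conj_proj (T : eqType) (s : seq T) (e : T -> 'M[K]_n) (A : 'M[K]_n) P :
  proj s (fun t => invmx A *m e t *m A) P = invmx A *m proj s e P *m A.
Proof. by rewrite /proj mulmx_sumr mulmx_suml. Qed.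

Lemma conj_lie (A X Z : 'M[K]_n) : A \in unitmx ->
  lie (invmx A *m X *m A) (invmx A *m Z *m A) = invmx A *m lie X Z *m A.
Proof.
move=> AU; rewrite /lie mulmxBr mulmxBl -!mulmxA !(mulmxA A (invmx A)) mulmxV //.
by rewrite !mul1mx.
Qed.

Lemma eqmx_unit_stable m (U : 'M[K]_(m, n)) (A : 'M[K]_n) : A \in unitmx -> (U *m A <= U)%MS ->
  (U *m A :=: U)%MS.
Proof.
move=> AU UA; apply/eqmxP; rewrite UA /=.
by have := submxMr A (stable_invmx AU UA); rewrite mulmxKV.
Qed.

(** Transport of structure; the factor c^-1 on E compensates the factor c by which
    T multiplies N. *)
Lemma deligne_data_conj (T : 'M[K]_n) c : T \in unitmx -> c != 0 ->
  preserves W T -> T *m YM = YM *m T -> T *m N = c *: (N *m T) ->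
  deligne_data W N YM sY (fun t => invmx T *m eY t *m T) (c^-1 *: (invmx T *m E *m T)).
Proof.
move=> TU c0 WT TY TN; case: D => gY WY YMe Ee [YE EN NE].
have YMT : YM = invmx T *m YM *m T by rewrite -mulmxA -TY mulKmx.
have NT : N = c *: (invmx T *m N *m T) by rewrite -mulmxA scalemxAr -TN mulKmx.
have lowT : low sY (fun t => invmx T *m eY t *m T) 0 N = c *: (invmx T *m low sY eY 0 N *m T).
  rewrite conj_low0 // TN -scalemxAl mulmxK // lowZ -scalemxAr -scalemxAl //.
split.
- exact: conj_grading.
- move=> j; rewrite conj_proj; have /eqmxP h := WY j; apply/eqmxP.
  apply: eqmx_trans (eqmx_sym (eqmx_unit_stable TU (WT j))) _.
  apply: eqmx_trans (eqmxMr T h) _; apply: eqmx_sym; apply: eqmxMr.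
  by apply: eqmxMfull; rewrite row_full_unit unitmx_inv.
- have YTi : YM *m invmx T = invmx T *m YM by rewrite {1}YMT mulmxK.
  by move=> t; rewrite !mulmxA YTi -(mulmxA _ YM) YMe !mulmxA -(mulmxA _ YM T) -TY mulmxA.
- move=> t; rewrite -scalemxAl -scalemxAr; congr (_ *: _).
  by rewrite -!mulmxA !(mulmxA T (invmx T)) mulmxV // !mul1mx (mulmxA E) Ee -mulmxA.
split.
- rewrite lieZr {1}YMT conj_lie // YE scalerA -scalemxAr -scalemxAl !scalerA mulrC //.
- rewrite lowT lieZl lieZr scalerA mulVf // scale1r conj_lie // EN conj_degop mulmxBr mulmxBl.
  by rewrite -YMT.
- rewrite lowT {1}NT -scalerBr lieZl lieZr -mulmxBl -mulmxBr conj_lie // NE.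
  by rewrite mulmx0 mul0mx !scaler0.
Qed.

Variables (sP : seq int) (rho : int -> 'M[K]_n).
Hypotheses (gP : grading sP rho) (Wrho : forall j p, (W j *m rho p <= W j)%MS).
Hypotheses (YMrho : forall p, YM *m rho p = rho p *m YM) (PN : lie (degop sP rho) N = - N).

Let T := eigenop sP rho (fun p => (2 : K) ^ p).

Lemma two_neq0 : (2 : K) != 0. Proof. by rewrite pnatr_eq0. Qed.

Lemma exp2_inj p q : (2 : K) ^ p = 2 ^ q -> p = q.
Proof.
move=> h; have : (2 : K) ^ (p - q) == 1.
  by rewrite expfzDr ?two_neq0 // h -expfzDr ?two_neq0 // subrr expr0z.
rewrite pexprz_eq1 ?ler0n // => /orP[|]; first by move/eqP; lia.
by rewrite gt_eqF // ltr1n.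
Qed.

Lemma T_unit : T \in unitmx.
Proof. by apply: (eigenop_unit gP) => p; rewrite expfz_neq0 ?two_neq0. Qed.

Lemma lie_degop_off X d a b : lie (degop sP rho) X = d%:~R *: X -> b != a + d -> rho a *m X *m rho b = 0.
Proof.
move=> H ab; have := lie_degop_block gP X a b; rewrite H -scalemxAr -scalemxAl => /eqP.
rewrite -subr_eq0 -scalerBl scaler_eq0 => /orP[|/eqP//].
rewrite -rmorphB /= intr_eq0 => h; case/negP: ab; lia.
Qed.

(** Apply [deligne_data_conj] to T = 2^P, which multiplies N by 2.  By uniqueness T
    commutes with Y and multiplies E by 1/2; as 2 is not a root of unity, this
    determines the degrees for P. *)
Lemma deligne_P : (forall t p, eY t *m rho p = rho p *m eY t) /\ lie (degop sP rho) E = E.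
Proof.
have TN : T *m N = 2 *: (N *m T).
  apply: (mx_eq_blocks gP) => a b.
  rewrite -scalemxAr -scalemxAl !mulmxA (eigenopl gP) -!mulmxA (eigenopr gP) -!scalemxAl -!scalemxAr !mulmxA scalerA.
  have [->|ab] := eqVneq b (a - 1).
    by congr (_ *: _); rewrite -{2}(expr1z (2 : K)) -expfzDr ?two_neq0 // addrC subrK.
  have -> : rho a *m N *m rho b = 0 by apply: (@lie_degop_off _ (-1)); rewrite ?PN ?scaleN1r.
  by rewrite !scaler0.
have TY : T *m YM = YM *m T.
  by apply/esym/eigenop_comm => p; exact: YMrho.
have WT : preserves W T.
  by move=> j; rewrite /T /eigenop mulmx_sumr; apply: summx_sub => p _; rewrite -scalemxAr scalemx_sub.
have D' := deligne_data_conj T_unit two_neq0 WT TY TN.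
have [eYT ET] := deligne_uniq WN gM YME D D'.
split.
  move=> t; apply: (eigen_comm gP (x := fun p => (2 : K) ^ p)).
    by move=> p q _ _; exact: exp2_inj.
  by rewrite -/T {1}(eYT t) !mulmxA mulmxV ?T_unit // mul1mx.
have TE : T *m E = 2^-1 *: (E *m T).
  by rewrite {1}ET -scalemxAr !mulmxA mulmxV ?T_unit // mul1mx.
apply: (mx_eq_blocks gP) => a b; rewrite lie_degop_block //.
have := congr1 (fun X => rho a *m X *m rho b) TE.
rewrite -scalemxAr -scalemxAl !mulmxA (eigenopl gP) -!mulmxA (eigenopr gP) -!scalemxAl -!scalemxAr !mulmxA scalerA => /eqP.
rewrite -subr_eq0 -scalerBl scaler_eq0 => /orP[|/eqP->]; last by rewrite scaler0.
rewrite subr_eq0 -(exprN1 (2 : K)) -expfzDr ?two_neq0 // => /eqP h.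
have -> : b = a + 1.
  suff -> : a = -1 + b by ring.
  exact: exp2_inj.
by rewrite addrC addKr scale1r.
Qed.

End Compat.

(** * The type of N and the purity of the graded pieces *)
Section Horizontal.
Variables (R : realType) (n : nat).
Local Notation C := R[i].

Lemma cxM (A B : 'M[R]_n) : cx (A *m B) = cx A *m cx B.
Proof. by rewrite /cx map_mxM. Qed.

Lemma cxX (A : 'M[R]_n) m : cx (A ^+ m) = cx A ^+ m.
Proof.
elim: m => [|m IH]; first by rewrite !expr0 -!idmxE /cx map_mx1.
by rewrite !exprS -!mulmxE cxM IH.
Qed.

Lemma mxZX (K : fieldType) (A : 'M[K]_n) (z : K) m : (z *: A) ^+ m = z ^+ m *: A ^+ m.
Proof.
elim: m => [|m IH]; first by rewrite !expr0 scale1r.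
by rewrite !exprS -!mulmxE IH -scalemxAl -scalemxAr scalerA.
Qed.

Lemma cx_nilp (N : 'M[R]_n) m (z : C) : N ^+ m = 0 -> (z *: cx N) ^+ n = 0.
Proof. by move=> /nilp_dim Nn; rewrite mxZX -cxX Nn /cx map_mx0 scaler0. Qed.

Lemma coarse_degop (K : numFieldType) (T : eqType) s (e : T -> 'M[K]_n) (f : T -> int) :
  grading s e -> degop (undup (map f s)) (coarse s e f) = eigenop s e (fun t => (f t)%:~R).
Proof.
move=> ge; apply: (mx_eq_blocks ge) => a b; congr (_ *m _).
have -> : e a *m degop (undup (map f s)) (coarse s e f) = (f a)%:~R *: e a.
  have -> : e a = e a *m coarse s e f (f a) by rewrite coarse_mull // eqxx.
  by rewrite -mulmxA (degopl (coarse_grading ge f)) scalemxAr.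
by rewrite (eigenopl ge).
Qed.

Lemma lie_op_blocks (K : numFieldType) (T : eqType) s (e : T -> 'M[K]_n) (x : T -> K) (d : K) X :
  grading s e -> (forall a b, x b - x a != d -> e a *m X *m e b = 0) ->
  lie (eigenop s e x) X = d *: X.
Proof.
move=> ge H; apply: (mx_eq_blocks ge) => a b.
rewrite /lie mulmxBr mulmxBl !mulmxA (eigenopl ge) -!mulmxA (eigenopr ge).
rewrite -!(scalemxAr, scalemxAl) -scalerBl mulmxA; case: (eqVneq (x b - x a) d) => [<-//|h].
by rewrite H // !scaler0.
Qed.

Variables (F : int -> 'M[C]_n) (M : int -> 'M[R]_n) (s : seq (int * int)) (e : int * int -> 'M[C]_n).
Variable N : 'M[R]_n.
Hypotheses (b : bigraded F M s e) (ebar : forall t, bar (e t) = e (swap t)).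
Hypotheses (FN : forall p, (F p *m cx N <= F (p - 1))%MS) (MN : forall j, (M j *m N <= M (j - 2%:Z))%MS).

Let ge : grading s e. Proof. by case: b. Qed.

Lemma F_sub p m (v : 'M[C]_(m, n)) : (v <= F p)%MS <-> forall t, ~~ Hpart p t -> v *m e t = 0.
Proof.
by case: b => _ FI _ _; exact: (sub_eq_projP ge v (FI p)).
Qed.

(** N lowers F by 1 and M by 2 and is real, so it lowers both indices by at most 1
    and their sum by at least 2. *)
Lemma N_type t u : u != (t.1 - 1, t.2 - 1) -> e t *m cx N *m e u = 0.
Proof.
move=> ut.
have eF v p : p <= v.1 -> (e v <= F p)%MS.
  move=> pv; apply/(F_sub p) => u' nu; rewrite (gr_orth ge) //; apply: contra nu => /eqP<-.
  exact: pv.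
have h v w : ~~ (v.1 - 1 <= w.1) -> e v *m cx N *m e w = 0.
  move=> vw; apply: (F_sub (v.1 - 1) _).1 => //.
  by apply: submx_trans (FN v.1); apply: submxMr; exact: eF.
have [t1|t1] := boolP (t.1 - 1 <= u.1); last exact: h.
have [t2|t2] := boolP (t.2 - 1 <= u.2); last first.
  by apply: (can_inj (@barK R n n)); rewrite !barM bar_cx !ebar bar0; exact: h.
have w : ~~ Wpart (weight t - 2) u.
  by move: t u t1 t2 ut => [p q] [p' q']; rewrite /Wpart /weight /= xpair_eqE => *; lia.
case: b => _ _ MI _; have /andP[h1 _] := MI (weight t - 2); have /andP[_ h2] := MI (weight t).
apply: (proj_idE ge _ w); apply: submx_trans h1.
have h3 : (cxf M (weight t) *m cx N <= cxf M (weight t - 2))%MS.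
  by rewrite /cxf -cxM /cx map_submx; exact: MN.
apply: submx_trans h3; apply: submxMr; apply: submx_trans h2.
by apply: (gr_sub_proj ge); rewrite /Wpart.
Qed.

End Horizontal.

Section InducedRanks.
Variables (R : realType) (n : nat).
Local Notation C := R[i].

Lemma rank_capM (A U : 'M[C]_n) g : g \in unitmx -> (U *m g <= U)%MS ->
  \rank (A *m g :&: U)%MS = \rank (A :&: U)%MS.
Proof.
move=> gU Ug; have h := eqmx_unit_stable gU Ug.
rewrite -(cap_eqmx (eqmx_refl (A *m g)) h) -(mxrankMfree (A :&: U)%MS (B := g)) ?row_free_unit //.
apply: eqmx_rank; rewrite capmxMr andbT; apply/rV_subP => v.
rewrite sub_capmx => /andP[vA vU]; rewrite -[v](mulmxKV gU); apply: submxMr.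
by rewrite sub_capmx -[X in (_ <= X)%MS && _](mulmxK gU A) -[X in _ && (_ <= X)%MS](mulmxK gU U) !submxMr.
Qed.

(** Purity of Gr^W_j for F g in terms of ranks attached to F itself: the conjugate of
    F g and F g itself meet the real space W_j in the same rank, which is that of F
    since g preserves W_j. *)
Lemma gr_hodge_ranks (F : int -> 'M[C]_n) (W : int -> 'M[R]_n) (g : 'M[C]_n) :
  increasing_filtration W -> g \in unitmx -> preserves (cxf W) g ->
  is_mhs (filtration_act F g) W ->
  forall j p,
  let w j : int := (\rank (cxf W j))%:Z in
  let r j p : int := (\rank (F p :&: cxf W j)%MS)%:Z in
  (r j p - r (j - 1) p) + (r j (j + 1 - p) - r (j - 1) (j + 1 - p)) = w j - w (j - 1).
Proof.
move=> hW gU Wg [_ H] j p /=; have [] := H j p; set A := Pilot.Defs.induced _ _ _; set B := Pilot.Defs.induced _ _ _.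
move=> /eqmxP hs /eqmxP hc.
have WS : (cxf W (j - 1) <= cxf W j)%MS by apply: cxfS => //; lia.
have indR (X : 'M[C]_n) : (\rank (Pilot.Defs.induced (cxf W) j X) + \rank (X :&: cxf W (j - 1)) =
    \rank (X :&: cxf W j) + \rank (cxf W (j - 1)))%N.
  rewrite /Pilot.Defs.induced -[RHS]mxrank_sum_cap; congr addn; apply: eqmx_rank.
  apply/andP; split; last exact: capmxS (capmxSl _ _) (submx_refl _).
  by rewrite !sub_capmx capmxSl capmxSr (submx_trans (capmxSr _ _) WS).
have barR (X : 'M[C]_n) i : \rank (bar X :&: cxf W i)%MS = \rank (X :&: cxf W i)%MS.
  rewrite -[X in (bar _ :&: X)%MS](bar_cx (W i)) -(mxrank_map Num.conj (X :&: _)%MS).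
  by rewrite map_capmx.
have rA := indR (filtration_act F g p); have rB := indR (bar (filtration_act F g (j + 1 - p))).
have := mxrank_sum_cap A B; rewrite hs hc; move: rA rB.
rewrite -/A -/B !barR /filtration_act !rank_capM //; lia.
Qed.

End InducedRanks.

(** * Structure of the limit *)
Section Setup.
Variables (R : realType) (n : nat).
Local Notation C := R[i].

Definition hodge_op (s : seq (int * int)) (e : int * int -> 'M[C]_n) : 'M[C]_n :=
  eigenop s e (fun t => t.1%:~R).

(** What the sequel uses of the limit: [e] are the projections to the I^(p,q), [eY]
    those to the eigenspaces of Deligne's grading Y, and [E] is N_0^+. *)
Record limit_data (W : int -> 'M[R]_n) (N : 'M[R]_n) (F : int -> 'M[C]_n) (YM : 'M[C]_n)
    (s : seq (int * int)) (e : int * int -> 'M[C]_n)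
    (sY : seq int) (eY : int -> 'M[C]_n) (E : 'M[C]_n) : Prop := LimitData {
  ld_gr : grading s e;
  ld_F : forall p m (v : 'M[C]_(m, n)), (v <= F p)%MS <-> forall t, ~~ Hpart p t -> v *m e t = 0;
  ld_bar : forall t, bar (e t) = e (swap t);
  ld_YM : YM = eigenop s e (fun t => (weight t)%:~R);
  ld_del : deligne_data (cxf W) (cx N) YM sY eY E;
  ld_W : forall j t, (cxf W j *m e t <= cxf W j)%MS;
  ld_N : forall t u, u != (t.1 - 1, t.2 - 1) -> e t *m cx N *m e u = 0;
  ld_eYbar : forall j, bar (eY j) = eY j;
  ld_Ebar : bar E = E;
  ld_eYe : forall j t, eY j *m e t = e t *m eY j;
  ld_PE : lie (hodge_op s e) E = E }.

Lemma cx_preserves (W : int -> 'M[R]_n) N : preserves W N -> preserves (cxf W) (cx N).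
Proof. by move=> WN j; rewrite /cxf -cxM /cx map_submx. Qed.

Lemma cxf_increasing (W : int -> 'M[R]_n) : increasing_filtration W -> increasing_filtration (cxf W).
Proof.
move=> hW; have [_ [a Wa] [b Wb]] := hW; split.
- by move=> i j ij; apply: cxfS.
- by exists a; rewrite /cxf /cx Wa map_mx0.
- exists b; move: Wb; rewrite /cxf /cx => /eqmxP h; apply/eqmxP.
  by rewrite -(map_mx1 (real_complex R)); apply/map_eqmx.
Qed.

Lemma bar_lie (A B : 'M[C]_n) : bar (lie A B) = lie (bar A) (bar B).
Proof. by rewrite /lie barB !barM. Qed.

Lemma bar_low s (e : int -> 'M[C]_n) d X : bar (low s e d X) = low s (fun t => bar (e t)) d (bar X).
Proof. by rewrite /low bar_sum; apply: eq_bigr => a _; rewrite !barM. Qed.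

Lemma bar_degop s (e : int -> 'M[C]_n) : bar (degop s e) = degop s (fun t => bar (e t)).
Proof. by rewrite /degop bar_sum; apply: eq_bigr => a _; rewrite barZ rmorph_int. Qed.

Lemma bar_grading (T : eqType) s (e : T -> 'M[C]_n) :
  grading s e -> grading s (fun t => bar (e t)).
Proof.
move=> [us e0 em e1]; split=> //.
- by move=> t /e0->; rewrite bar0.
- by move=> t u; rewrite -barM em; case: eqP => //; rewrite bar0.
- by rewrite -bar_sum e1 bar1.
Qed.

Lemma bar_deligne_data W (N YM : 'M[C]_n) s e E :
  (forall j, bar (W j) = W j) -> bar N = N -> bar YM = YM ->
  deligne_data W N YM s e E -> deligne_data W N YM s (fun t => bar (e t)) (bar E).
Proof.
move=> bW bN bY [ge We Ye Ee [YE EN NE]]; split.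
- exact: bar_grading.
- move=> j; rewrite /proj -bar_sum -(bW j) !bar_sub; exact: We.
- by move=> t; rewrite -bY -!barM Ye.
- by move=> t; rewrite -!barM Ee.
split.
- by rewrite -bY -bar_lie YE barZ rmorph_nat.
- by rewrite -bN -bar_low -bar_lie EN barB bY bar_degop.
- by rewrite -bN -bar_low -barB -bar_lie NE bar0.
Qed.

(** Stability of W under the I^(p,q) comes first, as the compatibility of Y with P
    relies on it; the reality of Y and E is an instance of uniqueness. *)
Lemma limit_data_exists (W Q : int -> 'M[R]_n) (h : int -> int -> nat) (N : 'M[R]_n)
    (F : int -> 'M[C]_n) (M : int -> 'M[R]_n) (Y : 'M[C]_n) :
  increasing_filtration W -> admissible_nilpotent_orbit W Q h N F M -> split_mhs F M ->
  deligne_grading (cxf W) (cx N) (deligne_Y F M) Y ->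
  exists s e sY eY E, limit_data W N F (deligne_Y F M) s e sY eY E /\ Y = degop sY eY.
Proof.
move=> hW [[[WN _] [m Nm]] _ FN [_ MN _] [y0 hD]] hsplit hY.
have [s [e [b ebar YME]]] := split_data hsplit.
have ge : grading s e by case: b.
pose sM := undup (map weight s); pose eM := coarse s e weight.
have gM : grading sM eM := coarse_grading ge weight.
have YMd : deligne_Y F M = degop sM eM by rewrite YME -coarse_degop.
pose sP := undup (map fst s); pose rho := coarse s e fst.
have gP : grading sP rho := coarse_grading ge fst.
have Pd : hodge_op s e = degop sP rho by rewrite /hodge_op -coarse_degop.
have Nt := N_type b ebar FN MN.
have WN' := cx_preserves WN.
have PN : lie (degop sP rho) (cx N) = - cx N.
  rewrite -Pd -scaleN1r; apply: (lie_op_blocks ge) => a c ac; apply: Nt.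
  by apply: contra ac => /eqP->; rewrite /= -rmorphB /= addrC addKr rmorphN.
have [sY [eY [E [D YE]]]] := deligne_data_of (cxf_increasing hW) hY.
have WeM j l : (cxf W j *m eM l <= cxf W j)%MS.
  by case: (D) => gY WY _ _ _; apply: (deg_preserves gY WY) => t; rewrite (YM_comm D gM).
have ynz : y0 < `|y0| + 1 by rewrite (le_lt_trans (ler_norm _)) // ltrDl.
have [mhs _ _] := hD 0 _ ynz.
have Nn (z : C) : (z *: cx N) ^+ n = 0 by apply: cx_nilp Nm.
have Wst : forall j t, (cxf W j *m e t <= cxf W j)%MS.
  have [_ FI _ _] := b; apply: (W_stable ge FI ebar hW WeM).
    apply: (gr_hodge_ranks hW (expmx_unit (Nn _))) mhs.
    move=> j; apply: expmx_stable; rewrite -scalemxAr scalemx_sub //; exact: WN'.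
  exact: (trace_weights D gM YMd).
have barW j : bar (cxf W j) = cxf W j by exact: bar_cx.
have barYM : bar (deligne_Y F M) = deligne_Y F M.
  rewrite YMd bar_degop /degop; apply: eq_bigr => t _; congr (_ *: _); exact: (eM_bar ge).
have Db := bar_deligne_data barW (bar_cx N) barYM D.
have [eYb Eb] := deligne_uniq WN' gM YMd D Db.
have rM p l : eM l *m rho p = rho p *m eM l.
  by rewrite /rho /coarse /proj mulmx_sumr mulmx_suml; apply: eq_bigr => t _; rewrite (weight_comm ge).
have Wrho j p : (cxf W j *m rho p <= cxf W j)%MS.
  by rewrite /rho /coarse /proj mulmx_sumr; apply: summx_sub => t _.
have YMrho p : deligne_Y F M *m rho p = rho p *m deligne_Y F M.
  rewrite YMd /degop [LHS]mulmx_suml [RHS]mulmx_sumr; apply: eq_bigr => t _.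
  by rewrite -scalemxAl -scalemxAr rM.
have [eYrho PE] := deligne_P D gM YMd WN' gP Wrho YMrho PN.
have eYe j t : eY j *m e t = e t *m eY j.
  have -> : e t = rho t.1 *m eM (weight t).
    apply: (mx_eq_blocks ge) => a c; congr (_ *m _).
    rewrite mulmxA (coarse_mull ge) (gr_mul ge).
    case: (eqVneq a.1 t.1) => at1; last first.
      by rewrite mul0mx ifF //; apply/negP => /eqP at'; move: at1; rewrite at' eqxx.
    rewrite (coarse_mull ge); congr (if _ then _ else _).
    move: a t at1 => [x y] [x' y'] /= ->; rewrite xpair_eqE eqxx /weight /=.
    by rewrite (inj_eq (addrI _)).
  by rewrite mulmxA eYrho -!mulmxA (YM_comm D gM YMd).
exists s, e, sY, eY, E; split; last exact: YE.
apply: (LimitData ge (F_sub b) ebar YME D Wst Nt _ _ eYe _).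
- by move=> j; rewrite -eYb.
- by rewrite -Eb.
- by rewrite Pd.
Qed.

End Setup.

(** * Products of gradings and intertwining operators *)
Section ProductGradings.
Variables (K : fieldType) (n : nat).

Lemma product_grading (T U : eqType) s1 s2 (e1 : T -> 'M[K]_n) (e2 : U -> 'M[K]_n) :
  grading s1 e1 -> grading s2 e2 -> (forall t u, e1 t *m e2 u = e2 u *m e1 t) ->
  grading (allpairs pair s1 s2) (fun v => e1 v.1 *m e2 v.2).
Proof.
move=> g1 g2 comm; split.
- by apply: allpairs_uniq; [exact: gr_uniq g1 | exact: gr_uniq g2 | move=> [a b] [c d]].
- move=> [t u] h /=; have [tin|/(gr_out g1)->] := boolP (t \in s1); last by rewrite mul0mx.
  have [uin|/(gr_out g2)->] := boolP (u \in s2); last by rewrite mulmx0.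
  by case/negP: h; apply/allpairsP; exists (t, u).
- move=> [a b] [c d] /=; rewrite -mulmxA (mulmxA (e2 b)) -comm -mulmxA mulmxA.
  rewrite (gr_mul g1) (gr_mul g2) xpair_eqE.
  by case: (a == c); case: (b == d); rewrite ?(mulmx0, mul0mx).
rewrite big_allpairs_dep /=; rewrite -(gr_sum g1); apply: eq_bigr => t _.
by rewrite -mulmx_sumr (gr_sum g2) mulmx1.
Qed.

Lemma reindex_grading (T U : eqType) s (e : T -> 'M[K]_n) (f : T -> U) (g : U -> T) :
  cancel f g -> cancel g f -> grading s e -> grading (map f s) (fun u => e (g u)).
Proof.
move=> fg gf [us e0 em e1]; split.
- by rewrite map_inj_uniq //; exact: can_inj fg.
- by move=> u h; apply: e0; apply: contra h => h; rewrite -(gf u) map_f.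
- by move=> u v; rewrite em (can_eq gf).
- by rewrite big_map -[RHS]e1; apply: eq_bigr => t _; rewrite fg.
Qed.

End ProductGradings.

Lemma unitmx_mul3 (K : fieldType) n (A B D : 'M[K]_n) :
  A \in unitmx -> B \in unitmx -> D \in unitmx -> A *m B *m D \in unitmx.
Proof. by move=> hA hB hD; rewrite !unitmx_mul hA hB hD. Qed.

Lemma eigen_block (K : fieldType) n (A B w X X' : 'M[K]_n) (x y : K) :
  A *m X = x *: A -> X' *m B = y *: B -> X *m w = w *m X' -> x != y -> A *m w *m B = 0.
Proof.
move=> hA hB hw xy; have := congr1 (fun Z => A *m Z *m B) hw.
rewrite !mulmxA hA -!mulmxA hB -!scalemxAr -scalemxAl mulmxA => /eqP.
by rewrite -subr_eq0 -scalerBl scaler_eq0 subr_eq0 (negbTE xy) => /eqP.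
Qed.

Lemma intertwine_blocks (K : fieldType) n (T U : eqType) s s' (a : T -> 'M[K]_n)
    (b : U -> 'M[K]_n) (f : T -> U) (w : 'M[K]_n) :
  grading s a -> grading s' b -> injective f ->
  (forall t u, u != f t -> a t *m w *m b u = 0) -> forall t, a t *m w = w *m b (f t).
Proof.
move=> ga gb fi off t; transitivity (a t *m w *m b (f t)).
  rewrite {1}(gr_sumr gb (a t *m w)); apply: (gr_sum_pick gb) => [u|]; first exact: off.
  by move/(gr_out gb)->; rewrite mulmx0.
rewrite [RHS](gr_suml ga) -mulmxA; apply/esym.
rewrite (gr_sum_pick ga (t := t)) // => [u ut|/(gr_out ga)->]; last by rewrite !mul0mx.
by rewrite mulmxA off // (inj_eq fi) eq_sym.
Qed.

(** * The Weyl element of SL_2 *)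
Section Weyl.
Variables (K : numFieldType) (n : nat) (E F H : 'M[K]_n) (c t : K).
Hypotheses (EF : lie E F = H) (HE : lie H E = 2 *: E) (HF : lie H F = - (2 *: F)).
Hypotheses (En : E ^+ n = 0) (Fn : F ^+ n = 0) (ct : c * t = -1).

Lemma scaled_nilp (a : K) (X : 'M[K]_n) : X ^+ n = 0 -> (a *: X) ^+ n = 0.
Proof. by move=> Xn; rewrite mxZX Xn scaler0. Qed.

Lemma expmx_conjE (A X Z Z' : 'M[K]_n) : A ^+ n = 0 ->
  A *m X - X *m A = Z -> A *m Z - Z *m A = Z' -> A *m Z' - Z' *m A = 0 ->
  expmx A *m X = (X + Z + 2^-1 *: Z') *m expmx A.
Proof.
move=> An hX hZ hZ'; have NAn : (- A) ^+ n = 0 by rewrite -scaleN1r scaled_nilp.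
rewrite -(@exp_conj2 _ _ _ _ _ Z Z' An NAn) ?mulmxN //.
by rewrite -(mulmxA _ (expmx (- A))) (mulmx1C (expmxN An)) mulmx1.
Qed.

(** When c t = -1 this product of three exponentials represents the nontrivial
    element of the Weyl group; the condition makes the coefficients of E and F cancel
    in the successive conjugates of H. *)
Lemma weyl_H : (expmx (c *: E) *m expmx (t *: F) *m expmx (c *: E)) *m H =
  - (H *m (expmx (c *: E) *m expmx (t *: F) *m expmx (c *: E))).
Proof.
have cEn := scaled_nilp c En; have tFn := scaled_nilp t Fn.
have s1 : expmx (c *: E) *m H = (H + (2 * c) *: E) *m expmx (c *: E).
  rewrite (@expmx_conjE _ _ ((2 * c) *: E) 0) ?scaler0 ?addr0 //.
  - rewrite -scalemxAl -scalemxAr -scalerBr -[_ - _]/(lie H E) HE scalerA mulrC //.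
  - by rewrite -!scalemxAl -!scalemxAr !scalerA mulrC subrr.
  - by rewrite mulmx0 mul0mx subrr.
have s2 : expmx (t *: F) *m (H + (2 * c) *: E) = (- H + (2 * c) *: E) *m expmx (t *: F).
  pose Z := (- 2 * t) *: F + (2 * c * t) *: H.
  pose Z' := (- 4 * c * t ^+ 2) *: F.
  rewrite (@expmx_conjE _ _ Z Z') //.
  - congr (_ *m _); rewrite /Z /Z'.
    have -> : 2 * c * t = - 2 by rewrite -mulrA ct mulrN1.
    have -> : - 4 * c * t ^+ 2 = 4 * t by rewrite expr2 !mulrA -(mulrA _ c t) ct; ring.
    by apply/matrixP => i j; rewrite !(mxDE, mxNE, mxZE, mx0E); field.
  - have -> : (t *: F) *m (H + (2 * c) *: E) - (H + (2 * c) *: E) *m (t *: F) =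
      t *: lie H F + (2 * c * t) *: lie E F by rewrite /lie; mxlin.
    by rewrite HF EF /Z; apply/matrixP => i j; rewrite !(mxDE, mxNE, mxZE); ring.
  - have -> : (t *: F) *m Z - Z *m (t *: F) = (2 * c * t ^+ 2) *: lie H F.
      by rewrite /Z /lie; mxlin.
    by rewrite HF /Z'; apply/matrixP => i j; rewrite !(mxDE, mxNE, mxZE); ring.
  - by rewrite /Z' -!scalemxAl -!scalemxAr !scalerA mulrC subrr.
rewrite -!mulmxA s1 (mulmxA (expmx (t *: F))) s2 !mulmxA -!mulNmx; congr (_ *m _ *m _).
have s3 : expmx (c *: E) *m (- H + (2 * c) *: E) =
    - (expmx (c *: E) *m H) + (2 * c) *: E *m expmx (c *: E).
  rewrite mulmxDr mulmxN; congr (_ + _); rewrite -scalemxAr -scalemxAl; congr (_ *: _).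
  by apply/esym; apply: expmx_comm; rewrite -scalemxAr -scalemxAl.
by rewrite s3 s1 mulmxDl opprD subrK mulNmx.
Qed.

End Weyl.

(** * Operators lowering both Hodge indices *)
Section CayleyBigrading.
Variables (R : realType) (n : nat).
Local Notation C := R[i].
Variables (W : int -> 'M[R]_n) (N : 'M[R]_n) (F : int -> 'M[C]_n) (YM : 'M[C]_n)
    (s : seq (int * int)) (e : int * int -> 'M[C]_n)
    (sY : seq int) (eY : int -> 'M[C]_n) (E : 'M[C]_n) (k : nat).
Hypothesis LD : limit_data W N F YM s e sY eY E.
Hypothesis Ndec : cx N = \sum_(j < k.+1) low sY eY j%:Z (cx N).

Let ge := ld_gr LD.
Let gY : grading sY eY. Proof. by case: (ld_del LD). Qed.
Let N0 := low sY eY 0 (cx N).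
Let Y := degop sY eY.
Let H := YM - Y.
Let P := hodge_op s e.

Lemma YM_eY t : YM *m eY t = eY t *m YM. Proof. by case: (ld_del LD). Qed.
Lemma E_eY t : E *m eY t = eY t *m E. Proof. by case: (ld_del LD). Qed.
Lemma N0_eY t : N0 *m eY t = eY t *m N0. Proof. exact: low0_comm. Qed.

Lemma lie_YM_N : lie YM (cx N) = - (2 : C) *: cx N.
Proof.
rewrite (ld_YM LD); apply: (lie_op_blocks ge) => a b ab; apply: (ld_N LD).
apply: contra ab => /eqP->; rewrite /weight /= -rmorphB /=; apply/eqP.
by have -> : a.1 - 1 + (a.2 - 1) - (a.1 + a.2) = -2 :> int by ring.
Qed.

Lemma lie_P_N : lie P (cx N) = - (1 : C) *: cx N.
Proof.
apply: (lie_op_blocks ge) => a b ab; apply: (ld_N LD).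
apply: contra ab => /eqP->; rewrite /= -rmorphB /=; apply/eqP.
by have -> : a.1 - 1 - a.1 = -1 :> int by ring.
Qed.

Lemma P_eY t : P *m eY t = eY t *m P.
Proof.
rewrite /P /hodge_op [LHS]mulmx_suml [RHS]mulmx_sumr; apply: eq_bigr => u _.
by rewrite -scalemxAl -scalemxAr (ld_eYe LD).
Qed.

Lemma lie_H_deg X : (forall t, X *m eY t = eY t *m X) -> lie H X = lie YM X.
Proof. by move=> hX; rewrite -[RHS]subr0 -(comm_degop sY hX) -lieBl. Qed.

Lemma lie_H_E : lie H E = 2 *: E.
Proof. by rewrite lie_H_deg; [case: (ld_del LD) => _ _ _ _ [] | exact: E_eY]. Qed.

Lemma lie_E_N0 : lie E N0 = H.
Proof. by case: (ld_del LD) => _ _ _ _ []. Qed.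

Lemma lie_YM_low d : lie YM (low sY eY d (cx N)) = - (2 : C) *: low sY eY d (cx N).
Proof. by rewrite low_lie ?lie_YM_N ?lowZ //; exact: YM_eY. Qed.

Lemma lie_P_low d : lie P (low sY eY d (cx N)) = - (1 : C) *: low sY eY d (cx N).
Proof. by rewrite low_lie ?lie_P_N ?lowZ //; exact: P_eY. Qed.

Lemma lie_H_N0 : lie H N0 = - (2 *: N0).
Proof. by rewrite lie_H_deg ?lie_YM_low ?scaleNr //; exact: N0_eY. Qed.

Lemma weight_nilpotent X (d : int) : d != 0 -> lie YM X = d%:~R *: X -> X ^+ n = 0.
Proof.
move=> d0; have gM := coarse_grading ge weight.
rewrite (ld_YM LD) -(coarse_degop weight ge) => hX.
have off a b : b != a + d -> coarse s e weight a *m X *m coarse s e weight b = 0.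
  exact: (lie_degop_off gM hX).
have [d1|d1] := ltP d 0.
  apply: (lower_nilpotent (ht := id) gM) => a b ab; apply: off.
  by apply: contra ab => /eqP ->; lia.
apply: (lower_nilpotent (ht := -%R) gM) => a b ab; apply: off.
by apply: contra ab => /eqP ->; lia.
Qed.

Lemma E_nil : E ^+ n = 0.
Proof. by apply: (@weight_nilpotent _ 2) => //; case: (ld_del LD) => _ _ _ _ []. Qed.

Lemma N0_nil : N0 ^+ n = 0.
Proof. by apply: (@weight_nilpotent _ (-2)) => //; rewrite lie_YM_low rmorphN. Qed.

(** The algebra without unit generated by the sl_2-modules of the N_(-j), j > 0.  It
    is stable under ad N_0 and ad E, and all its elements will be seen to lower both
    indices of the J^(p,q). *)
Inductive lower_part : 'M[C]_n -> Prop :=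
| LowerGen m j : lower_part (iter m (lie N0) (low sY eY j.+1%:Z (cx N)))
| Lower0 : lower_part 0
| LowerD X Z of lower_part X & lower_part Z : lower_part (X + Z)
| LowerZ a X of lower_part X : lower_part (a *: X)
| LowerM X Z of lower_part X & lower_part Z : lower_part (X *m Z).

Lemma lower_lie A :
  (forall m j, lower_part (lie A (iter m (lie N0) (low sY eY j.+1%:Z (cx N))))) ->
  forall X, lower_part X -> lower_part (lie A X).
Proof.
move=> gen X; elim=> {X} [m j||X Z _ hX _ hZ|a X _ hX|X Z X1 hX Z1 hZ].
- exact: gen.
- by rewrite lie0r; exact: Lower0.
- by rewrite lieD; exact: LowerD.
- by rewrite lieZr; exact: LowerZ.
- by rewrite lieM; apply: LowerD; apply: LowerM.
Qed.

Lemma lower_lie_N0 X : lower_part X -> lower_part (lie N0 X).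
Proof. by apply: lower_lie => m j; exact: (LowerGen m.+1 j). Qed.

(** Deligne's condition [N - N_0, E] = 0, degree by degree. *)
Lemma lie_E_low j : lie E (low sY eY j.+1%:Z (cx N)) = 0.
Proof.
rewrite low_lie; last exact: E_eY.
have -> : lie E (cx N) = lie E N0 - lie (cx N - N0) E by rewrite (lieC _ E) opprK -lieD addrC subrK.
case: (ld_del LD) => _ _ _ _ [_ _ ->]; rewrite subr0 lie_E_N0.
apply: (low_weight_off gY (d := 0)) => //; rewrite scale0r oppr0 comm_degop // => t.
by apply: commB; [exact: YM_eY | rewrite (degopl gY) (degopr gY)].
Qed.

Lemma lie_H_low m j : lie H (iter m (lie N0) (low sY eY j.+1%:Z (cx N))) =
  (j%:R - 1 - 2 * m%:R) *: iter m (lie N0) (low sY eY j.+1%:Z (cx N)).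
Proof.
elim: m => [|m IH].
  have -> : lie H (low sY eY j.+1%:Z (cx N)) =
     lie YM (low sY eY j.+1%:Z (cx N)) - lie Y (low sY eY j.+1%:Z (cx N)) by rewrite -lieBl.
  rewrite lie_YM_low (low_weight gY) /= opprK -scalerDl; congr (_ *: _).
  by rewrite -[(Posz _)%:~R]/(j.+1%:R) -natr1; ring.
rewrite iterS lie_jacobi IH lieZr lie_H_N0.
have -> X : lie (- (2 *: N0)) X = - (2 : C) *: lie N0 X by rewrite -scaleNr lieZl.
by rewrite -scalerDl; congr (_ *: _); rewrite -natr1; ring.
Qed.

Lemma lower_lie_E X : lower_part X -> lower_part (lie E X).
Proof.
apply: lower_lie => m j; elim: m => [|m IH]; first by rewrite lie_E_low; exact: Lower0.
rewrite iterS lie_jacobi lie_E_N0 lie_H_low; apply: LowerD; first exact: lower_lie_N0.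
by apply: LowerZ; exact: LowerGen.
Qed.

(** N_(-j-1) is a highest weight vector of weight j - 1. *)
Lemma low_top j : iter j (lie N0) (low sY eY j.+1%:Z (cx N)) = 0.
Proof.
apply: (ad_top lie_E_N0 lie_H_N0 _ (lie_E_low j) N0_nil).
by have := lie_H_low 0 j; rewrite mulr0 subr0.
Qed.

Let sP := undup (map fst s).
Let rho := coarse s e fst.
Let gP : grading sP rho := coarse_grading ge fst.

Lemma P_degop : P = degop sP rho.
Proof. by rewrite /P /hodge_op -(coarse_degop _ ge). Qed.

Lemma rho_eY p j : rho p *m eY j = eY j *m rho p.
Proof.
rewrite /rho /coarse /proj [LHS]mulmx_suml [RHS]mulmx_sumr; apply: eq_bigr => t _.
by rewrite (ld_eYe LD).
Qed.

(** Projection to J^(p,q), where P = p and Y = p + q. *)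
Definition Jpiece (t : int * int) : 'M[C]_n := coarse s e fst t.1 *m eY (t.1 + t.2).
Definition Jindex : seq (int * int) :=
  map (fun t : int * int => (t.1, t.2 - t.1)) (allpairs pair (undup (map fst s)) sY).

Lemma J_grading : grading Jindex Jpiece.
Proof.
apply: (reindex_grading (g := fun t : int * int => (t.1, t.1 + t.2)) _ _
  (product_grading gP gY rho_eY)).
- by move=> [a b] /=; congr pair; ring.
- by move=> [a b] /=; congr pair; ring.
Qed.
Let gJ := J_grading.

Lemma J_P t : Jpiece t *m P = t.1%:~R *: Jpiece t.
Proof. by rewrite P_degop /Jpiece rho_eY -mulmxA (degopl gP) scalemxAr. Qed.

Lemma J_Y t : Jpiece t *m Y = (t.1 + t.2)%:~R *: Jpiece t.
Proof. by rewrite /Jpiece -mulmxA (degopl gY) scalemxAr. Qed.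

Lemma sub_F_J p m (v : 'M[C]_(m, n)) :
  (v <= F p)%MS <-> forall t, ~~ Hpart p t -> v *m Jpiece t = 0.
Proof.
split=> [/(ld_F LD) h t nt|h].
  rewrite /Jpiece /coarse /proj mulmxA mulmx_sumr big1 ?mul0mx // => u /eqP ut.
  by apply: h; rewrite /Hpart ut.
apply/(ld_F LD) => t nt.
have -> : e t = rho t.1 *m e t by rewrite /rho coarse_mulr // eqxx.
suff -> : rho t.1 = \sum_(j <- sY) Jpiece (t.1, j - t.1).
  rewrite mulmxA mulmx_sumr big1 ?mul0mx // => j _; exact: h.
rewrite (gr_sumr gY (rho t.1)); apply: eq_bigr => j _; rewrite /Jpiece /=.
by rewrite addrC subrK.
Qed.

Lemma sub_W_J j m (v : 'M[C]_(m, n)) :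
  (v <= cxf W j)%MS <-> forall t, ~~ Wpart j t -> v *m Jpiece t = 0.
Proof.
have WY : forall j, (cxf W j == proj sY eY (upto j))%MS by case: (ld_del LD).
have /andP[h1 h2] := WY j; split=> [vW t nt|h].
  rewrite /Jpiece -[coarse _ _ _ _]/(rho t.1) rho_eY mulmxA.
  by rewrite (proj_idE gY (submx_trans vW h1)) ?mul0mx.
apply: submx_trans h2; apply/(sub_projP gY) => i ni.
suff -> : eY i = \sum_(p <- sP) Jpiece (p, i - p).
  by rewrite mulmx_sumr big1 // => p _; apply: h; rewrite /Wpart /= addrC subrK.
rewrite (gr_suml gP (eY i)); apply: eq_bigr => p _; rewrite /Jpiece /=.
by rewrite addrC subrK.
Qed.

Lemma low_block_J X (a b : int * int) (d d' : C) :
  lie P X = d *: X -> lie Y X = d' *: X ->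
  (b.1 - a.1)%:~R != d \/ (b.1 + b.2 - (a.1 + a.2))%:~R != d' -> Jpiece a *m X *m Jpiece b = 0.
Proof.
have Jl t : P *m Jpiece t = t.1%:~R *: Jpiece t.
  by rewrite P_degop /Jpiece mulmxA (degopr gP) scalemxAl.
have Jl' t : Y *m Jpiece t = (t.1 + t.2)%:~R *: Jpiece t.
  by rewrite /Jpiece -[coarse _ _ _ _]/(rho t.1) rho_eY mulmxA (degopr gY) scalemxAl.
have key A x y c : Jpiece a *m A = x *: Jpiece a -> A *m Jpiece b = y *: Jpiece b ->
    lie A X = c *: X -> y - x != c -> Jpiece a *m X *m Jpiece b = 0.
  move=> ha hb hX xy; have := congr1 (fun Z => Jpiece a *m Z *m Jpiece b) hX.
  rewrite /lie mulmxBr mulmxBl !mulmxA ha -!mulmxA hb -!(scalemxAr, scalemxAl) mulmxA => /eqP.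
  rewrite -subr_eq0 -!scalerBl scaler_eq0 subr_eq0 => /orP[h|/eqP//].
  by rewrite h in xy.
move=> hP hY [h|h].
  by apply: (key P _ _ _ (J_P a) (Jl b) hP); rewrite -rmorphB.
by apply: (key Y _ _ _ (J_Y a) (Jl' b) hY); rewrite -rmorphB.
Qed.

Lemma low_iter m j : let X := iter m (lie N0) (low sY eY j.+1%:Z (cx N)) in
  lie P X = (- (1 + m%:R : C)) *: X /\ lie Y X = (- (j.+1%:R : C)) *: X.
Proof.
have YN0 : lie Y N0 = 0 by apply: comm_degop; exact: N0_eY.
elim: m => [|m [IHP IHY]] /=.
  by rewrite addr0 lie_P_low; split=> //; rewrite (low_weight gY) -scaleNr.
split; rewrite lie_jacobi.
  rewrite IHP lieZr lie_P_low lieZl -scalerDl; congr (_ *: _).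
  by rewrite -(natr1 m); ring.
by rewrite IHY lieZr YN0 /lie mulmx0 mul0mx subr0 addr0.
Qed.

(** The generator (ad N_0)^m N_(-j-1) changes p by -1 - m and p + q by -j - 1, hence
    q by m - j.  It vanishes if m >= j by [low_top], and otherwise lowers p and q. *)
Lemma lower_strict X : lower_part X ->
  forall t u, ~~ below t.1 t.2 u -> Jpiece t *m X *m Jpiece u = 0.
Proof.
elim=> {X} [m j||X Z _ hX _ hZ|a X _ hX|X Z _ hX _ hZ] t u tu.
- have [jm|mj] := leqP j m.
    rewrite -(subnK jm) iterD low_top (_ : iter _ _ _ = 0) ?mulmx0 ?mul0mx //.
    by elim: (m - j)%N => //= i ->; rewrite lie0r.
  have [hP hY] := low_iter m j; apply: (low_block_J hP hY).
  apply/orP; rewrite -negb_and; apply: contra tu => /andP[/eqP h1 /eqP h2].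
  have e1 : u.1 - t.1 = - (1 + m%:Z).
    by apply: (@intr_inj C); rewrite h1 rmorphN rmorphD.
  have e2 : u.1 + u.2 - (t.1 + t.2) = - (j.+1%:Z).
    by apply: (@intr_inj C); rewrite h2 rmorphN.
  by move: t u e1 e2 {h1 h2} => [p q] [p' q']; rewrite /below /= => *; lia.
- by rewrite mulmx0 mul0mx.
- by rewrite mulmxDr mulmxDl hX // hZ // addr0.
- by rewrite -scalemxAr -scalemxAl hX // scaler0.
rewrite mulmxA (gr_sumr gJ (Jpiece t *m X)) !mulmx_suml big1 // => v _.
have [tv|tv] := boolP (below t.1 t.2 v); last by rewrite hX // !mul0mx.
rewrite (gr_split gJ) hZ ?mulmx0 //.
by apply: contra tu; move: t u v tv => [? ?] [? ?] [? ?]; rewrite /below /=; lia.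
Qed.

Lemma N_minus_N0 : lower_part (cx N - N0).
Proof.
rewrite {1}Ndec big_ord_recl /= addrC addrA addNr add0r.
elim/big_ind: _ => [|X Z|i _]; [exact: Lower0|exact: LowerD|].
exact: (LowerGen 0 i).
Qed.

Lemma bar_P : bar P = YM - P.
Proof.
have eP t : e t *m P = t.1%:~R *: e t.
  have -> : e t = e t *m rho t.1 by rewrite /rho (coarse_mull ge) eqxx.
  by rewrite P_degop -mulmxA (degopl gP) scalemxAr.
have eYM t : e t *m YM = (weight t)%:~R *: e t.
  have -> : e t = e t *m coarse s e weight (weight t) by rewrite (coarse_mull ge) eqxx.
  by rewrite (ld_YM LD) -(coarse_degop weight ge) -mulmxA (degopl (coarse_grading ge weight)) scalemxAr.
rewrite (gr_suml ge (bar P)) (gr_suml ge (YM - P)); apply: eq_bigr => t _.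
rewrite mulmxBr eP eYM -scalerBl -rmorphB /=.
have -> : weight t - t.1 = (swap t).1 by rewrite /weight /swap /=; ring.
have -> : e t = bar (e (swap t)) by rewrite (ld_bar LD); case: (t).
by rewrite -barM eP barZ rmorph_int.
Qed.

Section WeylElement.
Variable winv : 'M[C]_n.
Hypothesis winv_comm : forall X, X *m E = E *m X -> X *m N0 = N0 *m X -> X *m winv = winv *m X.
Hypothesis winv_H : winv *m H = - (H *m winv).

(** The Weyl element negates H, and commutes with Y and 2 P - Y_M because these
    commute with the triple. *)
Lemma winv_P : winv *m (YM - P) = (Y - P) *m winv.
Proof.
have lieE A X : lie A X = 0 -> A *m X = X *m A by move=> /eqP; rewrite subr_eq0 => /eqP->.
(* [D] commutes with the sl_2-triple. *)
pose D := 2 *: P - YM.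
have wD : D *m winv = winv *m D.
  apply: winv_comm; apply: lieE; rewrite /D lieBl lieZl.
    by rewrite (ld_PE LD) -lie_H_deg ?lie_H_E ?subrr //; exact: E_eY.
  by rewrite lie_P_low lie_YM_low scalerA mulrN1 subrr.
have wY : Y *m winv = winv *m Y.
  by apply: winv_comm; apply: lieE; apply: comm_degop; [exact: E_eY|exact: N0_eY].
have -> : YM - P = 2^-1 *: (Y + H - D).
  by rewrite /D /H; apply/matrixP => i j; rewrite !(mxDE, mxNE, mxZE); field.
have -> : Y - P = 2^-1 *: (Y - H - D).
  by rewrite /D /H; apply/matrixP => i j; rewrite !(mxDE, mxNE, mxZE); field.
rewrite -scalemxAl -scalemxAr; congr (_ *: _).
move: (H) winv_H (D) wD => H' wH D' wD'.
by rewrite !(mulmxDr, mulmxDl, mulmxN, mulNmx) wY wH wD'.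
Qed.

(** Complex conjugation turns P into Y_M - P and fixes Y; by [winv_P] the Weyl element
    intertwines Y - P, which is q on J^(p,q), with this conjugate. *)
Lemma winv_J p q : Jpiece (q, p) *m winv = winv *m bar (Jpiece (p, q)).
Proof.
have gJb := bar_grading gJ.
have off a b : b != swap a -> Jpiece a *m winv *m bar (Jpiece b) = 0.
  have Jl t : P *m Jpiece t = t.1%:~R *: Jpiece t.
    by rewrite P_degop /Jpiece mulmxA (degopr gP) scalemxAl.
  have Jl' t : Y *m Jpiece t = (t.1 + t.2)%:~R *: Jpiece t.
    by rewrite /Jpiece -[coarse _ _ _ _]/(rho t.1) rho_eY mulmxA (degopr gY) scalemxAl.
  have bY : bar Y = Y.
    by rewrite /Y bar_degop /degop; apply: eq_bigr => t _; rewrite (ld_eYbar LD).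
  have wY : Y *m winv = winv *m Y.
    apply: winv_comm; apply/eqP; rewrite eq_sym -subr_eq0 -[_ - _]/(lie Y _) comm_degop //.
      exact: E_eY.
    exact: N0_eY.
  move=> ab; have [h1|h1] := eqVneq a.2 b.1; last first.
    apply: (@eigen_block _ _ _ _ _ (Y - P) (bar P) a.2%:~R b.1%:~R).
    - by rewrite mulmxBr J_P J_Y -scalerBl -rmorphB /= addrC addKr.
    - by rewrite -barM Jl barZ rmorph_int.
    - by rewrite bar_P winv_P.
    - by rewrite eqr_int.
  apply: (@eigen_block _ _ _ _ _ Y (bar Y) (a.1 + a.2)%:~R (b.1 + b.2)%:~R).
  - exact: J_Y.
  - by rewrite -barM Jl' barZ rmorph_int.
  - by rewrite bY.
  rewrite eqr_int; apply: contra ab; move: a b h1 => [x y] [x' y'] /= ->.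
  by rewrite /swap xpair_eqE /= eqxx addrC (inj_eq (addrI _)) eq_sym.
have swap_inj : injective swap by move=> [a b] [a' b'] [-> ->].
exact: (intertwine_blocks gJ gJb swap_inj off (q, p)).
Qed.

End WeylElement.

End CayleyBigrading.

(** * The bigrading along an imaginary orbit *)
Section TransportBigrading.
Variables (R : realType) (n : nat).
Local Notation C := R[i].

Lemma eqmx_conj_unit (A : 'M[C]_n) m (X : 'M[C]_(n, m)) : A \in unitmx -> (A *m X :=: X)%MS.
Proof. by move=> AU; apply: eqmxMfull; rewrite row_full_unit. Qed.

(** If [winv] exchanges the pieces J^(q,p) with the conjugates of the J^(p,q), then
    the conjugate of the bigrading J G differs from the swapped one by winv (bar G)
    G^-1 = 1 + lam, and a strictly lowering [lam] is absorbed by the congruence. *)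
Lemma bigraded_conj (F : int -> 'M[C]_n) (W : int -> 'M[R]_n) (s : seq (int * int))
    (J : int * int -> 'M[C]_n) (G winv lam : 'M[C]_n) :
  grading s J -> G \in unitmx -> winv \in unitmx ->
  (forall p, (F p :=: proj s J (Hpart p) *m G)%MS) ->
  (forall j, (cxf W j :=: proj s J (Wpart j) *m G)%MS) ->
  (forall p q, J (q, p) *m winv = winv *m bar (J (p, q))) ->
  winv *m bar G = (1%:M + lam) *m G ->
  (forall t u, ~~ below t.1 t.2 u -> J t *m lam *m J u = 0) ->
  bigraded F W s (fun t => invmx G *m J t *m G).
Proof.
move=> gJ GU wU hF hW hw hG strict.
have GVU : invmx G \in unitmx by rewrite unitmx_inv.
have pr P : (proj s (fun t => invmx G *m J t *m G) P :=: proj s J P *m G)%MS.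
  by rewrite conj_proj -mulmxA; exact: eqmx_conj_unit.
split.
- exact: conj_grading.
- move=> p; apply/eqmxP; apply: eqmx_trans (hF p) (eqmx_sym (pr _)).
- move=> j; apply/eqmxP; apply: eqmx_trans (hW j) (eqmx_sym (pr _)).
move=> p q.
have A1 : (bar (invmx G *m J (p, q) *m G) :=: (J (q, p) + J (q, p) *m lam) *m G)%MS.
  have bU : bar (invmx G) \in unitmx by rewrite /bar map_unitmx.
  have -> : bar (invmx G *m J (p, q) *m G) = bar (invmx G) *m (bar (J (p, q)) *m bar G).
    by rewrite !barM mulmxA.
  apply: eqmx_trans (eqmx_conj_unit _ bU) _.
  apply: eqmx_trans (eqmx_sym (eqmx_conj_unit _ wU)) _.
  by rewrite mulmxA -hw -mulmxA hG mulmxA mulmxDr mulmx1.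
have A2 : (invmx G *m J (q, p) *m G :=: J (q, p) *m G)%MS.
  by rewrite -mulmxA; exact: eqmx_conj_unit.
have A3 : (J (q, p) *m lam *m G <= proj s J (below q p) *m G)%MS.
  apply: submxMr; apply/(sub_projP gJ) => u nu; exact: (strict (q, p)).
apply/eqmxP; apply: eqmx_trans (adds_eqmx A1 (pr _)) _.
apply: eqmx_sym; apply: eqmx_trans (adds_eqmx A2 (pr _)) _; apply/eqmxP.
rewrite mulmxDl !addsmx_sub !addsmxSr !andbT; apply/andP; split; last first.
  by rewrite addmx_sub // ?addsmxSl // (submx_trans A3) ?addsmxSr.
rewrite -[X in (X <= _)%MS](addrK (J (q, p) *m lam *m G)); apply: addmx_sub.
  exact: addsmxSl.
by rewrite eqmx_opp (submx_trans A3) ?addsmxSr.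
Qed.

End TransportBigrading.

Section CayleyTheorem.
Variables (R : realType) (n : nat).
Local Notation C := R[i].

Lemma ratio_algebra (a a' b d f f' : 'M[C]_n) : a *m a' = 1%:M -> a' *m a = 1%:M ->
  d *m f = f' ->
  (a *m b *m a) *m (a' *m f') = (1%:M + a *m (b *m 1%:M *m d - 1%:M) *m a') *m (a *m f).
Proof.
move=> aa aa' df.
rewrite -!mulmxA (mulmxA a a') aa mul1mx mulmxDl mul1mx -!mulmxA (mulmxA a' a) aa' !mul1mx.
by rewrite mulmxBl mulmxBr -!mulmxA mul1mx df addrC subrK.
Qed.

Variables (W : int -> 'M[R]_n) (N : 'M[R]_n) (F : int -> 'M[C]_n) (YM : 'M[C]_n)
    (s : seq (int * int)) (e : int * int -> 'M[C]_n)
    (sY : seq int) (eY : int -> 'M[C]_n) (E : 'M[C]_n) (k : nat).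
Hypothesis LD : limit_data W N F YM s e sY eY E.
Hypothesis WN : preserves W N.
Hypothesis Nnil : cx N ^+ n = 0.
Hypothesis Ndec : cx N = \sum_(j < k.+1) low sY eY j%:Z (cx N).

Let N0 := low sY eY 0 (cx N).

Section Scalars.
Variables (ic c t2 : C).
Hypotheses (ct2 : c * t2 = -1) (t2E : t2 = ic + ic).
Hypotheses (bic : Num.conj ic = - ic) (bc : Num.conj c = - c).

Let G := expmx (c *: E) *m expmx (ic *: cx N).
Let winv := expmx (c *: E) *m expmx (t2 *: N0) *m expmx (c *: E).

Let cE_nil : (c *: E) ^+ n = 0 := scaled_nilp c (E_nil LD).
Let ncE_nil : (- (c *: E)) ^+ n = 0.
Proof. by have := scaled_nilp (- c) (E_nil LD); rewrite scaleNr. Qed.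
Let tN_nil : (t2 *: N0) ^+ n = 0 := scaled_nilp t2 (N0_nil LD).
Let icN_nil : (ic *: cx N) ^+ n = 0 := scaled_nilp ic Nnil.

Lemma G_unit : G \in unitmx.
Proof. by have := unitmx_mul3 (unitmx1 C n) (expmx_unit cE_nil) (expmx_unit icN_nil); rewrite mul1mx. Qed.

Lemma winv_unit : winv \in unitmx.
Proof. exact: unitmx_mul3 (expmx_unit cE_nil) (expmx_unit tN_nil) (expmx_unit cE_nil). Qed.

Lemma winv_comm X : X *m E = E *m X -> X *m N0 = N0 *m X -> X *m winv = winv *m X.
Proof.
move=> hE hN; have h1 : expmx (c *: E) *m X = X *m expmx (c *: E).
  by apply/esym; apply: expmx_comm; rewrite -scalemxAl -scalemxAr hE.
have h2 : expmx (t2 *: N0) *m X = X *m expmx (t2 *: N0).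
  by apply/esym; apply: expmx_comm; rewrite -scalemxAl -scalemxAr hN.
by apply/esym; exact: commM (commM h1 h2) h1.
Qed.

Lemma winv_weyl : winv *m (YM - degop sY eY) = - ((YM - degop sY eY) *m winv).
Proof. exact: (weyl_H (lie_E_N0 LD) (lie_H_E LD) (lie_H_N0 LD) (E_nil LD) (N0_nil LD) ct2). Qed.

Lemma bar_G : bar G = expmx (- (c *: E)) *m expmx (- (ic *: cx N)).
Proof.
have h1 : bar (c *: E) = - (c *: E) by rewrite barZ bc (ld_Ebar LD) scaleNr.
have h2 : bar (ic *: cx N) = - (ic *: cx N) by rewrite barZ bic bar_cx scaleNr.
by rewrite -h1 -h2 -(bar_expmx (c *: E)) -(bar_expmx (ic *: cx N)) -barM.
Qed.

(** As bar G = e^(-cE) e^(-ic N), the product winv (bar G) G^-1 equals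
    e^(cE) (e^(t2 N_0) e^(-t2 N)) e^(-cE); the middle factor is 1 modulo [lower_part]
    because N - N_0 lies there, and conjugation by e^(cE) preserves [lower_part]. *)
Lemma cayley_ratio : exists lam, lower_part N sY eY lam /\ winv *m bar G = (1%:M + lam) *m G.
Proof.
have ntN : (- (t2 *: cx N)) ^+ n = 0.
  by have := scaled_nilp (- t2) Nnil; rewrite scaleNr.
pose mu := expmx (t2 *: N0) *m 1%:M *m expmx (- (t2 *: cx N)) - 1%:M.
have hmu : lower_part N sY eY mu.
  have nu := N_minus_N0 Ndec.
  apply: (exp_conj_ind tN_nil ntN).
  - exact: Lower0.
  - exact: LowerD.
  - exact: LowerZ.
  - rewrite mulmx1 mul1mx -scalerBr -[_ - cx N]opprB scalerN -scaleNr; exact: LowerZ.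
  move=> Z hZ; have -> : t2 *: N0 *m Z + Z *m - (t2 *: cx N) =
      - t2 *: (lie N0 Z + Z *m (cx N - N0)).
    rewrite /lie mulmxBr [X in _ = _ *: X]addrC addrA subrK mulmxN -scalemxAl -scalemxAr.
    by rewrite scalerBr !scaleNr opprK addrC.
  by apply: LowerZ; apply: LowerD; [exact: lower_lie_N0|exact: LowerM].
exists (expmx (c *: E) *m mu *m expmx (- (c *: E))); split.
  rewrite -[X in lower_part _ _ _ X](subrK mu); apply: LowerD => //.
  apply: (exp_conj_ind cE_nil ncE_nil).
  - exact: Lower0.
  - exact: LowerD.
  - exact: LowerZ.
  - have -> : c *: E *m mu + mu *m - (c *: E) = - c *: lie E mu.
      by rewrite /lie mulmxN -scalemxAl -scalemxAr scaleNr scalerBr opprB.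
    by apply: LowerZ; exact: (lower_lie_E LD).
  move=> Z hZ; have -> : c *: E *m Z + Z *m - (c *: E) = - c *: lie E Z.
    by rewrite /lie mulmxN -scalemxAl -scalemxAr scaleNr scalerBr opprB.
  by apply: LowerZ; exact: (lower_lie_E LD).
rewrite bar_G; apply: ratio_algebra.
- exact: (expmxN cE_nil).
- exact: mulmx1C (expmxN cE_nil).
(* Since [t2 = 2 ic], e^(- t2 N) e^(ic N) is the conjugate of e^(ic N). *)
have tic : - (t2 *: cx N) + ic *: cx N = - (ic *: cx N) by rewrite t2E scalerDl opprD addrNK.
have nic : (- (t2 *: cx N) + ic *: cx N) ^+ n = 0.
  by rewrite tic; have := scaled_nilp (- ic) Nnil; rewrite scaleNr.
have comm : (- (t2 *: cx N)) *m (ic *: cx N) = (ic *: cx N) *m (- (t2 *: cx N)).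
  by rewrite mulNmx mulmxN -!scalemxAl -!scalemxAr !scalerA mulrC.
by rewrite (expmxD comm ntN icN_nil nic) tic.
Qed.

(** The scalars are ic = z purely imaginary, t2 = 2 z and c = -1 / (2 z).  As E has
    degree 1 for P, the factor e^(cE) preserves F. *)
Lemma cayley_bigraded : bigraded (fun p => F p *m expmx (ic *: cx N)) W (Jindex s sY)
  (fun t => invmx G *m Jpiece s e eY t *m G).
Proof.
have [lam [hlam hG]] := cayley_ratio; have gJ := J_grading LD.
have FJ p : (F p :=: proj (Jindex s sY) (Jpiece s e eY) (Hpart p))%MS.
  apply/eqmxP/andP; split.
    by apply/(sub_projP gJ); apply/(sub_F_J LD p).
  apply/(sub_F_J LD p) => t nt; rewrite (gr_projr gJ) (negbTE nt) //.
have WJ j : (cxf W j :=: proj (Jindex s sY) (Jpiece s e eY) (Wpart j))%MS.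
  apply/eqmxP/andP; split.
    by apply/(sub_projP gJ); apply/(sub_W_J LD j).
  apply/(sub_W_J LD j) => t nt; rewrite (gr_projr gJ) (negbTE nt) //.
apply: (bigraded_conj gJ G_unit winv_unit _ _ _ hG).
- move=> p.
  have FE : (F p *m (c *: E) <= F p)%MS.
    apply/(sub_F_J LD p) => t nt; rewrite -scalemxAr -scalemxAl.
    have /(sub_F_J LD p) h : (F p <= F p)%MS by [].
    rewrite (gr_sumr gJ (F p)) 2!mulmx_suml big1 ?scaler0 // => u _.
    have [up|up] := boolP (Hpart p u); last by rewrite h // !mul0mx.
    rewrite (gr_split gJ) (_ : _ *m E *m _ = 0) ?mulmx0 //.
    apply: (low_block_J LD (d := 1) (d' := 0)).
    - by rewrite (ld_PE LD) scale1r.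
    - by rewrite scale0r; apply: comm_degop; exact: (E_eY LD).
    left; rewrite -[1]/(1%:~R) eqr_int; apply: contra nt; rewrite /Hpart.
    by move: u t up => [a b] [a' b']; rewrite /Hpart /= => *; lia.
  have h := eqmx_unit_stable (expmx_unit cE_nil) (expmx_stable FE).
  apply: eqmx_trans (eqmxMr _ (eqmx_sym h)) _; rewrite -mulmxA.
  exact: eqmxMr.
- move=> j; have W1 : (cxf W j *m (c *: E) <= cxf W j)%MS.
    rewrite -scalemxAr scalemx_sub //; case: (ld_del LD) => gY WY _ hE _.
    exact: (deg_preserves gY WY hE).
  have W2 : (cxf W j *m (ic *: cx N) <= cxf W j)%MS.
    by rewrite -scalemxAr scalemx_sub //; exact: cx_preserves.
  have h1 := eqmx_unit_stable (expmx_unit cE_nil) (expmx_stable W1).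
  have h2 := eqmx_unit_stable (expmx_unit icN_nil) (expmx_stable W2).
  apply: eqmx_sym; apply: eqmx_trans (eqmxMr _ (eqmx_sym (WJ j))) _.
  have -> : cxf W j *m G = cxf W j *m expmx (c *: E) *m expmx (ic *: cx N) by exact: mulmxA.
  exact: eqmx_trans (eqmxMr _ h1) h2.
- exact: (winv_J LD winv_comm winv_weyl).
- move=> t u; exact: (lower_strict LD hlam).
Qed.

End Scalars.
End CayleyTheorem.

(** * Rescaling of the polarizations *)
Local Notation form := Pilot.Defs.form.

Section Forms.
Variables (R : realType) (n : nat).
Local Notation C := R[i].

Lemma form_rows (K : fieldType) m p (A : 'M[K]_(m, n)) (B : 'M[K]_(p, n)) (Z : 'M[K]_n) i j :
  (A *m Z *m B^T) i j = form Z (row i A) (row j B).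
Proof.
by rewrite /form tr_row [col _ _]colE !mulmxA -colE -!row_mul [RHS]mxE [RHS]mxE.
Qed.

Definition vanishes (K : fieldType) (U V Z : 'M[K]_n) : Prop :=
  forall (u v : 'rV[K]_n), (u <= U)%MS -> (v <= V)%MS -> form Z u v = 0.

Lemma vanishesP (K : fieldType) (U V Z : 'M[K]_n) : vanishes U V Z <-> U *m Z *m V^T = 0.
Proof.
split=> [h|h u v /submxP[a ->] /submxP[b ->]].
  by apply/matrixP => i j; rewrite form_rows h ?row_sub // mxE.
by rewrite /form trmx_mul !mulmxA -(mulmxA a) -(mulmxA a) h mulmx0 mul0mx mxE.
Qed.

Lemma vanishes_cx (U V Z : 'M[R]_n) : vanishes U V Z -> vanishes (cx U) (cx V) (cx Z).
Proof.
move/vanishesP => h; apply/vanishesP; move: (congr1 (@cx R n n) h).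
by rewrite !cxM /cx map_trmx map_mx0.
Qed.

Lemma vanishes_mx (K : fieldType) (U V Z : 'M[K]_n) m p (A : 'M[K]_(m, n)) (B : 'M[K]_(p, n)) :
  vanishes U V Z -> (A <= U)%MS -> (B <= V)%MS -> A *m Z *m B^T = 0.
Proof.
move=> h AU BV; apply/matrixP => i j; rewrite form_rows mxE; apply: h.
  exact: submx_trans (row_sub _ _) AU.
exact: submx_trans (row_sub _ _) BV.
Qed.

Lemma trmxX (K : fieldType) (A : 'M[K]_n) j : (A ^+ j)^T = A^T ^+ j.
Proof.
elim: j => [|j IH]; first by rewrite !expr0 -!idmxE trmx1.
by rewrite exprS exprSr -!mulmxE trmx_mul IH.
Qed.

Lemma expmx_tr (K : numFieldType) (A : 'M[K]_n) : (expmx A)^T = expmx A^T.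
Proof.
rewrite /expmx raddf_sum; apply: eq_bigr => i _ /=; rewrite linearZ /=; congr (_ *: _).
exact: trmxX.
Qed.

Lemma exp_isometry (K : numFieldType) (U X Q : 'M[K]_n) :
  X ^+ n = 0 -> (U *m X <= U)%MS -> vanishes U U (X *m Q + Q *m X^T) ->
  vanishes U U (expmx X *m Q *m (expmx X)^T - Q).
Proof.
move=> Xn UX h; rewrite expmx_tr.
have XTn : X^T ^+ n = 0.
  by rewrite -trmxX Xn trmx0.
apply: (exp_conj_ind (P := vanishes U U) Xn XTn) => //.
- by move=> u v _ _; rewrite /form mulmx0 mul0mx mxE.
- by move=> Y Z hY hZ u v uU vU; rewrite /form mulmxDr mulmxDl mxE -!/(form _ _ _) hY // hZ // addr0.
- by move=> a Y hY u v uU vU; rewrite /form -scalemxAr -scalemxAl mxE -/(form _ _ _) hY // mulr0.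
move=> Z hZ u v uU vU; rewrite /form mulmxDr mulmxDl mxE.
have stab (w : 'rV[K]_n) : (w <= U)%MS -> (w *m X <= U)%MS.
  by move=> wU; apply: submx_trans UX; exact: submxMr.
rewrite !mulmxA -(mulmxA _ X^T) -trmx_mul.
have := hZ (u *m X) v (stab u uU) vU; rewrite /form => ->; rewrite add0r.
exact: (hZ u (v *m X) uU (stab v vU)).
Qed.

End Forms.

Section FormSl2.
Variables (K : numFieldType) (n : nat).
Implicit Types (E F H X Z : 'M[K]_n).

(** [sl2_inj] for the action X |-> A X + X A^T on forms, for which [lie] makes
    (E, F, -H) the triple. *)
Lemma form_sl2_inj E F H Z (d : K) : lie E F = H -> lie H E = 2 *: E -> E ^+ n = 0 ->
  F *m Z + Z *m F^T = 0 -> H *m Z + Z *m H^T = - d *: Z -> 0 < d -> Z = 0.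
Proof.
move=> EF HE En FZ HZ d0.
have ETn : E^T ^+ n = 0 by rewrite -trmxX En trmx0.
apply: (@sl2_inj _ _ (fun X => E *m X + X *m E^T) (fun X => F *m X + X *m F^T)
   (fun X => - (H *m X + X *m H^T)) d) => //.
- by move=> a X; rewrite -scalemxAr -scalemxAl scalerDr.
- by rewrite mulmx0 mul0mx addr0.
- by move=> X; rewrite -EF /lie raddfB /= !trmx_mul; mxlin.
- move=> X; have -> : 2 *: (E *m X + X *m E^T) = lie H E *m X + X *m (lie H E)^T.
    by rewrite HE linearZ /= -scalemxAl -scalemxAr scalerDr.
  by rewrite /lie raddfB /= !trmx_mul; mxlin.
- by rewrite HZ scaleNr opprK.
- by rewrite FZ mulmx0 mul0mx addr0.
- by exists (n + n)%N; exact: iter_two_sided_nil.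
Qed.

Lemma shift_comm s (e : int -> 'M[K]_n) X (d a : int) : grading s e ->
  lie (degop s e) X = d%:~R *: X -> e a *m X = X *m e (a + d).
Proof.
move=> ge hX; transitivity (e a *m X *m e (a + d)).
  rewrite {1}(gr_sumr ge (e a *m X)); apply: (gr_sum_pick ge) => [u ua|].
    exact: (lie_degop_off ge hX).
  by move/(gr_out ge)->; rewrite mulmx0.
rewrite [RHS](gr_suml ge) -mulmxA; apply/esym.
rewrite (gr_sum_pick ge (t := a)) // => [u ua|/(gr_out ge)->]; last by rewrite !mul0mx.
rewrite mulmxA (lie_degop_off ge hX) //; apply: contra ua => /eqP h.
by apply/eqP/esym; exact: (addIr d).
Qed.

Lemma trmx_grading (T : eqType) s (e : T -> 'M[K]_n) : grading s e -> grading s (fun t => (e t)^T).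
Proof.
move=> [us e0 em e1]; split=> //.
- by move=> t /e0->; rewrite trmx0.
- by move=> t u; rewrite -trmx_mul em eq_sym; case: eqP => [->//|]; rewrite trmx0.
- by rewrite -(raddf_sum (@trmx K n n)) /= e1 trmx1.
Qed.

End FormSl2.

Lemma bilinear_sum (K : fieldType) n m (r : seq int) (U V : int -> 'M[K]_(m, n)) (Z : 'M[K]_n) :
  (\sum_(l <- r) U l) *m Z *m (\sum_(l <- r) V l)^T =
  \sum_(l <- r) \sum_(l' <- r) U l *m Z *m (V l')^T.
Proof.
rewrite 2!mulmx_suml; apply: eq_bigr => l _.
by rewrite (raddf_sum (@trmx K m n)) mulmx_sumr.
Qed.

Section Isometry.
Variables (R : realType) (n : nat).
Local Notation C := R[i].
Variables (W : int -> 'M[R]_n) (Q : int -> 'M[R]_n) (N : 'M[R]_n) (F : int -> 'M[C]_n) (YM : 'M[C]_n)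
    (s : seq (int * int)) (e : int * int -> 'M[C]_n)
    (sY : seq int) (eY : int -> 'M[C]_n) (E : 'M[C]_n).
Hypothesis LD : limit_data W N F YM s e sY eY E.
Hypothesis hW : increasing_filtration W.
Hypothesis hQ : graded_forms W Q.
Hypothesis hN : infinitesimal_isometry W Q N.
Hypothesis isoF : forall j p, vanishes (F p :&: cxf W j)%MS (F (j + 1 - p)%R :&: cxf W j)%MS (cxf Q j).

Let ge := ld_gr LD.
Let gY : grading sY eY. Proof. by case: (ld_del LD). Qed.
Let WY j : (cxf W j == proj sY eY (upto j))%MS. Proof. by case: (ld_del LD). Qed.
Let sM := undup (map weight s).
Let eM := coarse s e weight.
Let gM : grading sM eM := coarse_grading ge weight.
Let YMd : YM = degop sM eM. Proof. by rewrite (ld_YM LD) -(coarse_degop weight ge). Qed.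

Lemma eM_eY l t : eM l *m eY t = eY t *m eM l.
Proof. by rewrite (YM_comm (ld_del LD) gM YMd). Qed.

Lemma radical_l j : vanishes (cxf W (j - 1)) (cxf W j) (cxf Q j).
Proof.
apply: vanishes_cx => u v uW vW; have [_ h] := hQ.
have uW' : (u <= W j)%MS by apply: submx_trans uW _; case: hW => mono _ _; apply: mono; lia.
exact: ((h j u uW').1 uW).
Qed.

Lemma radical_r j : vanishes (cxf W j) (cxf W (j - 1)) (cxf Q j).
Proof.
apply: vanishes_cx => u v uW vW; have [sym h] := hQ.
have vW' : (v <= W j)%MS by apply: submx_trans vW _; case: hW => mono _ _; apply: mono; lia.
by rewrite sym // (((h j v vW').1 vW) u uW) mulr0.
Qed.

Lemma N_isometry j : vanishes (cxf W j) (cxf W j) (cx N *m cxf Q j + cxf Q j *m (cx N)^T).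
Proof.
have -> : cx N *m cxf Q j + cxf Q j *m (cx N)^T = cx (N *m Q j + Q j *m N^T).
  by rewrite /cxf -!/(cx _) {2}/cx map_trmx -/(cx N^T) -!cxM /cx map_mxD.
apply: vanishes_cx => u v uW vW; have [_ h] := hN; rewrite -[RHS](h j u v uW vW).
by rewrite /form mulmxDr mulmxDl mxE trmx_mul !mulmxA.
Qed.

(* The form that Q_j induces on the j-eigenspace of Y, isomorphic to Gr^W_j. *)
Let B j : 'M[C]_n := eY j *m cxf Q j *m (eY j)^T.

Lemma eY_W j : (eY j <= cxf W j)%MS.
Proof.
have /andP[_ h] := WY j; apply: submx_trans h; exact: (gr_sub_proj gY (upto_refl j)).
Qed.

Lemma eY_rest j m (U : 'M[C]_(m, n)) : (U <= cxf W j)%MS -> (U - U *m eY j <= cxf W (j - 1))%MS.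
Proof.
move=> UW; have /andP[h1 _] := WY j; have /andP[_ h2] := WY (j - 1).
apply: submx_trans h2; apply/(sub_projP gY) => t; rewrite /upto => tj.
rewrite mulmxBl -mulmxA (gr_mul gY); case: eqP => [->|jt]; first by rewrite subrr.
rewrite mulmx0 subr0; apply: (proj_idE gY (submx_trans UW h1)); rewrite /upto; lia.
Qed.

Lemma form_gr j m p (U : 'M[C]_(m, n)) (V : 'M[C]_(p, n)) :
  (U <= cxf W j)%MS -> (V <= cxf W j)%MS -> U *m cxf Q j *m V^T = U *m B j *m V^T.
Proof.
move=> UW VW.
have Ue : (U *m eY j <= cxf W j)%MS by apply: submx_trans (eY_W j); exact: submxMl.
have h1 := vanishes_mx (@radical_l j) (eY_rest UW) VW.
have h2 := vanishes_mx (@radical_r j) Ue (eY_rest VW).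
move: h1; rewrite !mulmxBl => /eqP; rewrite subr_eq0 => /eqP ->.
move: h2; rewrite raddfB /= mulmxBr => /eqP; rewrite subr_eq0 => /eqP ->.
by rewrite trmx_mul /B !mulmxA.
Qed.

(** N is an infinitesimal isometry, and N_0 is the operator it induces on Gr^W. *)
Lemma B_N0 j : let N0 := low sY eY 0 (cx N) in N0 *m B j + B j *m N0^T = 0.
Proof.
move=> N0; have N0e : N0 *m eY j = eY j *m N0 by exact: low0_comm.
have N0E : eY j *m N0 = eY j *m cx N *m eY j.
  by rewrite -(gr_idem gY j) -(mulmxA (eY j)) -N0e mulmxA (low_block gY) subr0 eqxx (gr_idem gY).
have NW : (eY j *m cx N <= cxf W j)%MS.
  have WN : preserves W N by case: hN.
  by apply: submx_trans (cx_preserves WN j); apply: submxMr; exact: eY_W.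
have h1 : eY j *m N0 *m cxf Q j *m (eY j)^T = eY j *m cx N *m cxf Q j *m (eY j)^T.
  have := vanishes_mx (@radical_l j) (eY_rest NW) (eY_W j).
  by rewrite !mulmxBl N0E => /eqP; rewrite subr_eq0 => /eqP ->.
have h2 : eY j *m cxf Q j *m (eY j *m N0)^T = eY j *m cxf Q j *m (eY j *m cx N)^T.
  have := vanishes_mx (@radical_r j) (eY_W j) (eY_rest NW).
  by rewrite raddfB /= mulmxBr N0E => /eqP; rewrite subr_eq0 => /eqP ->.
have -> : N0 *m B j = eY j *m N0 *m cxf Q j *m (eY j)^T by rewrite /B !mulmxA N0e.
have -> : B j *m N0^T = eY j *m cxf Q j *m (eY j *m N0)^T.
  by rewrite /B -N0e [in RHS]trmx_mul !mulmxA.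
rewrite h1 h2 trmx_mul -(vanishes_mx (@N_isometry j) (eY_W j) (eY_W j)).
by rewrite mulmxDr mulmxDl !mulmxA.
Qed.

(** For t = l + m, the part Bt of the form of weight t for Y_M is annihilated by the
    lowering operator N_0 of the triple (E, N_0, -H) acting on forms, and has weight
    2j - t > 0; a finite-dimensional module has no such vector. *)
Lemma form_low j l m : l + m < 2 * j -> eM l *m B j *m (eM m)^T = 0.
Proof.
move=> lm; set N0 := low sY eY 0 (cx N).
have N0M a : eM a *m N0 = N0 *m eM (a - 2).
  by apply: (shift_comm _ gM); rewrite -YMd (lie_YM_low LD) rmorphN.
have gMT := trmx_grading gM.
have bN0 := B_N0 j; rewrite -/N0 /= in bN0.
have YB : degop sY eY *m B j = j%:~R *: B j.
  by rewrite /B !mulmxA (degopr gY) -!scalemxAl.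
have BY : B j *m (degop sY eY)^T = j%:~R *: B j.
  by rewrite /B -mulmxA -trmx_mul (degopr gY) linearZ /= -scalemxAr.
have YeM a : degop sY eY *m eM a = eM a *m degop sY eY.
  rewrite /degop [LHS]mulmx_suml [RHS]mulmx_sumr; apply: eq_bigr => i _.
  by rewrite -scalemxAl -scalemxAr eM_eY.
move: (B j) bN0 YB BY => Bj bN0 YB BY.
pose t := l + m; pose Bt := \sum_(a <- sM) eM a *m Bj *m (eM (t - a))^T.
have blk a b : eM a *m Bt *m (eM b)^T = if b == t - a then eM a *m Bj *m (eM b)^T else 0.
  rewrite /Bt mulmx_sumr (gr_sum_pick gM (t := a)) => [|u ua|/(gr_out gM)->].
  - rewrite !mulmxA (gr_idem gM) -mulmxA -trmx_mul (gr_mul gM).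
    by case: (b == t - a) => //; rewrite trmx0 mulmx0.
  - by rewrite !mulmxA (gr_orth gM) 1?eq_sym // !mul0mx.
  - by rewrite !mul0mx.
suff Bt0 : Bt = 0.
  have := blk l m; rewrite Bt0 mulmx0 mul0mx /t addrC addKr eqxx => <-; by [].
apply: (form_sl2_inj (d := (2 * j - t)%:~R) (lie_E_N0 LD) (lie_H_E LD) (E_nil LD)).
- apply: (mx_eq_blocks2 gM gMT) => a b; rewrite mulmx0 mul0mx mulmxDr mulmxDl.
  rewrite -/N0 (mulmxA (eM a)) N0M -(mulmxA N0) -(mulmxA N0) blk.
  rewrite (mulmxA (eM a)) -(mulmxA _ N0^T) -trmx_mul N0M trmx_mul mulmxA blk.
  have -> : (b == t - (a - 2)) = (b - 2 == t - a) by apply/eqP/eqP => h; lia.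
  case: eqP => _; last by rewrite mulmx0 mul0mx addr0.
  rewrite !mulmxA -N0M -(mulmxA _ _ N0^T) -trmx_mul -N0M trmx_mul mulmxA.
  rewrite -(mulmxA (eM a) N0) -(mulmxA (eM a) Bj) -mulmxDl -mulmxDr bN0.
  by rewrite mulmx0 mul0mx.
- have YBt : degop sY eY *m Bt = j%:~R *: Bt.
    rewrite /Bt mulmx_sumr scaler_sumr; apply: eq_bigr => a _.
    by rewrite !mulmxA YeM -(mulmxA (eM a) (degop _ _) Bj) YB -scalemxAr -scalemxAl.
  have BtY : Bt *m (degop sY eY)^T = j%:~R *: Bt.
    rewrite /Bt mulmx_suml scaler_sumr; apply: eq_bigr => a _.
    by rewrite -mulmxA -trmx_mul YeM trmx_mul mulmxA -(mulmxA (eM a) Bj) BY -scalemxAr -scalemxAl.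
  have YMt : YM *m Bt + Bt *m YM^T = t%:~R *: Bt.
    apply: (mx_eq_blocks2 gM gMT) => a b; rewrite mulmxDr mulmxDl.
    have h1 i : eM i *m YM = i%:~R *: eM i by rewrite YMd (degopl gM).
    have -> : eM a *m (YM *m Bt) *m (eM b)^T = a%:~R *: (eM a *m Bt *m (eM b)^T).
      by rewrite (mulmxA (eM a)) h1 -!scalemxAl.
    have -> : eM a *m (Bt *m YM^T) *m (eM b)^T = b%:~R *: (eM a *m Bt *m (eM b)^T).
      by rewrite (mulmxA (eM a)) -(mulmxA _ YM^T) -trmx_mul h1 linearZ /= -scalemxAr.
    rewrite -scalemxAr -scalemxAl blk -scalerDl.
    by case: eqP => [->|_]; rewrite ?scaler0 // -rmorphD /= addrC subrK.
  rewrite mulmxBl raddfB /= mulmxBr YBt BtY addrACA YMt -opprD -scalerDl -scalerBl.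
  by congr (_ *: _); rewrite -rmorphD -rmorphB -rmorphN; congr (_%:~R); ring.
- by rewrite ltr0z; move: lm; rewrite /t; lia.
Qed.

(** One of p + p' and q + q' exceeds j, and F and its conjugate are isotropic. *)
Lemma form_high j l m : 2 * j < l + m ->
  cxf W j *m eM l *m cxf Q j *m (cxf W j *m eM m)^T = 0.
Proof.
move=> lm.
have isoP t u : j < t.1 + u.1 -> cxf W j *m e t *m cxf Q j *m (cxf W j *m e u)^T = 0.
  move=> tu; apply: (vanishes_mx (@isoF j t.1)); rewrite sub_capmx (ld_W LD) andbT.
    apply/(ld_F LD) => v; rewrite /Hpart -mulmxA (gr_mul ge); case: eqP => [->|_ _]; last by rewrite mulmx0.
    by rewrite lexx.
  apply/(ld_F LD) => v; rewrite /Hpart -mulmxA (gr_mul ge); case: eqP => [<-|_ _]; last by rewrite mulmx0.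
  by move: t u tu => [a b] [a' b'] /= *; lia.
have isoQ t u : j < t.2 + u.2 -> cxf W j *m e t *m cxf Q j *m (cxf W j *m e u)^T = 0.
  move=> tu; apply: (can_inj (@barK R n n)); rewrite bar0 !barM.
  have barT (X : 'M[C]_n) : bar X^T = (bar X)^T by rewrite /bar map_trmx.
  by rewrite barT barM !(ld_bar LD) !bar_cx; apply: isoP.
rewrite /eM /coarse /proj !mulmx_sumr 2!mulmx_suml big1 // => t /eqP tl.
rewrite (raddf_sum (@trmx C n n)) mulmx_sumr big1 // => u /eqP um.
have [h|h] := ltP j (t.1 + u.1); first exact: isoP.
apply: isoQ; move: t u tl um h => [a b] [a' b']; rewrite /weight /= => *; lia.
Qed.

(** By [form_low] and [form_high] Q_j pairs weight l of Y_M only with weight 2j - l. *)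
Lemma scaling_isometry (x : C) j : x != 0 ->
  let A := \sum_(l <- sM) x ^ (- l) *: eM l in
  vanishes (cxf W j) (cxf W j) (A *m cxf Q j *m A^T - x ^ (- (2 * j)) *: cxf Q j).
Proof.
move=> x0 A; apply/vanishesP.
have WeM l : (cxf W j *m eM l <= cxf W j)%MS.
  by apply: (deg_preserves gY WY) => t; exact: eM_eY.
have off l m : l + m != 2 * j -> cxf W j *m eM l *m cxf Q j *m (cxf W j *m eM m)^T = 0.
  move=> lm; have [h|h] := ltP (2 * j) (l + m); first exact: form_high.
  rewrite form_gr // trmx_mul mulmxA -(mulmxA (cxf W j)) -(mulmxA (cxf W j)).
  by rewrite form_low ?mulmx0 ?mul0mx // lt_neqAle lm h.
have Wsum : cxf W j = \sum_(l <- sM) cxf W j *m eM l by exact: (gr_sumr gM).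
have Asum : cxf W j *m A = \sum_(l <- sM) x ^ (- l) *: (cxf W j *m eM l).
  by rewrite mulmx_sumr; apply: eq_bigr => l _; rewrite scalemxAr.
rewrite mulmxBr mulmxBl; apply/eqP; rewrite subr_eq0; apply/eqP.
rewrite !mulmxA -(mulmxA _ A^T) -trmx_mul Asum -scalemxAr -scalemxAl.
rewrite [in RHS]Wsum !bilinear_sum scaler_sumr; apply: eq_bigr => l _.
rewrite scaler_sumr; apply: eq_bigr => m _.
rewrite linearZ /= -scalemxAr -!scalemxAl scalerA.
have [lm|lm] := eqVneq (l + m) (2 * j); last by rewrite off // !scaler0.
congr (_ *: _); rewrite -expfzDr // -opprD addrC lm //.
Qed.

End Isometry.

(** * The mixed Hodge metric *)
Section Metric.
Variables (R : realType) (n : nat).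
Local Notation C := R[i].

(** The sum over p, q of Q_(p+q)(i^(p-q) x^(p,q), conjugate of y^(p,q)). *)
Definition gram (s : seq (int * int)) (e : int * int -> 'M[C]_n) (Q : int -> 'M[R]_n) : 'M[C]_n :=
  \sum_(t <- s) ('i : C) ^ (t.1 - t.2) *: (e t *m cxf Q (weight t) *m (bar (e t))^T).

Lemma bar_tr m p (X : 'M[C]_(m, p)) : bar X^T = (bar X)^T.
Proof. by rewrite /bar map_trmx. Qed.

Lemma form_gram s e Q (u v : 'rV[C]_n) : form (gram s e Q) u (bar v) =
  \sum_(t <- s) ('i : C) ^ (t.1 - t.2) * form (cxf Q (weight t)) (u *m e t) (bar (v *m e t)).
Proof.
rewrite /form /gram mulmx_sumr mulmx_suml summxE; apply: eq_bigr => t _.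
rewrite -scalemxAr -scalemxAl mxE barM trmx_mul !mulmxA //.
Qed.

Lemma formZl (Q : 'M[C]_n) a u v : form Q (a *: u) v = a * form Q u v.
Proof. by rewrite /form -!scalemxAl mxE. Qed.

Section OneFiltration.
Variables (F : int -> 'M[C]_n) (W Q : int -> 'M[R]_n) (s : seq (int * int)) (e : int * int -> 'M[C]_n).
Hypothesis b : bigraded F W s e.
Let ge : grading s e. Proof. by case: b. Qed.

Lemma gram_is_metric : is_mixed_hodge_metric F W Q (gram s e Q).
Proof.
move=> p q r t u v; rewrite (eqmxP (deligne_bigradingE b p q)) (eqmxP (deligne_bigradingE b r t)).
move=> hu hv; rewrite form_gram.
rewrite (gr_sum_pick ge (t := (p, q))) /=.
- rewrite (gr_idr ge hu) formZl /weight /=; case: andP => [[/eqP-> /eqP->]|ne].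
    by rewrite (gr_idr ge hv).
  rewrite (gr_orthr ge hv) ?bar0; last by apply/negP => /eqP [h1 h2]; apply: ne; rewrite h1 h2 !eqxx.
  by rewrite /form trmx0 mulmx0 mxE mulr0.
- by move=> t' tt; rewrite (gr_orthr ge hu) 1?eq_sym // /form !mul0mx mxE mulr0.
- by move/(gr_out ge)->; rewrite mulmx0 /form !mul0mx mxE mulr0.
Qed.

(** The defining conditions prescribe all blocks of the Gram matrix, and
    complementary pieces span. *)
Lemma gramE : mixed_hodge_metric F W Q = gram s e Q.
Proof.
set G := mixed_hodge_metric F W Q.
have hG : is_mixed_hodge_metric F W Q G.
  apply: (@xgetPex _ _ [set G | is_mixed_hodge_metric F W Q G]).
  by exists (gram s e Q); exact: gram_is_metric.
apply: (mx_eq_blocks2 ge (trmx_grading (bar_grading ge))) => t u.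
apply/matrixP => i j; rewrite !form_rows.
have -> : row j (bar (e u)) = bar (row j (e u)) by rewrite /bar map_row.
case: t u => [p q] [r t].
have hu : (row i (e (p, q)) <= deligne_bigrading F W p q)%MS.
  by rewrite (eqmxP (deligne_bigradingE b p q)) row_sub.
have hv : (row j (e (r, t)) <= deligne_bigrading F W r t)%MS.
  by rewrite (eqmxP (deligne_bigradingE b r t)) row_sub.
by rewrite (hG _ _ _ _ _ _ hu hv) (gram_is_metric hu hv).
Qed.

Lemma piece_hodge t : (e t <= hodge_piece F W t.1 t.2)%MS.
Proof.
case: t => p q /=; case: (b) => _ FI WI barI.
have eF : (e (p, q) <= F p)%MS.
  by have /andP[_ h] := FI p; apply: submx_trans h; apply: (gr_sub_proj ge); rewrite /Hpart /=.
have eF' : (e (q, p) <= F q)%MS.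
  by have /andP[_ h] := FI q; apply: submx_trans h; apply: (gr_sub_proj ge); rewrite /Hpart /=.
have eW : (e (p, q) <= cxf W (p + q))%MS.
  by have /andP[_ h] := WI (p + q); apply: submx_trans h; apply: (gr_sub_proj ge); rewrite /Wpart /=.
have eW' : (e (q, p) <= cxf W (p + q))%MS.
  by have /andP[_ h] := WI (p + q); apply: submx_trans h; apply: (gr_sub_proj ge); rewrite /Wpart /= addrC.
rewrite /hodge_piece sub_capmx; apply/andP; split.
  by apply: submx_trans (addsmxSl _ _); rewrite sub_capmx eF.
have /andP[_ h] := barI q p; apply: submx_trans (addsmxSl _ _) _; apply: submx_trans h _.
apply: addsmxS.
  rewrite sub_capmx bar_sub eF' /=; rewrite -[X in (_ <= X)%MS](bar_cx (W (p + q))) bar_sub.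
  exact: eW'.
have /andP[_ h1] := WI (p + q - 1); apply: submx_trans h1; apply: (sub_proj_sub ge) => u.
rewrite !unfold_in /below /Wpart; lia.
Qed.

Lemma gram_pos : polarized F W Q -> forall u : 'rV[C]_n, u != 0 -> 0 < form (gram s e Q) u (bar u).
Proof.
move=> [_ pos] u u0; rewrite form_gram.
have term t : 0 <= ('i : C) ^ (t.1 - t.2) * form (cxf Q (weight t)) (u *m e t) (bar (u *m e t))
    ?= iff (u *m e t == 0).
  have [->|ut] := eqVneq (u *m e t) 0; first by rewrite /form !mul0mx mxE mulr0; split; rewrite ?eqxx.
  have := pos t.1 t.2 (u *m e t) (submx_trans (submxMl _ _) (piece_hodge t)).
  suff nW : ~~ (u *m e t <= cxf W (t.1 + t.2 - 1))%MS.
    by move=> /(_ nW) h; split; [exact: ltW | rewrite lt_eqF].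
  apply: contra ut => h; case: (b) => _ _ WI _; have /andP[h1 _] := WI (t.1 + t.2 - 1).
  have := proj_idE ge (submx_trans h h1) (t := t); rewrite -mulmxA (gr_idem ge) => -> //.
  by case: (t) => p q; rewrite /Wpart /=; lia.
rewrite lt_neqAle sumr_ge0 ?andbT => [|t _]; last by have [] := term t.
apply: contra u0 => /eqP/esym h; rewrite (gr_sumr ge u) big_seq big1 // => t ts.
move: h; rewrite (bigD1_seq t) ?(gr_uniq ge) //= => /eqP.
have ge0 t' := (term t').1.
rewrite paddr_eq0 ?ge0 ?sumr_ge0 // => /andP[/eqP h _].
have := (term t).2; rewrite h eqxx => /esym/eqP; exact.
Qed.

End OneFiltration.

Lemma posdef_unit (G : 'M[C]_n) : (forall u : 'rV[C]_n, u != 0 -> 0 < form G u (bar u)) -> G \in unitmx.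
Proof.
move=> pos; rewrite -row_free_unit -kermx_eq0; apply/eqP/row_matrixP => i.
rewrite row0; apply/eqP/negPn/negP => ne; have := pos _ ne.
have : row i (kermx G) *m G = 0 by rewrite -row_mul mulmx_ker row0.
by rewrite /form => ->; rewrite mul0mx mxE ltxx.
Qed.

Lemma bigraded_eqF (F F' : int -> 'M[C]_n) W s e :
  (forall p, (F p :=: F' p)%MS) -> bigraded F W s e -> bigraded F' W s e.
Proof.
move=> h [ge FI WI barI]; split => // p; apply/eqmxP.
exact: eqmx_trans (eqmx_sym (h p)) (eqmxP (FI p)).
Qed.

Lemma bigraded_transport (F : int -> 'M[C]_n) (W : int -> 'M[R]_n) s e (g : 'M[C]_n) :
  bigraded F W s e -> g \in unitmx -> bar g = g -> preserves (cxf W) g ->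
  bigraded (fun p => F p *m g) W s (fun t => invmx g *m e t *m g).
Proof.
move=> [ge FI WI barI] gU bg Wg; have gVU : invmx g \in unitmx by rewrite unitmx_inv.
have cu m (X : 'M[C]_(n, m)) : (invmx g *m X :=: X)%MS by exact: eqmx_conj_unit.
have pr P : (proj s (fun t => invmx g *m e t *m g) P :=: proj s e P *m g)%MS.
  by rewrite conj_proj -mulmxA; exact: cu.
split.
- exact: conj_grading.
- move=> p; apply/eqmxP; apply: eqmx_trans (eqmx_sym (pr _)); apply: eqmxMr; exact/eqmxP.
- move=> j; apply/eqmxP; apply: eqmx_trans (eqmx_sym (pr _)).
  apply: eqmx_trans (eqmx_sym (eqmx_unit_stable gU (Wg j))) _; apply: eqmxMr; exact/eqmxP.
move=> p q; apply/eqmxP.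
have bgV : bar (invmx g) = invmx g by rewrite /bar map_invmx -/(bar g) bg.
have h1 : (bar (invmx g *m e (p, q) *m g) :=: bar (e (p, q)) *m g)%MS.
  by rewrite !barM bgV bg -mulmxA; exact: cu.
have h2 : (invmx g *m e (q, p) *m g :=: e (q, p) *m g)%MS by rewrite -mulmxA; exact: cu.
apply: eqmx_trans (adds_eqmx h1 (pr _)) _; apply: eqmx_trans _ (eqmx_sym (adds_eqmx h2 (pr _))).
apply: eqmx_trans (eqmx_sym (addsmxMr _ _ _)) _; apply: eqmx_trans _ (addsmxMr _ _ _).
by apply: eqmxMr; exact/eqmxP.
Qed.

(** [g] multiplies Q_j by [l j] and, being real, commutes with the conjugation of the
    second variable. *)
Lemma gram_transport F (W Q : int -> 'M[R]_n) s e (g : 'M[C]_n) (l : int -> C) :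
  bigraded F W s e -> g \in unitmx -> bar g = g ->
  (forall j, vanishes (cxf W j) (cxf W j) (g *m cxf Q j *m g^T - l j *: cxf Q j)) ->
  gram s (fun t => invmx g *m e t *m g) Q =
  invmx g *m (\sum_(t <- s) (('i : C) ^ (t.1 - t.2) * l (weight t)) *:
     (e t *m cxf Q (weight t) *m (bar (e t))^T)) *m (invmx g)^T.
Proof.
move=> b gU bg iso; have ge : grading s e by case: b.
have bgV : bar (invmx g) = invmx g by rewrite /bar map_invmx -/(bar g) bg.
rewrite /gram mulmx_sumr mulmx_suml; apply: eq_bigr => t _.
rewrite -scalemxAr -scalemxAl -scalerA; congr (_ *: _).
have eW : (e t <= cxf W (weight t))%MS.
  case: b => _ _ WI _; have /andP[_ h] := WI (weight t); apply: submx_trans h.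
  by apply: (gr_sub_proj ge); rewrite /Wpart.
have ebW : (bar (e t) <= cxf W (weight t))%MS by rewrite -[X in (_ <= X)%MS](bar_cx (W (weight t))) bar_sub.
have := vanishes_mx (iso (weight t)) eW ebW.
rewrite mulmxBr mulmxBl -scalemxAr -scalemxAl => /eqP; rewrite subr_eq0 => /eqP h.
rewrite !barM bgV bg !trmx_mul scalemxAl scalemxAr -h.
by rewrite !mulmxA.
Qed.

(** Transport of structure: g X g^-1 = k X enters once linearly and once through the
    adjoint. *)
Lemma adjoint_transport (G' X g : 'M[C]_n) (k : C) : g \in unitmx -> G' \in unitmx -> bar g = g ->
  g *m X = k *: (X *m g) ->
  \tr (X *m Pilot.Defs.adjoint (invmx g *m G' *m (invmx g)^T) X) =
  k * Num.conj k * \tr (X *m Pilot.Defs.adjoint G' X).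
Proof.
move=> gU GU bg gX.
have bgV : bar (invmx g) = invmx g by rewrite /bar map_invmx -/(bar g) bg.
have gVU : invmx g \in unitmx by rewrite unitmx_inv.
have gTU : (invmx g)^T \in unitmx by rewrite unitmx_tr.
have gXg : g *m X *m invmx g = k *: X by rewrite gX -scalemxAl mulmxK.
have inv3 : invmx (invmx g *m G' *m (invmx g)^T) = g^T *m invmx G' *m g.
  set Z := invmx g *m G' *m _; set T := g^T *m _ *m g.
  have ZU : Z \in unitmx by exact: unitmx_mul3.
  have ZT : T *m Z = 1%:M.
    rewrite /T /Z -!mulmxA (mulmxA g) mulmxV // mul1mx (mulmxA (invmx G')) mulVmx //.
    by rewrite mul1mx -trmx_mul mulVmx // trmx1.
  by rewrite -[LHS]mul1mx -ZT mulmxK.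
have -> : Pilot.Defs.adjoint (invmx g *m G' *m (invmx g)^T) X =
    Num.conj k *: (invmx g *m Pilot.Defs.adjoint G' X *m g).
  rewrite /Pilot.Defs.adjoint inv3.
  have -> : g^T *m invmx G' *m g *m X *m (invmx g *m G' *m (invmx g)^T) =
      k *: (g^T *m (invmx G' *m X *m G') *m (invmx g)^T).
    have -> : g^T *m invmx G' *m g *m X *m (invmx g *m G' *m (invmx g)^T) =
      g^T *m invmx G' *m (g *m X *m invmx g) *m (G' *m (invmx g)^T) by rewrite !mulmxA.
    by rewrite gXg -scalemxAr -scalemxAl !mulmxA.
  by rewrite barZ linearZ /= !barM !bar_tr bg bgV !trmx_mul !trmxK !mulmxA.
rewrite -scalemxAr mxtraceZ mulmxA mxtrace_mulC !mulmxA gX -!scalemxAl mxtraceZ mulrCA mulrA.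
by congr (_ * \tr (_ *m _)); rewrite mulmxK.
Qed.

End Metric.

(** * Positivity of the metric on endomorphisms *)

(** Polarization identity: a sesquilinear form with real diagonal is hermitian; the
    values a = 1 and a = i suffice. *)
Lemma conj_cross (L : numClosedFieldType) (b c : L) :
  (forall a, Num.conj (Num.conj a * b + a * c) = Num.conj a * b + a * c) -> c = Num.conj b.
Proof.
move=> cross; have h1 := cross 1; have h2 := cross 'i.
rewrite !rmorph1 !mul1r rmorphD /= in h1.
rewrite rmorphD !rmorphM /= conjCK !conjCi in h2.
have h3 : Num.conj b - Num.conj c = c - b.
  by apply: (mulfI (neq0Ci L)); rewrite !mulrBr -mulNr h2; ring.
apply: (mulfI (x := 2)); first by rewrite pnatr_eq0.
transitivity (b + c + (c - b)); first by ring.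
by rewrite -h1 -h3; ring.
Qed.

Lemma conj_cross_cancel (L : numClosedFieldType) (p q b c a : L) :
  Num.conj p = p -> Num.conj q = q ->
  Num.conj (p + (Num.conj a * b + a * c) + a * Num.conj a * q) =
  p + (Num.conj a * b + a * c) + a * Num.conj a * q ->
  Num.conj (Num.conj a * b + a * c) = Num.conj a * b + a * c.
Proof.
move=> hp hq; have E (x y : L) : Num.conj (x + y) = Num.conj x + Num.conj y := rmorphD _ x y.
rewrite E (E p) hp.
have -> : Num.conj (a * Num.conj a * q) = a * Num.conj a * q.
  by rewrite !rmorphM /= conjCK hq (mulrC (Num.conj a) a).
by move=> /addIr/addrI.
Qed.

Lemma trace_conj (L : fieldType) n (P A B X Y : 'M[L]_n) : P \in unitmx ->
  \tr (A *m (B *m X *m Y)) =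
  \tr (P *m A *m invmx P *m (P *m B *m invmx P) *m (P *m X *m invmx P) *m (P *m Y *m invmx P)).
Proof.
move=> PU; have cj U V : P *m U *m invmx P *m (P *m V *m invmx P) = P *m (U *m V) *m invmx P.
  by rewrite !mulmxA mulmxKV.
by rewrite !cj [RHS]mxtrace_mulC !mulmxA mulVmx // mul1mx.
Qed.

Section Positivity.
Variables (R : realType) (n : nat).
Local Notation C := R[i].
Variable G : 'M[C]_n.
Hypothesis pos : forall u : 'rV[C]_n, u != 0 -> 0 < form G u (bar u).

(** The values on u + a v are real for all a. *)
Lemma posdef_herm_form (u v : 'rV[C]_n) : form G v (bar u) = Num.conj (form G u (bar v)).
Proof.
have real (w : 'rV[C]_n) : Num.conj (form G w (bar w)) = form G w (bar w).
  apply/CrealP; have [->|w0] := eqVneq w 0; last exact: gtr0_real (pos w0).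
  by rewrite /form !mul0mx mxE; exact: rpred0.
have expand (a : C) : form G (u + a *: v) (bar (u + a *: v)) =
    form G u (bar u) + (Num.conj a * form G u (bar v) + a * form G v (bar u))
    + a * Num.conj a * form G v (bar v).
  have barD (x y : 'rV[C]_n) : bar (x + y) = bar x + bar y by rewrite /bar map_mxD.
  have Dl x y z : form G (x + y) z = form G x z + form G y z by rewrite /form !mulmxDl mxE.
  have Dr x y z : form G x (y + z) = form G x y + form G x z.
    by rewrite /form linearD /= mulmxDr mxE.
  have Zr x y k : form G x (k *: y) = k * form G x y.
    by rewrite /form linearZ /= -scalemxAr mxE.
  rewrite barD barZ Dl !Dr !Zr !formZl mulrA (mulrC (Num.conj a) a) !addrA.
  by rewrite (mulrC a (Num.conj a)) -mulrA mulrCA mulrA.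
set b := form G u (bar v) in expand *; set c := form G v (bar u) in expand *.
by apply: conj_cross => a; apply: conj_cross_cancel (real v) _; [exact: (real u)|rewrite -expand real].
Qed.

Lemma posdef_herm : (bar G)^T = G.
Proof.
have E i j : G i j = form G (delta_mx 0 i) (bar (delta_mx 0 j)).
  by rewrite /form /bar map_delta_mx trmx_delta -colE -rowE !mxE.
by apply/matrixP => i j; rewrite !mxE [RHS]E posdef_herm_form -E.
Qed.

(** After a unitary diagonalization of G the trace becomes the sum of the
    |X_ij|^2 d_j / d_i, with positive eigenvalues d_i. *)
Lemma adjoint_pos (X : 'M[C]_n) : X != 0 -> 0 < \tr (X *m Pilot.Defs.adjoint G X).
Proof.
move=> X0; have GU := posdef_unit pos.
have /orthomx_spectralP GE : G \is normalmx by apply/normalmxP; rewrite -map_trmx -/(bar G) posdef_herm.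
set P := spectralmx G in GE; set d := spectral_diag G in GE.
have PU : P \in unitmx by exact: spectral_unit.
have PVE : invmx P = (bar P)^T by rewrite (invmx_unitary (spectral_unitarymx G)) map_trmx.
have PVU : invmx P \in unitmx by rewrite unitmx_inv.
have PGP : P *m G *m invmx P = diag_mx d.
  by rewrite {1}GE !mulmxA mulmxV // mul1mx mulmxK.
have d0 i : 0 < d 0 i.
  have rP : row i P != 0.
    apply/eqP => h; have : row i (P *m invmx P) = 0 by rewrite row_mul h mul0mx.
    rewrite mulmxV // => /matrixP/(_ 0 i); rewrite !mxE eqxx => /eqP.
    by rewrite oner_eq0.
  have := pos rP; have -> : bar (row i P) = row i (bar P) by rewrite /bar map_row.
  by rewrite -form_rows -PVE PGP mxE eqxx mulr1n.
pose dV : 'rV[C]_n := \row_i (d 0 i)^-1.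
have dVd : diag_mx dV *m diag_mx d = 1%:M.
  by rewrite mulmx_diag; apply/matrixP => i j; rewrite !mxE mulVf // gt_eqF.
have PGVP : P *m invmx G *m invmx P = diag_mx dV.
  have ddV : diag_mx d *m diag_mx dV = 1%:M by exact: mulmx1C.
  have h : P *m invmx G *m invmx P *m diag_mx d = 1%:M.
    by rewrite -PGP !mulmxA mulmxKV // mulmxKV // mulmxV.
  by rewrite -[LHS]mulmx1 -ddV mulmxA h mul1mx.
pose X' := P *m X *m invmx P.
have X'0 : X' != 0.
  apply: contra X0 => /eqP h; apply/eqP; have : invmx P *m X' *m P = 0 by rewrite h mulmx0 mul0mx.
  by rewrite /X' !mulmxA mulVmx // mul1mx mulmxKV.
have bX' : (bar X')^T = P *m (bar X)^T *m invmx P.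
  rewrite /X' !barM !trmx_mul -PVE.
  by rewrite {1}PVE bar_tr barK trmxK mulmxA.
have adj : Pilot.Defs.adjoint G X = G *m (bar X)^T *m invmx G.
  rewrite /Pilot.Defs.adjoint !barM !trmx_mul posdef_herm /bar map_invmx -/(bar G).
  by rewrite trmx_inv posdef_herm; exact: mulmxA.
have -> : \tr (X *m Pilot.Defs.adjoint G X) =
    \tr (X' *m diag_mx d *m (bar X')^T *m diag_mx dV).
  by rewrite bX' -PGP -PGVP adj; exact: trace_conj.
have -> : \tr (X' *m diag_mx d *m (bar X')^T *m diag_mx dV) =
    \sum_i \sum_j `|X' i j| ^+ 2 * (d 0 j / d 0 i).
  apply: eq_bigr => i _; rewrite mul_mx_diag mxE mxE mulr_suml; apply: eq_bigr => j _.
  rewrite mul_mx_diag !mxE normCK; ring.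
have t0 i j : 0 <= `|X' i j| ^+ 2 * (d 0 j / d 0 i).
  by rewrite mulr_ge0 ?exprn_ge0 ?divr_ge0 // ltW.
rewrite lt_neqAle sumr_ge0 ?andbT => [|i _]; last exact: sumr_ge0.
apply: contra X'0 => /eqP/esym/eqP; rewrite psumr_eq0 => [/allP h|i _]; last exact: sumr_ge0.
apply/eqP/matrixP => i j; rewrite [RHS]mxE; have := h i (mem_index_enum _).
rewrite psumr_eq0 // => /allP /(_ j (mem_index_enum _)) /=.
by rewrite mulf_eq0 expf_eq0 /= normr_eq0 mulf_eq0 invr_eq0 !(gt_eqF (d0 _)) !orbF => /eqP.
Qed.

End Positivity.

(** * Norms as Laurent polynomials *)
Lemma eigenop_shift (K : numFieldType) n (s : seq int) (e : int -> 'M[K]_n) X (d : int) (x : K) :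
  grading s e -> x != 0 -> lie (degop s e) X = d%:~R *: X ->
  eigenop s e (fun a => x ^ (- a)) *m X = x ^ d *: (X *m eigenop s e (fun a => x ^ (- a))).
Proof.
move=> ge x0 hX; apply: (mx_eq_blocks ge) => a b.
rewrite -scalemxAr -scalemxAl !mulmxA (eigenopl ge) -!scalemxAl -!mulmxA (eigenopr ge).
rewrite -!scalemxAr scalerA !mulmxA.
have [->|h] := eqVneq b (a + d); last by rewrite (lie_degop_off ge hX) ?scaler0 ?h // !scaler0.
by rewrite -expfzDr //; congr (x ^ _ *: _); lia.
Qed.

Section NormPolynomial.
Variables (R : realType) (n : nat).
Local Notation C := R[i].
Implicit Types (G X D : 'M[C]_n).

Lemma adjoint_sum G (J : Type) (r : seq J) (a : J -> C) (X : J -> 'M[C]_n) :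
  Pilot.Defs.adjoint G (\sum_(j <- r) a j *: X j) =
  \sum_(j <- r) Num.conj (a j) *: Pilot.Defs.adjoint G (X j).
Proof.
rewrite /Pilot.Defs.adjoint mulmx_sumr mulmx_suml bar_sum raddf_sum; apply: eq_bigr => j _ /=.
by rewrite -scalemxAr -scalemxAl barZ linearZ.
Qed.

(** Used for the metrics D G obtained from G by rescaling its pieces. *)
Lemma adjoint_scaled G D X : G \in unitmx -> D \in unitmx ->
  Pilot.Defs.adjoint (D *m G) X = Pilot.Defs.adjoint G (invmx D *m X *m D).
Proof.
move=> GU DU; rewrite /Pilot.Defs.adjoint; congr (bar _)^T.
have -> : invmx (D *m G) = invmx G *m invmx D; last by rewrite !mulmxA.
have DGU : D *m G \in unitmx by rewrite unitmx_mul DU.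
have h : invmx G *m invmx D *m (D *m G) = 1%:M by rewrite mulmxA mulmxKV // mulVmx.
by rewrite -[LHS]mul1mx -h mulmxK.
Qed.

(** [D] is self-adjoint for G, so conjugation by D is self-adjoint on endomorphisms,
    and X and Z belong to different eigenvalues. *)
Lemma trace_eigen_orth G D X Z (a b : C) : G \in unitmx -> D \in unitmx ->
  (bar G)^T = G -> D *m G = G *m (bar D)^T -> D *m X = a *: (X *m D) -> D *m Z = b *: (Z *m D) ->
  Num.conj b = b -> a != b -> \tr (X *m Pilot.Defs.adjoint G Z) = 0.
Proof.
move=> GU DU hG DG DX DZ bb ab.
have adE : Pilot.Defs.adjoint G Z = G *m (bar Z)^T *m invmx G.
  rewrite /Pilot.Defs.adjoint !barM !trmx_mul hG /bar map_invmx -/(bar G) trmx_inv hG.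
  exact: mulmxA.
have GD : invmx G *m D = (bar D)^T *m invmx G.
  by rewrite -[LHS](mulmxK GU) -(mulmxA _ D) DG mulKmx.
have ZD : (bar Z)^T *m (bar D)^T = b *: ((bar D)^T *m (bar Z)^T).
  by rewrite -!trmx_mul -!barM DZ barZ bb linearZ.
have adZ : Pilot.Defs.adjoint G Z *m D = b *: (D *m Pilot.Defs.adjoint G Z).
  have -> : Pilot.Defs.adjoint G Z *m D = G *m ((bar Z)^T *m (bar D)^T) *m invmx G.
    by rewrite adE -!mulmxA GD.
  rewrite ZD -scalemxAr -scalemxAl adE.
  by congr (_ *: _); rewrite !mulmxA DG.
set A := Pilot.Defs.adjoint G Z in adZ *.
have : b * \tr (X *m A) = a * \tr (X *m A).
  rewrite -[in LHS](mulKmx DU X) DX -scalemxAr -scalemxAl mxtraceZ mulrCA; congr (_ * _).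
  rewrite -mxtraceZ -!mulmxA scalemxAr [b *: _]scalemxAr -adZ mxtrace_mulC -!mulmxA.
  by rewrite mulmxV // mulmx1.
move/eqP; rewrite eq_sym -subr_eq0 -mulrBl mulf_eq0 subr_eq0 (negbTE ab) => /eqP; exact.
Qed.

Lemma Re_scale (x : R) (z : C) : complex.Re (x%:C%C * z) = x * complex.Re z.
Proof. by case: z => a b /=; rewrite mul0r subr0. Qed.

Lemma Re_sum (J : Type) (r : seq J) (f : J -> C) :
  complex.Re (\sum_(j <- r) f j) = \sum_(j <- r) complex.Re (f j).
Proof. by apply: (big_morph (@complex.Re R)) => // -[a b] [c d]. Qed.

Lemma Re_pos (z : C) : 0 < z -> 0 < complex.Re z.
Proof. by rewrite ltcE => /andP[]. Qed.

(** Expanding D^-1 N D into eigenvectors gives the polynomial.  The coefficient of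
    index k is the product of N with X_k, i.e. the square norm of X_k by
    [trace_eigen_orth]. *)
Lemma norm_polynomial G (N : 'M[C]_n) (D : R -> 'M[C]_n) (X : nat -> 'M[C]_n) (k : nat) :
  (forall u : 'rV[C]_n, u != 0 -> 0 < form G u (bar u)) ->
  (forall r, 0 < r -> [/\ D r \in unitmx, D r *m G = G *m (bar (D r))^T &
     forall m, (m <= k)%N -> D r *m X m = r%:C%C ^ (- m%:Z) *: (X m *m D r)]) ->
  N = \sum_(m < k.+1) X m -> X k != 0 ->
  exists tau : nat -> R, 0 < tau k /\ forall r, 0 < r ->
    complex.Re (\tr (N *m Pilot.Defs.adjoint (D r *m G) N)) = \sum_(m < k.+1) tau m * r ^ m%:Z.
Proof.
have cpow (r : R) (j : int) : r%:C%C ^ j = (r ^ j)%:C%C by rewrite fmorphXz.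
move=> pos hD NE Xk; have GU := posdef_unit pos.
exists (fun m => complex.Re (\tr (N *m Pilot.Defs.adjoint G (X m)))); split.
  have -> : \tr (N *m Pilot.Defs.adjoint G (X k)) = \tr (X k *m Pilot.Defs.adjoint G (X k)).
    rewrite {1}NE mulmx_suml raddf_sum (bigD1 ord_max) //= big1 ?addr0 // => m mk.
    (* Any positive r other than 1 separates the eigenvalues r^-m. *)
    have [DU DG DX] := hD 2 (ltr0n _ 2).
    apply: (trace_eigen_orth GU DU (posdef_herm pos) DG (DX m _) (DX k _)) => //; first by rewrite -ltnS.
      by rewrite cpow conj_real.
    rewrite !cpow (inj_eq (fmorph_inj _)).
    have h12 : (2 : R) != 1 by rewrite (eqr_nat _ 2 1).
    by rewrite (inj_eq (ieexprIz (ltr0n _ 2) h12)) (inj_eq oppr_inj).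
  by apply: Re_pos; apply: adjoint_pos.
move=> r r0; have [DU DG DX] := hD r r0; rewrite adjoint_scaled //.
have -> : invmx (D r) *m N *m D r = \sum_(m < k.+1) (r%:C%C ^ m%:Z) *: X m.
  rewrite NE mulmx_sumr mulmx_suml; apply: eq_bigr => m _.
  have h : (m <= k)%N by rewrite -ltnS.
  have h1 : X m *m D r = r%:C%C ^ m%:Z *: (D r *m X m).
    rewrite DX // scalerA -expfzDr ?subrr ?scale1r //.
    exact: real_neq0.
  by rewrite -mulmxA h1 -scalemxAr mulKmx.
rewrite adjoint_sum mulmx_sumr (raddf_sum (@mxtrace C n)) Re_sum; apply: eq_bigr => m _ /=.
rewrite -scalemxAr mxtraceZ.
have -> : Num.conj (r%:C%C ^ m%:Z) = (r ^ m%:Z)%:C%C by rewrite cpow conj_real.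
by rewrite Re_scale mulrC.
Qed.

End NormPolynomial.

(** * Translation along the real direction *)
Lemma eigenop_conj (K : numFieldType) n (T : eqType) (s : seq T) (e : T -> 'M[K]_n) (U V S : 'M[K]_n) f :
  U \in unitmx -> V \in unitmx -> eigenop s e f = S -> V *m S = S *m V ->
  eigenop s (fun t => invmx (V *m U) *m e t *m (V *m U)) f = invmx U *m S *m U.
Proof.
move=> UU VU <- VS.
have -> : eigenop s (fun t => invmx (V *m U) *m e t *m (V *m U)) f =
    invmx (V *m U) *m eigenop s e f *m (V *m U).
  rewrite /eigenop mulmx_sumr mulmx_suml; apply: eq_bigr => t _.
  by rewrite -scalemxAr -scalemxAl.
have VUU : V *m U \in unitmx by rewrite unitmx_mul VU.
apply: (can_inj (mulKmx VUU)); rewrite -(mulmxA (invmx _)) mulKVmx //.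
by rewrite -!mulmxA mulKVmx // !mulmxA VS.
Qed.

Lemma mhnorm_gram (R : realType) n F (W Q : int -> 'M[R]_n) s e A : bigraded F W s e ->
  mhnorm F W Q A = Num.sqrt (complex.Re (\tr (A *m Pilot.Defs.adjoint (gram s e Q) A))).
Proof. by move=> b; rewrite /mhnorm (gramE _ b). Qed.

(** The two metrics are then the same default value. *)
Lemma mhnorm_no_bigrading (R : realType) n F F' (W Q : int -> 'M[R]_n) A :
  ~ (exists I, is_deligne_bigrading F W I) -> ~ (exists I, is_deligne_bigrading F' W I) ->
  mhnorm F W Q A = mhnorm F' W Q A.
Proof.
have E F0 : ~ (exists I, is_deligne_bigrading F0 W I) -> deligne_bigrading F0 W = fun _ _ => 0.
  by move=> no; rewrite /deligne_bigrading xgetPN // => I hI; apply: no; exists I.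
by move=> /E h /E h'; rewrite /mhnorm /mixed_hodge_metric /is_mixed_hodge_metric h h'.
Qed.

Section Orbit.
Variables (R : realType) (n : nat).
Local Notation C := R[i].
Variables (W Q : int -> 'M[R]_n) (N : 'M[R]_n) (m0 : nat).
Hypothesis hN : infinitesimal_isometry W Q N.
Hypothesis Nm : N ^+ m0 = 0.

Let zN_nil (z : C) : (z *: cx N) ^+ n = 0. Proof. exact: cx_nilp Nm. Qed.

Lemma expN_preserves (z : C) : preserves (cxf W) (expmx (z *: cx N)).
Proof.
move=> j; apply: expmx_stable; rewrite -scalemxAr scalemx_sub //.
by apply: cx_preserves; case: hN.
Qed.

Lemma expN_isometry (z : C) j : vanishes (cxf W j) (cxf W j)
  (expmx (z *: cx N) *m cxf Q j *m (expmx (z *: cx N))^T - cxf Q j).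
Proof.
apply: exp_isometry => //.
  rewrite -scalemxAr scalemx_sub //; apply: cx_preserves; by case: hN.
move=> u v uW vW; have := N_isometry hN uW vW; rewrite /form => h.
by rewrite linearZ /= -scalemxAl -scalemxAr -scalerDr -scalemxAr -scalemxAl mxE h mulr0.
Qed.

Lemma expN_form (z : C) j (u v : 'rV[C]_n) : (u <= cxf W j)%MS -> (v <= cxf W j)%MS ->
  form (cxf Q j) (u *m expmx (z *: cx N)) (v *m expmx (z *: cx N)) = form (cxf Q j) u v.
Proof.
move=> uW vW; have := expN_isometry z uW vW; rewrite /form trmx_mul.
rewrite mulmxBr mulmxBl mxE [X in _ + X]mxE => /eqP; rewrite subr_eq0 => /eqP <-.
by rewrite !mulmxA.
Qed.

(** The first Hodge-Riemann relation at e^(zN).F, transported by the isometry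
    e^(-zN). *)
Lemma isotropy F (h : int -> int -> nat) (z : C) : in_D W Q h (orbit_at N F z) ->
  forall j p, vanishes (F p :&: cxf W j)%MS (F (j + 1 - p)%R :&: cxf W j)%MS (cxf Q j).
Proof.
case=> _ [iso _] _ j p u v; rewrite !sub_capmx => /andP[uF uW] /andP[vF vW].
rewrite -(expN_form z uW vW); apply: (iso j p).
  apply: submx_trans (addsmxSl _ _); rewrite sub_capmx submxMr //.
  exact: submx_trans (submxMr _ uW) (expN_preserves z j).
apply: submx_trans (addsmxSl _ _); rewrite sub_capmx submxMr //.
exact: submx_trans (submxMr _ vW) (expN_preserves z j).
Qed.

Section RealTranslation.
Variables (F : int -> 'M[C]_n) (x : R).
Let g : 'M[C]_n := expmx (x%:C%C *: cx N).

Let gU : g \in unitmx. Proof. exact: expmx_unit (zN_nil _). Qed.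
Let bg : bar g = g.
Proof. by rewrite /g bar_expmx barZ conj_real bar_cx. Qed.

Lemma orbit_translate z p : orbit_at N F (z + x%:C%C) p = orbit_at N F z p *m g.
Proof.
rewrite /orbit_at /filtration_act -mulmxA; congr (_ *m _); rewrite scalerDl.
rewrite /g -expmxD //; last by rewrite -scalerDl.
by rewrite -!scalemxAl -!scalemxAr !scalerA mulrC.
Qed.

Lemma bigraded_translate z s e : bigraded (orbit_at N F z) W s e ->
  bigraded (orbit_at N F (z + x%:C%C)) W s (fun t => invmx g *m e t *m g).
Proof.
move=> b; apply: bigraded_eqF (bigraded_transport b gU bg (expN_preserves _)) => p.
by rewrite orbit_translate; exact: eqmx_refl.
Qed.

End RealTranslation.

(** e^(xN) is a real isometry of W and Q commuting with N, so it transports bigrading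
    and metric.  A bigrading exists for both filtrations or for neither. *)
Lemma norm_translate F (h : int -> int -> nat) z (x : R) :
  in_D W Q h (orbit_at N F (z + x%:C%C)) ->
  mhnorm (orbit_at N F (z + x%:C%C)) W Q (cx N) = mhnorm (orbit_at N F z) W Q (cx N).
Proof.
case=> _ pol _.
have [[I hI]|no] := pselect (exists I, is_deligne_bigrading (orbit_at N F z) W I).
  have [s [e [b _]]] := bigraded_of hI; have b' := bigraded_translate x b.
  apply: etrans (mhnorm_gram Q (cx N) b') _; apply: etrans _ (esym (mhnorm_gram Q (cx N) b)).
  have gU' := posdef_unit (gram_pos b' pol).
  set g := expmx (x%:C%C *: cx N) in b' gU' *.
  have gU : g \in unitmx by exact: expmx_unit (zN_nil _).
  have bg : bar g = g by rewrite /g bar_expmx barZ conj_real bar_cx.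
  have iso j : vanishes (cxf W j) (cxf W j) (g *m cxf Q j *m g^T - 1 *: cxf Q j).
    by rewrite scale1r; exact: expN_isometry.
  have gN : g *m cx N = 1 *: (cx N *m g).
    by rewrite scale1r /g; apply/esym/expmx_comm; rewrite -scalemxAl -scalemxAr.
  have := gram_transport b gU bg iso; rewrite (eq_bigr (fun t : int * int => ('i : C) ^ (t.1 - t.2) *:
     (e t *m cxf Q (weight t) *m (bar (e t))^T))) => [|t _]; last by rewrite mulr1.
  rewrite -/(gram s e Q) => gE; rewrite gE in gU' *.
  have GU : gram s e Q \in unitmx.
    by move: gU'; rewrite !unitmx_mul => /andP[/andP[]].
  by rewrite (adjoint_transport gU GU bg gN) rmorph1 !mul1r.
have no' : ~ exists I, is_deligne_bigrading (orbit_at N F (z + x%:C%C)) W I.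
  case=> I hI; apply: no; have [s [e [b _]]] := bigraded_of hI.
  have := bigraded_is (bigraded_translate (- x) b).
  have -> : z + x%:C%C + (- x)%:C%C = z by rewrite rmorphN addrK.
  by eexists; eassumption.
exact: mhnorm_no_bigrading.
Qed.

End Orbit.

(** * The norm along the imaginary axis *)
Lemma unitmx_mul2 (K : fieldType) n (A B : 'M[K]_n) :
  A \in unitmx -> B \in unitmx -> A *m B \in unitmx.
Proof. by move=> hA hB; rewrite unitmx_mul hA. Qed.

Lemma conj_fix (K : fieldType) n (U X : 'M[K]_n) : U \in unitmx ->
  U *m X = X *m U -> invmx U *m X *m U = X.
Proof. by move=> UU UX; rewrite -mulmxA -UX mulKmx. Qed.

Lemma conj_neq0 (K : fieldType) n (U X : 'M[K]_n) : U \in unitmx ->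
  X != 0 -> invmx U *m X *m U != 0.
Proof.
move=> UU; apply: contra => /eqP h; apply/eqP.
by rewrite -(mulKVmx UU X) -(mulmxK UU (invmx U *m X)) h mul0mx mulmx0.
Qed.

Section GramSpec.
Variables (R : realType) (n : nat).
Local Notation C := R[i].
Variables (Q : int -> 'M[R]_n) (s : seq (int * int)) (e : int * int -> 'M[C]_n) (f : int * int -> C).
Hypothesis ge : grading s e.

Lemma eigenop_gram : eigenop s e f *m gram s e Q =
  \sum_(t <- s) (('i : C) ^ (t.1 - t.2) * f t) *: (e t *m cxf Q (weight t) *m (bar (e t))^T).
Proof.
rewrite /gram mulmx_sumr; apply: eq_bigr => t _.
by rewrite -scalemxAr !mulmxA (eigenopr ge) -!scalemxAl scalerA.
Qed.

Lemma gram_eigenop : (forall t, Num.conj (f t) = f t) ->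
  gram s e Q *m (bar (eigenop s e f))^T =
  \sum_(t <- s) (('i : C) ^ (t.1 - t.2) * f t) *: (e t *m cxf Q (weight t) *m (bar (e t))^T).
Proof.
move=> fr; rewrite /gram mulmx_suml; apply: eq_bigr => t _.
rewrite -scalemxAl -!mulmxA -trmx_mul -barM (eigenopr ge) barZ fr linearZ /=.
by rewrite -!scalemxAr scalerA.
Qed.

End GramSpec.

Section NormFormula.
Variables (R : realType) (n : nat).
Local Notation C := R[i].
Variables (W : int -> 'M[R]_n) (Q : int -> 'M[R]_n) (N : 'M[R]_n) (F : int -> 'M[C]_n) (YM : 'M[C]_n)
    (s : seq (int * int)) (e : int * int -> 'M[C]_n)
    (sY : seq int) (eY : int -> 'M[C]_n) (E : 'M[C]_n) (m0 : nat)
    (h : int -> int -> nat) (k : nat) (Nd : nat -> 'M[C]_n).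
Hypothesis LD : limit_data W N F YM s e sY eY E.
Hypothesis hW : increasing_filtration W.
Hypothesis hQ : graded_forms W Q.
Hypothesis hN : infinitesimal_isometry W Q N.
Hypothesis Nm : N ^+ m0 = 0.

Let ge := ld_gr LD.
Let gY : grading sY eY. Proof. by case: (ld_del LD). Qed.
Let WY j : (cxf W j == proj sY eY (upto j))%MS. Proof. by case: (ld_del LD). Qed.
Let sM := undup (map weight s).
Let eM := coarse s e weight.
Let gM : grading sM eM := coarse_grading ge weight.
Let YMd : YM = degop sM eM. Proof. by rewrite (ld_YM LD) -(coarse_degop weight ge). Qed.
Let zN_nil (z : C) : (z *: cx N) ^+ n = 0. Proof. exact: cx_nilp Nm. Qed.

Definition dilation (r : R) : 'M[C]_n := eigenop sM eM (fun l => r%:C%C ^ (- l)).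

Section Dilation.
Variable r : R.
Hypothesis r0 : 0 < r.

Let rC0 : r%:C%C != 0 :> C.
Proof. exact: real_neq0. Qed.

Lemma real_pow (x : R) (j : int) : x%:C%C ^ j = (x ^ j)%:C%C :> C.
Proof. by rewrite fmorphXz. Qed.

Lemma dilation_bar : bar (dilation r) = dilation r.
Proof.
rewrite /dilation /eigenop bar_sum; apply: eq_bigr => l _.
by rewrite barZ real_pow conj_real (eM_bar ge (ld_bar LD)).
Qed.

Lemma dilation_unit : dilation r \in unitmx.
Proof. by apply: (eigenop_unit gM) => l; exact: expfz_neq0. Qed.

Lemma dilation_N : dilation r *m cx N = r%:C%C ^ (- 2) *: (cx N *m dilation r).
Proof. by apply: (eigenop_shift gM rC0); rewrite -YMd (lie_YM_N LD) rmorphN. Qed.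

Lemma dilation_W : preserves (cxf W) (dilation r).
Proof.
apply: (deg_preserves gY WY) => t; apply/esym/eigenop_comm => l.
by rewrite (eM_eY LD).
Qed.

Lemma dilation_F p : (F p *m dilation r :=: F p)%MS.
Proof.
apply: (eqmx_unit_stable dilation_unit); apply/(ld_F LD) => t nt.
have -> : F p *m dilation r *m e t = F p *m e t *m dilation r.
  rewrite -!mulmxA; congr (_ *m _); apply/esym/eigenop_comm => l.
  by rewrite (coarse_mull ge) (coarse_mulr ge).
by rewrite ((ld_F LD p (F p)).1 (submx_refl _) t nt) mul0mx.
Qed.

(** The dilation preserves F and multiplies N by r^(-2). *)
Lemma dilation_orbit (z : C) p :
  (orbit_at N F z p *m dilation r :=: orbit_at N F (z * r%:C%C ^ 2)%R p)%MS.
Proof.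
rewrite /orbit_at /filtration_act; set z' := z * _.
have hz : dilation r *m (z' *: cx N) = (z *: cx N) *m dilation r.
  rewrite -scalemxAr dilation_N scalerA -scalemxAl /z' -mulrA -expfzDr // subrr mulr1 //.
have := expmx_intertwine hz; move: (dilation r) (dilation_F p) => A hA AE.
by rewrite -mulmxA -AE mulmxA; exact: eqmxMr.
Qed.

End Dilation.

Hypothesis hNd : ad_decomposition (degop sY eY) (cx N) k Nd.

Lemma Nd_low : cx N = \sum_(j < k.+1) low sY eY j%:Z (cx N).
Proof.
have [NE wt] := hNd; rewrite {1}NE; apply: eq_bigr => j _.
have jk (i : 'I_k.+1) : (i <= k)%N by rewrite -ltnS.
have -> : low sY eY j%:Z (cx N) = \sum_(i < k.+1) low sY eY j%:Z (Nd i).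
  rewrite NE /low exchange_big /=; apply: eq_bigr => a _.
  by rewrite mulmx_sumr mulmx_suml.
have wt' (i : 'I_k.+1) : lie (degop sY eY) (Nd i) = - ((i%:Z)%:~R *: Nd i) by exact: wt.
rewrite (bigD1 j) //= (low_of_weight gY (wt' j)) big1 ?addr0 // => i ij.
by apply: (low_weight_off gY (wt' i)); apply: contra ij => /eqP[] /ord_inj ->.
Qed.

Section BasePoint.
Variable z : C.
Hypotheses (z0 : z != 0) (bz : Num.conj z = - z).

(* The Cayley transform at z, with c = -1 / (2 z). *)
Let V : 'M[C]_n := expmx ((- (z + z)^-1) *: E).
Let U : 'M[C]_n := expmx (z *: cx N).
Definition base_piece t : 'M[C]_n := invmx (V *m U) *m Jpiece s e eY t *m (V *m U).
Let T := Jindex s sY.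

Let UU : U \in unitmx. Proof. exact: expmx_unit (zN_nil z). Qed.
Let VU : V \in unitmx. Proof. exact: expmx_unit (scaled_nilp _ (E_nil LD)). Qed.

Lemma base_bigraded : bigraded (orbit_at N F z) W T base_piece.
Proof.
have Nn : cx N ^+ n = 0 by rewrite -[cx N]scale1r.
have WN : preserves W N by case: hN.
apply: (cayley_bigraded LD WN Nn Nd_low (t2 := z + z)) => //.
  by rewrite mulNr mulVf // -mulr2n mulrn_eq0.
by rewrite rmorphN fmorphV rmorphD /= bz -opprD invrN.
Qed.

Let gT : grading T base_piece. Proof. by case: base_bigraded. Qed.

Definition base_scaling (x : R) : 'M[C]_n := eigenop T base_piece (fun t => x%:C%C ^ (- weight t)).

(** On the J^(p,q) the operator Y is p + q, and V commutes with Y; so only the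
    conjugation by e^(zN) remains. *)
Lemma base_scalingE x : base_scaling x = invmx U *m eigenop sY eY (fun j => x%:C%C ^ (- j)) *m U.
Proof.
set S := eigenop sY eY _; apply: (eigenop_conj UU VU).
  rewrite [RHS](gr_suml (J_grading LD)) /eigenop; apply: eq_bigr => t _.
  by rewrite /Jpiece -[RHS]mulmxA (eigenopl gY) -scalemxAr.
apply/esym/expmx_comm; rewrite -scalemxAl -scalemxAr; congr (_ *: _).
by apply/esym/eigenop_comm; exact: (E_eY LD).
Qed.

Lemma base_scaling_Nd x m : 0 < x -> (m <= k)%N ->
  base_scaling x *m (invmx U *m Nd m *m U) =
  x%:C%C ^ (- m%:Z) *: (invmx U *m Nd m *m U *m base_scaling x).
Proof.
move=> x0 mk; rewrite base_scalingE; have [_ wt] := hNd.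
have xC0 : x%:C%C != 0 :> C by exact: real_neq0.
have := eigenop_shift (d := - m%:Z) gY xC0 (X := Nd m); rewrite wt // rmorphN scaleNr => /(_ erefl).
move: (eigenop _ _ _) UU => S; move: U (Nd m) => U' X UU' hS.
have cj A B : invmx U' *m A *m U' *m (invmx U' *m B *m U') = invmx U' *m (A *m B) *m U'.
  by rewrite !mulmxA mulmxK.
by rewrite !cj hS -scalemxAr -scalemxAl.
Qed.

(** The dilation carries the bigrading at z to the one at r^2 z, rescales Q_w by
    r^(-2w), and multiplies N by r^(-2). *)
Lemma norm_dilation r : 0 < r -> in_D W Q h (orbit_at N F z) ->
  mhnorm (orbit_at N F (z * r%:C%C ^ 2)) W Q (cx N) =
  Num.sqrt (r ^ (- 4) * complex.Re (\tr (cx N *m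
    Pilot.Defs.adjoint (base_scaling (r ^+ 2) *m gram T base_piece Q) (cx N)))).
Proof.
move=> r0 inD; have isoF := isotropy hN Nm inD; have [_ pol _] := inD.
have b := base_bigraded.
have rC0 : r%:C%C != 0 :> C by exact: real_neq0.
have iso j : vanishes (cxf W j) (cxf W j)
    (dilation r *m cxf Q j *m (dilation r)^T - r%:C%C ^ (- (2 * j)) *: cxf Q j).
  have := scaling_isometry LD hW hQ hN isoF (j := j) rC0; exact.
have AU := dilation_unit r0; have bA := dilation_bar r; have AN := dilation_N r0.
have AW := dilation_W r; have AF := dilation_orbit r0 z.
move: (dilation r) AU bA AN AW AF iso => A AU bA AN AW AF iso.
have b' := bigraded_eqF AF (bigraded_transport b AU bA AW).
apply: etrans (mhnorm_gram Q (cx N) b') _; congr Num.sqrt.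
have DE : base_scaling (r ^+ 2) *m gram T base_piece Q = \sum_(t <- T)
    (('i : C) ^ (t.1 - t.2) * r%:C%C ^ (- (2 * weight t))) *:
    (base_piece t *m cxf Q (weight t) *m (bar (base_piece t))^T).
  rewrite /base_scaling (eigenop_gram _ _ gT); apply: eq_bigr => t _; congr ((_ * _) *: _).
  by rewrite rmorphXn /= exprnP exprz_exp mulrN.
rewrite (gram_transport (l := fun j => r%:C%C ^ (- (2 * j))) b AU bA iso) -DE.
have GU := posdef_unit (gram_pos b pol).
have DU : base_scaling (r ^+ 2) \in unitmx.
  apply: (eigenop_unit gT) => t; apply: expfz_neq0.
  by apply: real_neq0; rewrite exprn_gt0.
have DGU : base_scaling (r ^+ 2) *m gram T base_piece Q \in unitmx := unitmx_mul2 DU GU.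
move: (base_scaling _ *m _) DGU => G' DGU; clear - AU DGU bA AN r0.
rewrite (adjoint_transport AU DGU bA AN) !real_pow conj_real -rmorphM /= -expfzDr ?gt_eqF //.
exact: Re_scale.
Qed.

Hypothesis hk : Nd k != 0.

Lemma norm_base : in_D W Q h (orbit_at N F z) -> exists tau : nat -> R, 0 < tau k /\
  forall r, 0 < r -> mhnorm (orbit_at N F (z * r%:C%C ^ 2)) W Q (cx N) =
    Num.sqrt (\sum_(m < k.+1) tau m * (r ^+ 2) ^ (m%:Z - 2)).
Proof.
move=> inD; have [_ pol _] := inD; have b := base_bigraded.
have [tau [tk tauE]] : exists tau : nat -> R, 0 < tau k /\ forall x, 0 < x ->
    complex.Re (\tr (cx N *m Pilot.Defs.adjoint (base_scaling x *m gram T base_piece Q) (cx N))) =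
    \sum_(m < k.+1) tau m * x ^ m%:Z.
  apply: (norm_polynomial (D := base_scaling) (X := fun m => invmx U *m Nd m *m U) (gram_pos b pol)).
  - move=> x x0; split.
    + apply: (eigenop_unit gT) => t; apply: expfz_neq0.
      exact: real_neq0.
    + have fr t : Num.conj (x%:C%C ^ (- weight t)) = x%:C%C ^ (- weight t) :> C.
        by rewrite real_pow conj_real.
      exact (etrans (eigenop_gram Q _ gT) (esym (gram_eigenop Q gT fr))).
    + by move=> m; exact: base_scaling_Nd.
  - have [NE _] := hNd; rewrite -mulmx_suml -mulmx_sumr -NE.
    have UN : U *m cx N = cx N *m U.
      by apply/esym/expmx_comm; rewrite -scalemxAl -scalemxAr.
    exact (esym (conj_fix UU UN)).
  - exact (conj_neq0 UU hk).
exists tau; split=> // r r0; rewrite (norm_dilation r0 inD) (tauE _ (exprn_gt0 2 r0)).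
congr Num.sqrt; rewrite mulr_sumr; apply: eq_bigr => m _; rewrite mulrCA; congr (_ * _).
rewrite expfzDr ?expf_neq0 ?gt_eqF // mulrC; congr (_ * _).
by rewrite exprnP exprz_exp.
Qed.

End BasePoint.

(** With the base point z = i y1 and r^2 = y / y1, [norm_base] covers all y > 0. *)
Lemma norm_formula (y0 : R) : Nd k != 0 ->
  (forall x y : R, y0 < y -> in_D W Q h (orbit_at N F (x +i* y)%C)) ->
  exists tau : nat -> R, 0 < tau k /\ forall y, 0 < y ->
    mhnorm (orbit_at N F (0 +i* y)%C) W Q (cx N) =
    Num.sqrt (\sum_(m < k.+1) tau m * y ^ (m%:Z - 2)).
Proof.
move=> hk hD; pose y1 := `|y0| + 1.
have y10 : 0 < y1 by rewrite ltr_wpDl.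
have inD : in_D W Q h (orbit_at N F (0 +i* y1)%C).
  by apply: hD; rewrite (le_lt_trans (ler_norm _)) // ltrDl.
have z0 : (0 +i* y1)%C != 0 :> C by rewrite eq_complex /= eqxx gt_eqF.
have bz : Num.conj (0 +i* y1)%C = - (0 +i* y1)%C :> C by apply/eqP; rewrite eq_complex /= oppr0 !eqxx.
have [tau [tk tauE]] := norm_base z0 bz hk inD.
exists (fun m => tau m * y1 ^ (- (m%:Z - 2))); split; first by rewrite mulr_gt0 ?exprz_gt0.
move=> y y0'; have r0 : 0 < Num.sqrt (y / y1) by rewrite sqrtr_gt0 divr_gt0.
have r2 : Num.sqrt (y / y1) ^+ 2 = y / y1 by rewrite sqr_sqrtr // divr_ge0 ?ltW.
have := tauE _ r0; rewrite r2.
have -> : (0 +i* y1)%C * (Num.sqrt (y / y1))%:C%C ^ 2 = (0 +i* y)%C :> C.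
  rewrite real_pow -exprnP r2; apply/eqP; rewrite eq_complex /=.
  apply/andP; split; apply/eqP; first by ring.
  by rewrite mul0r add0r mulrC divfK ?gt_eqF.
move->; congr Num.sqrt; apply: eq_bigr => m _; rewrite -mulrA; congr (_ * _).
by rewrite expfzMl ?gt_eqF // exprz_inv mulrC.
Qed.

End NormFormula.

(** * Asymptotics *)
Section Limit.
Variable R : realType.

Lemma laurent_cvg (tau : nat -> R) (k : nat) :
  (\sum_(m < k.+1) tau m * (y ^ (m%:Z - k%:Z))) @[y --> +oo] --> tau k.
Proof.
(* In the variable 1 / y the sum is a polynomial. *)
pose p : {poly R} := \sum_(m < k.+1) tau m *: 'X^(k - m).
have p0 : p.[0] = tau k.
  rewrite /p horner_sum (bigD1 ord_max) //= big1 ?addr0 => [|i ik].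
    by rewrite hornerZ hornerXn subnn expr0 mulr1.
  have lt : (i < k)%N by rewrite ltn_neqAle -ltnS ltn_ord andbT.
  by rewrite hornerZ hornerXn expr0n subn_eq0 leqNgt lt mulr0.
rewrite -p0.
have h : p.[y^-1] @[y --> +oo] --> p.[0].
  apply: (cvg_comp (fun y => y^-1) (fun t => p.[t])); last exact: continuous_horner.
  apply/gtr0_cvgV0; last exact: cvg_id.
  exact: nbhs_pinfty_gt.
apply: cvg_trans h; apply: near_eq_cvg; near=> y.
have y0 : y != 0 by rewrite gt_eqF //; near: y; exact: nbhs_pinfty_gt.
rewrite /p horner_sum; apply: eq_bigr => m _; rewrite hornerZ hornerXn; congr (_ * _).
have mk : (m <= k)%N by rewrite -ltnS.
by rewrite exprVn -[in RHS]opprB subzn // -exprnN.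
Unshelve. all: by end_near. Qed.

Lemma powR_half (y : R) (j : int) : 0 < y -> y `^ (j%:~R / 2) = Num.sqrt (y ^ j).
Proof. by move=> y0; rewrite powRrM powR_intmul ?ltW // powR12_sqrt // ltW // exprz_gt0. Qed.

Section ScaledLimit.
Variables (tau : nat -> R) (k : nat) (f : R -> R).
Hypothesis fE : forall y, 0 < y -> f y = Num.sqrt (\sum_(m < k.+1) tau m * y ^ (m%:Z - 2)).

Lemma scaled_norm_cvg : (y `^ ((2%:R - k%:R) / 2%:R) * f y) @[y --> +oo] --> Num.sqrt (tau k).
Proof.
have h : Num.sqrt (\sum_(m < k.+1) tau m * (y ^ (m%:Z - k%:Z))) @[y --> +oo] --> Num.sqrt (tau k).
  by apply: continuous_cvg; [exact: sqrt_continuous|exact: laurent_cvg].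
apply: cvg_trans h; apply: near_eq_cvg; near=> y.
have y0 : 0 < y by near: y; exact: nbhs_pinfty_gt.
have -> : 2%:R - k%:R = (2 - k%:Z)%:~R :> R by rewrite rmorphB.
rewrite powR_half // fE // -sqrtrM ?exprz_ge0 ?ltW // mulr_sumr; congr Num.sqrt.
apply: eq_bigr => m _; rewrite mulrCA; congr (_ * _); rewrite -expfzDr ?gt_eqF //.
by congr (_ ^ _); lia.
Unshelve. all: by end_near. Qed.

End ScaledLimit.

Variables (tau : nat -> R) (k : nat) (f : R -> R).
Hypothesis tk : 0 < tau k.
Hypothesis fE : forall y, 0 < y -> f y = Num.sqrt (\sum_(m < k.+1) tau m * y ^ (m%:Z - 2)).

Lemma norm_bounded : k = 2%N -> exists B y0 : R, forall y, y0 < y -> f y <= B.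
Proof.
move=> k2; exists (Num.sqrt (tau k) + 1).
have := scaled_norm_cvg fE; rewrite k2 subrr mul0r => h.
have : \forall y \near +oo, y `^ 0 * f y < Num.sqrt (tau 2) + 1.
  by apply: (cvgr_lt _ h); rewrite ltrDl.
case=> y0 [_ hy]; exists y0 => y /hy; rewrite powRr0 mul1r; exact: ltW.
Qed.

(** The factor y^((2-k)/2) tends to 0 for k > 2, so the limit would be 0 if f were
    bounded. *)
Lemma norm_unbounded : (2 < k)%N -> ~ exists B y0 : R, forall y, y0 < y -> f y <= B.
Proof.
move=> k2 [B [y0 hB]].
pose w (y : R) := y `^ ((2%:R - k%:R) / 2%:R).
have w0 : w y @[y --> +oo] --> (0 : R).
  (* The constant function 1 is of the same form, with limit 0. *)
  have one y : 0 < y -> 1 = Num.sqrt (\sum_(m < k.+1) (m == 2%N :> nat)%:R * y ^ (m%:Z - 2)) :> R.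
    move=> _; rewrite (bigD1 (Ordinal (ltnW k2 : 2 < k.+1)%N)) //= big1 => [|i i2].
      by rewrite subrr mulr1 addr0 sqrtr1.
    by rewrite (_ : (i == 2%N :> nat) = false) ?mul0r //; exact: negbTE i2.
  have := scaled_norm_cvg (tau := fun m => (m == 2%N)%:R) (f := fun=> 1) one; rewrite gtn_eqF // sqrtr0.
  by under eq_fun do rewrite mulr1.
have wB : w y * B @[y --> +oo] --> (0 : R).
  by rewrite -(mul0r B); apply: cvgMl.
suff : Num.sqrt (tau k) <= 0 by rewrite leNgt sqrtr_gt0 tk.
apply: (ler_cvg_to (scaled_norm_cvg fE) wB); near=> y.
apply: ler_wpM2l; first exact: powR_ge0.
by apply: hB; near: y; apply: nbhs_pinfty_gt; exact: num_real.
Unshelve. all: by end_near. Qed.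

End Limit.

Theorem lemma5p11p1 (R : realType) (n : nat)
    (W Q : int -> 'M[R]_n) (h : int -> int -> nat)
    (N : 'M[R]_n) (F : int -> 'M[R[i]]_n) (M : int -> 'M[R]_n)
    (Y : 'M[R[i]]_n) (k : nat) (Nd : nat -> 'M[R[i]]_n)
    (hW : increasing_filtration W)
    (hQ : graded_forms W Q)
    (hadm : admissible_nilpotent_orbit W Q h N F M)
    (hsplit : split_mhs F M)
    (hY : deligne_grading (cxf W) (cx N) (deligne_Y F M) Y)
    (hNd : ad_decomposition Y (cx N) k Nd)
    (hk : Nd k != 0) :
  let normN (z : R[i]) : R := mhnorm (orbit_at N F z) W Q (cx N) in
  let bounded_at_infinity : Prop :=
    exists B y0 : R, forall x y : R, y0 < y -> normN (x +i* y)%C <= B in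
  [/\ forall x y : R, in_D W Q h (orbit_at N F (x +i* y)%C) ->
        normN (x +i* y)%C = normN (0 +i* y)%C,
      exists K : R, K != 0 /\
        (y `^ ((2%:R - k%:R) / 2%:R) * normN (0 +i* y)%C) @[y --> +oo] --> K,
      k = 2%N -> bounded_at_infinity
    & (2 < k)%N -> ~ bounded_at_infinity].
Proof.
have [s [e [sY [eY [E [LD YE]]]]]] := limit_data_exists hW hadm hsplit hY; rewrite YE in hNd.
have [[hN [m Nm]] _ _ _ [y0 hD]] := hadm.
have [tau [tk tauE]] := norm_formula LD hW hQ hN Nm hNd hk hD.
move=> normN bounded_at_infinity.
have real_part (x y : R) : in_D W Q h (orbit_at N F (x +i* y)%C) ->
    normN (x +i* y)%C = normN (0 +i* y)%C.
  have -> : (x +i* y)%C = (0 +i* y)%C + x%:C%C :> R[i].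
    by apply/eqP; rewrite eq_complex /= add0r addr0 !eqxx.
  by move=> inD; exact: (norm_translate hN Nm inD).
split=> //.
- exists (Num.sqrt (tau k)); split; first by rewrite gt_eqF // sqrtr_gt0.
  exact: scaled_norm_cvg tauE.
- move=> k2; have [B [y1 hB]] := norm_bounded tauE k2.
  exists B, (Num.max y0 y1) => x y; rewrite gt_max => /andP[y0y y1y].
  by rewrite real_part ?hB //; exact: hD.
- move=> k2 [B [y1 hB]]; apply: (norm_unbounded tk tauE k2).
  by exists B, y1 => y; exact: hB.
Qed.
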